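(* Let $T>0$ and let $q\in L^2([0,T],\mathbb{C})$ be a finite gap potential. Then $q$ extends to a finite gap potential on $\mathbb{R}$ which is smooth and is periodic with period $T$.
   Context: For $q\in L^2([0,T],\mathbb{C})$ let $F(t,\lambda)$, $\lambda\in\mathbb{C}$, solve $\frac{d}{dt}F=F\alpha$, $F(0,\lambda)=\mathbb{1}$, with $\alpha=\frac12\begin{pmatrix}\mathbf{i}\lambda&q\\-\bar q&-\mathbf{i}\lambda\end{pmatrix}$, and let $M(\lambda)=F(T,\lambda)=\begin{pmatrix}a&b\\c&d\end{pmatrix}(\lambda)$ (called the monodromy), with entire entries and determinant $1$; put $\Delta=\mathrm{tr}\,M$. The spectral curve is $\Sigma=\{(\lambda,\mu)\in\mathbb{C}^2:\mu^2-\Delta(\lambda)\mu+1=0\}$. The eigenlines of $M$ form a holomorphic line bundle on a partial desingularisation $\widehat\Sigma$ of $\Sigma$ (the one whose structure sheaf is the endomorphism sheaf of the eigen-sheaf), explicitly $\widehat\Sigma=\{\nu^2=(\Delta(\lambda)^2-4)/(4p(\lambda)^2)\}$, where $p$ is an entire function which is a greatest common divisor of $a-d,b,c$. The potential $q$ is called finite gap if it is stationary under all but finitely many flows of the nonlinear Schrödinger hierarchy; equivalently (use this as definition) $\widehat\Sigma$ has finite arithmetic genus after compactification, i.e. the entire function $(\Delta^2-4)/p^2$ has only finitely many zeros counted with multiplicity. (As usual elements of $L^2$ are identified when equal almost everywhere.) *)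

(* Defs.v *)
From mathcomp Require Import all_boot all_order all_algebra.
From mathcomp Require Import all_classical all_reals all_analysis.
From mathcomp Require Import complex.

Set Implicit Arguments.
Unset Strict Implicit.
Unset Printing Implicit Defensive.

Import Order.TTheory GRing.Theory Num.Theory.
Import numFieldNormedType.Exports.

Local Open Scope classical_set_scope.
Local Open Scope ring_scope.
Local Open Scope complex_scope.

(* A potential is a function [R -> R[i]]; for a potential on [0, T] the values
   outside [0, T] are irrelevant. *)

Definition L2_potential (R : realType) (T : R) (q : R -> R[i]) : Prop :=
  [/\ measurable_fun `[0, T] (fun t => complex.Re (q t)),
      measurable_fun `[0, T] (fun t => complex.Im (q t)) &
      (@lebesgue_measure R).-integrable `[0, T]
        (EFin \o (fun t => complex.Re (q t) ^+ 2 + complex.Im (q t) ^+ 2))].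

(* Lebesgue integral of a complex-valued function over [a, b]. *)
Definition Cintegral (R : realType) (a b : R) (f : R -> R[i]) : R[i] :=
  (\int[@lebesgue_measure R]_(s in `[a, b]) complex.Re (f s)) +i*
  (\int[@lebesgue_measure R]_(s in `[a, b]) complex.Im (f s)).

Definition alpha (R : realType) (q : R -> R[i]) (t : R) (l : R[i]) :
    'M[R[i]]_2 :=
  2^-1 *: \matrix_(i < 2, j < 2)
    (if i == 0 then (if j == 0 then 'i%C * l else q t)
     else (if j == 0 then - (q t)^*%C else - ('i%C * l))).

(* Solution on [0, T] of dF/dt = F alpha, F(0) = 1, in the sense of
   Caratheodory: as q is only L^2, the equation holds in integrated form. *)
Definition frame_solution (R : realType) (T : R) (q : R -> R[i]) (l : R[i])
    (F : R -> 'M[R[i]]_2) : Prop :=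
  forall i j : 'I_2,
    [/\ {within `[0, T], continuous (fun t => complex.Re (F t i j))},
        {within `[0, T], continuous (fun t => complex.Im (F t i j))} &
        forall t, 0 <= t <= T ->
          F t i j = 1%:M i j
                    + Cintegral 0 t (fun s => (F s *m alpha q s l) i j)].

(* [R[i]^o] carries the structure of normed space over the field R[i], so that
   this is complex differentiability. *)
Definition entire (R : realType) (f : R[i] -> R[i]) : Prop :=
  forall z : R[i], derivable (f : R[i]^o -> R[i]^o) z 1.

Definition entire_dvd (R : realType) (f g : R[i] -> R[i]) : Prop :=
  exists2 h : R[i] -> R[i], entire h & forall z, g z = f z * h z.

(* Greatest common divisor of f1, f2, f3 in the ring of entire functions. *)
Definition entire_gcd3 (R : realType) (p f1 f2 f3 : R[i] -> R[i]) : Prop :=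
  [/\ entire p,
      [/\ entire_dvd p f1, entire_dvd p f2 & entire_dvd p f3] &
      forall e, entire e ->
        entire_dvd e f1 -> entire_dvd e f2 -> entire_dvd e f3 ->
        entire_dvd e p].

(* A zero z of multiplicity m contributes the m pairs (z, 0), ..., (z, m - 1);
   the zero function has infinitely many zeros. *)
Definition finitely_many_zeros (R : realType) (f : R[i] -> R[i]) : Prop :=
  finite_set [set zk : R[i] * nat |
    entire_dvd (fun l => (l - zk.1) ^+ zk.2.+1) f].

(* The function g below is (Delta^2 - 4) / p^2. *)
Definition finite_gap (R : realType) (T : R) (q : R -> R[i]) : Prop :=
  exists2 F : R -> R[i] -> 'M[R[i]]_2,
    forall l, frame_solution T q l (fun t => F t l) &
    let M := F T in
    exists p g : R[i] -> R[i],
      [/\ entire_gcd3 p (fun l => M l 0 0 - M l 1 1)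
                        (fun l => M l 0 1) (fun l => M l 1 0),
          exists l, p l != 0,
          entire g,
          forall l, (\tr (M l)) ^+ 2 - 4 = g l * p l ^+ 2 &
          finitely_many_zeros g].

Definition smooth (R : realType) (q : R -> R[i]) : Prop :=
  forall (n : nat) (t : R),
    derivable (derive1n n (fun s => complex.Re (q s))) t 1 /\
    derivable (derive1n n (fun s => complex.Im (q s))) t 1.

(* For a T-periodic potential on the line: finite gap on every period interval
   [x, x + T]. *)
Definition finite_gap_line (R : realType) (T : R) (q : R -> R[i]) : Prop :=
  forall x : R, finite_gap T (fun t => q (x + t)).

(* Main.v *)
Require Import Defs.
From mathcomp Require Import all_boot all_order all_algebra.
From mathcomp Require Import all_classical all_reals all_analysis.
From mathcomp Require Import measurable_realfun complex.
From mathcomp Require Import ring lra.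

(** Write [N := (M - Delta / 2) / p], an entire matrix, and [g := (Delta^2 - 4) / p^2].
Having finitely many zeros, [g] is [P u] with [P] a polynomial and [u] entire
without zeros.  For a nonzero entry [w] of [N], the matrix
[zeta(t) := (w / u) F(t)^-1 N F(t)] is entire in [lambda] and satisfies the Lax
equation [zeta' = zeta alpha - alpha zeta].  By Gronwall's inequality [p w] and the
entries of [F(t)^-1 (p N) F(t)] are [O(e^(|Im lambda| T / 2))], while by the
Riemann-Lebesgue lemma [|Delta^2 - 4| >= e^(|Im lambda| T) / 4] on the boundary of
the squares of half side [(2 n + 1) pi / T], [n] large.  Hence [zeta = O(P)] there,
and [zeta(t)] is a polynomial in [lambda] by Liouville's theorem.  Comparing
coefficients in the Lax equation, [q] is almost everywhere a constant multiple of a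
coefficient of [zeta], so that the coefficients of [zeta] solve a polynomial
differential equation and are smooth.  They extend periodically because
[zeta(T) = zeta(0)], as [N] commutes with [M = F(T)].  Finally, the monodromy from
another base point [x] is [F(x)^-1 M F(x)], which has the same [p] and [g]. *)

Set Implicit Arguments.
Unset Strict Implicit.
Unset Printing Implicit Defensive.

Import Order.TTheory GRing.Theory Num.Theory.
Import numFieldNormedType.Exports.

Local Open Scope classical_set_scope.
Local Open Scope ring_scope.
Local Open Scope complex_scope.

(** * Complex numbers and complex-valued curves *)

(** The growth of [p], of [u] and of [N], taken separately, is unknown. The factor [w / u] makes
    these unknowns cancel: for an entry [f] of [F(t)^-1 N F(t)] one has
    [(w / u) f (Delta^2 - 4) = P (p w) (p f)], where both brackets have controlled exponential
    growth and their product is no larger than a multiple of [P (Delta^2 - 4)] allows. As [w / u]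
    does not depend on [t], it harms neither the Lax equation nor the periodicity. Because
    [Delta^2 - 4] has zeros, a lower bound can hold only on chosen contours. Squares are convenient:
    their vertical sides can be put where the cosine in the leading term equals -1, and Cauchy's
    theorem then needs integrals over segments only. The other obstacle is that [q] is at first
    merely integrable. Differential equations are therefore carried as integral identities ([prim]),
    with a product rule proved at that level, and derivatives of the unknowns appear only once [q]
    has been recovered from continuous coefficients. *)

Section ComplexNorm.
Context {R : realType}.
Implicit Types (z w : R[i]) (x : R).

(* The norm of R[i] in MathComp takes its values in R[i]; nc is real-valued. *)
Definition nc z : R := ComplexField.Normc.normc z.

Lemma normr_nc z : `|z| = (nc z)%:C.
Proof. by []. Qed.

Lemma nc_ge0 z : 0 <= nc z.
Proof. by case: z => a b; exact: sqrtr_ge0. Qed.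

Lemma nc0 : nc (0 : R[i]) = 0.
Proof. exact: ComplexField.Normc.normc0. Qed.

Lemma nc1 : nc (1 : R[i]) = 1.
Proof. exact: ComplexField.Normc.normc1. Qed.

Lemma ncM z w : nc (z * w) = nc z * nc w.
Proof. exact: ComplexField.Normc.normcM. Qed.

Lemma ncV z : nc z^-1 = (nc z)^-1.
Proof. exact: ComplexField.Normc.normcV. Qed.

Lemma ncX z n : nc (z ^+ n) = nc z ^+ n.
Proof. by elim: n => [|n IH]; rewrite ?expr0 ?nc1// !exprS ncM IH. Qed.

Lemma ncN z : nc (- z) = nc z.
Proof. by case: z => a b; rewrite /nc /= !sqrrN. Qed.

Lemma ncD z w : nc (z + w) <= nc z + nc w.
Proof. by rewrite -lecR rmorphD/= -!normr_nc; exact: ler_normD. Qed.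

Lemma ncB z w : nc (z - w) <= nc z + nc w.
Proof. by rewrite -(ncN w) ncD. Qed.

Lemma nc_sub z w : nc (z - w) = nc (w - z).
Proof. by rewrite -ncN opprB. Qed.

Lemma nc_lb z w : nc z - nc w <= nc (z + w).
Proof. by rewrite lerBlDr -[X in nc X <= _](addrK w) ncB. Qed.

Lemma nc_eq0 z : (nc z == 0) = (z == 0).
Proof.
apply/eqP/eqP => [/ComplexField.Normc.eq0_normc//|->]; exact: nc0.
Qed.

Lemma nc_gt0 z : (0 < nc z) = (z != 0).
Proof. by rewrite lt_def nc_ge0 andbT nc_eq0. Qed.

Lemma nc_real x : nc x%:C = `|x|.
Proof. by rewrite /nc /= expr0n /= addr0 sqrtr_sqr. Qed.

Lemma nc_i : nc ('i%C : R[i]) = 1.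
Proof. by rewrite /nc /= expr0n/= expr1n add0r sqrtr1. Qed.

Lemma nc_nat n : nc (n%:R : R[i]) = n%:R.
Proof. by rewrite -(rmorph_nat (real_complex R)) nc_real ger0_norm. Qed.

Lemma nc_Re z : `|complex.Re z| <= nc z.
Proof.
by case: z => a b; rewrite /nc /= -sqrtr_sqr ler_wsqrtr // lerDl sqr_ge0.
Qed.

Lemma nc_Im z : `|complex.Im z| <= nc z.
Proof.
by case: z => a b; rewrite /nc /= -sqrtr_sqr ler_wsqrtr // lerDr sqr_ge0.
Qed.

Lemma nc_sqr z : nc z ^+ 2 = complex.Re z ^+ 2 + complex.Im z ^+ 2.
Proof. by case: z => a b; rewrite /nc /= sqr_sqrtr// addr_ge0// sqr_ge0. Qed.

Lemma nc_le z : nc z <= `|complex.Re z| + `|complex.Im z|.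
Proof.
rewrite [z in leLHS]complexE (le_trans (ncD _ _))//.
by rewrite ncM nc_i mul1r !nc_real.
Qed.

Lemma ReD z w : complex.Re (z + w) = complex.Re z + complex.Re w.
Proof. by case: z w => [a b] [c d]. Qed.

Lemma ImD z w : complex.Im (z + w) = complex.Im z + complex.Im w.
Proof. by case: z w => [a b] [c d]. Qed.

Lemma ReN z : complex.Re (- z) = - complex.Re z.
Proof. by case: z. Qed.

Lemma ImN z : complex.Im (- z) = - complex.Im z.
Proof. by case: z. Qed.

Lemma ReM z w : complex.Re (z * w) =
  complex.Re z * complex.Re w - complex.Im z * complex.Im w.
Proof. by case: z w => [a b] [c d]. Qed.

Lemma ImM z w : complex.Im (z * w) =
  complex.Re z * complex.Im w + complex.Im z * complex.Re w.
Proof. by case: z w => [a b] [c d]. Qed.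

Lemma ReJ z : complex.Re z^*%C = complex.Re z.
Proof. by case: z. Qed.

Lemma ImJ z : complex.Im z^*%C = - complex.Im z.
Proof. by case: z. Qed.

Lemma complexP z w : complex.Re z = complex.Re w ->
  complex.Im z = complex.Im w -> z = w.
Proof. by case: z w => [a b] [c d] /= -> ->. Qed.

Lemma conjCD z w : (z + w)^*%C = z^*%C + w^*%C.
Proof. exact: rmorphD. Qed.

Lemma conjCB z w : (z - w)^*%C = z^*%C - w^*%C.
Proof. exact: rmorphB. Qed.

Lemma conjCN z : (- z)^*%C = - z^*%C.
Proof. exact: rmorphN. Qed.

Lemma conjCM z w : (z * w)^*%C = z^*%C * w^*%C.
Proof. exact: rmorphM. Qed.

Lemma conjCi : ('i%C)^*%C = - 'i%C :> R[i].
Proof. by apply: complexP; rewrite /= ?oppr0. Qed.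

Lemma conjC_half : (2^-1)^*%C = 2^-1 :> R[i].
Proof. by rewrite conjc_inv conjc_nat. Qed.

End ComplexNorm.

Definition conjCE := (@conjCD, @conjCB, @conjCN, @conjCM, @conjCi, @conjC_half,
  @conjcK).

Definition ReImE := (@ReD, @ImD, @ReN, @ImN, @ReM, @ImM, @ReJ, @ImJ).

Section CurveContinuity.
Context {R : realType}.
Implicit Types (f g : R -> R[i]) (a b e t K : R).

(** Continuity is asked on the whole line, so that no subspace topology has to be carried along;
    curves given on [[0, T]] are first made constant outside it with [clamp]. *)
Definition ccont f : Prop := continuous (fun t => complex.Re (f t)) /\
  continuous (fun t => complex.Im (f t)).

Lemma ccontP f : ccont f <-> forall t e, 0 < e ->
  exists2 d : R, 0 < d & forall s, `|s - t| < d -> nc (f s - f t) < e.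
Proof.
split=> [[fr fi] t e e0|H].
  have e20 : 0 < e / 2 by lra.
  have /cvgrPdist_lt/(_ _ e20)/nbhs_ballP[d1 /= d10 H1] := fr t.
  have /cvgrPdist_lt/(_ _ e20)/nbhs_ballP[d2 /= d20 H2] := fi t.
  exists (Num.min d1 d2) => [|s]; first by rewrite lt_min d10.
  rewrite lt_min => /andP[s1 s2].
  have := H1 s; rewrite /ball /= distrC => /(_ s1) K1.
  have := H2 s; rewrite /ball /= distrC => /(_ s2) K2.
  rewrite (le_lt_trans (nc_le _))// !ReImE [e]splitr.
  by rewrite ltrD// distrC.
split=> t; apply/cvgrPdist_lt => e e0; have [d d0 Hd] := H t e e0;
  apply/nbhs_ballP; exists d => //= s; rewrite /ball /= distrC => /Hd;
  rewrite nc_sub; apply: le_lt_trans.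
  by rewrite -ReN -ReD nc_Re.
by rewrite -ImN -ImD nc_Im.
Qed.

Lemma ccont_cst c : ccont (fun=> c).
Proof. by split; exact: cst_continuous. Qed.

Lemma ccontD f g : ccont f -> ccont g -> ccont (fun t => f t + g t).
Proof.
move=> [f1 f2] [g1 g2]; split => t.
  under eq_fun do rewrite ReD; apply: cvgD; [exact: f1|exact: g1].
under eq_fun do rewrite ImD; apply: cvgD; [exact: f2|exact: g2].
Qed.

Lemma ccontN f : ccont f -> ccont (fun t => - f t).
Proof.
move=> [f1 f2]; split => t.
  under eq_fun do rewrite ReN; apply: cvgN; exact: f1.
under eq_fun do rewrite ImN; apply: cvgN; exact: f2.
Qed.

Lemma ccontB f g : ccont f -> ccont g -> ccont (fun t => f t - g t).
Proof. by move=> cf cg; apply: ccontD => //; exact: ccontN. Qed.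

Lemma ccontM f g : ccont f -> ccont g -> ccont (fun t => f t * g t).
Proof.
move=> [f1 f2] [g1 g2]; split => t.
  under eq_fun do rewrite ReM.
  by apply: cvgB; apply: cvgM; [exact: f1|exact: g1|exact: f2|exact: g2].
under eq_fun do rewrite ImM.
by apply: cvgD; apply: cvgM; [exact: f1|exact: g2|exact: f2|exact: g1].
Qed.

Lemma ccontJ f : ccont f -> ccont (fun t => (f t)^*%C).
Proof.
move=> [f1 f2]; split => t.
  under eq_fun do rewrite ReJ; exact: f1.
under eq_fun do rewrite ImJ; apply: cvgN; exact: f2.
Qed.

Lemma ccont_real (h : R -> R) : continuous h -> ccont (fun t => (h t)%:C).
Proof. by move=> ch; split => t; [exact: ch|exact: cst_continuous]. Qed.

Lemma ccont_comp (h : R -> R) f : continuous h -> ccont f ->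
  ccont (fun t => f (h t)).
Proof.
move=> ch [f1 f2]; split => t.
  exact: (cvg_comp _ _ (ch t) (f1 (h t))).
exact: (cvg_comp _ _ (ch t) (f2 (h t))).
Qed.

Lemma ccont_bounded f a b : ccont f -> exists2 K : R, 0 < K &
  forall t, a <= t <= b -> nc (f t) <= K.
Proof.
move=> [f1 f2].
have bnd (h : R -> R) : continuous h ->
    exists2 K : R, 0 < K & forall t, a <= t <= b -> `|h t| <= K.
  move=> ch; have := @segment_compact R a b.
  move=> /(@continuous_compact _ _ h _ (continuous_subspaceT ch)).
  move=> /compact_bounded[M [_ HM]].
  exists (`|M| + 1) => [|t tab]; first by rewrite ltr_wpDl.
  apply: (HM (`|M| + 1)); first by rewrite (le_lt_trans (ler_norm _))// ltrDl.
  by exists t => //=; rewrite in_itv.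
have [K1 K10 H1] := bnd _ f1; have [K2 K20 H2] := bnd _ f2.
exists (K1 + K2) => [|t tab]; first by rewrite addr_gt0.
by rewrite (le_trans (nc_le _))// lerD// ?H1// H2.
Qed.

Lemma ccont_unif f a b e : ccont f -> 0 < e -> exists2 d : R, 0 < d &
  forall s t, a <= s <= b -> a <= t <= b -> `|s - t| < d -> nc (f s - f t) < e.
Proof.
move=> /ccontP cf e0.
have e20 : 0 < e / 2 by lra.
have : compact `[a, b] by exact: segment_compact.
rewrite compact_cover.
have /choice[D HD] : forall t, exists d : R, 0 < d /\
    forall s, `|s - t| < d -> nc (f s - f t) < e / 2.
  by move=> t; have [d d0 Hd] := cf t _ e20; exists d.
have D0 t : 0 < D t by have [] := HD t.
have DP t s : `|s - t| < D t -> nc (f s - f t) < e / 2.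
  by have [_] := HD t; apply.
move=> /(_ R `[a, b]%classic (fun t => ball t (D t / 2)))[].
- by move=> t _; exact: ball_open.
- by move=> t tab; exists t => //; apply: ballxx; rewrite divr_gt0.
move=> G GS cov.
(* A Lebesgue number of the finite subcover: the balls have half radii, so that a point this close
   to one of the half balls still lies in the full ball. *)
exists (\big[Num.min/1]_(i <- finmap.enum_fset G) (D i / 2)).
  elim/big_ind: _ => // [x y x0 y0|i _]; first by rewrite lt_min x0.
  by rewrite divr_gt0.
move=> s t sab tab; rewrite distrC => st.
have := cov s; rewrite /= in_itv/= => /(_ sab)[i iG].
rewrite /ball /= distrC => si.
have Di : `|t - s| < D i / 2.
  apply: lt_le_trans st _.
  have {iG} : i \in finmap.enum_fset G by exact: iG.
  by elim: (finmap.enum_fset G) => // j r IH;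
     rewrite big_cons inE => /predU1P[<-|/IH jr]; rewrite ge_min ?lexx// jr orbT.
have -> : f s - f t = (f s - f i) - (f t - f i) by ring.
rewrite (le_lt_trans (ncB _ _))// [e]splitr ltrD// DP//.
  by rewrite (lt_le_trans si)// ler_piMr ?(ltW (D0 _))//; lra.
rewrite [X in `|X|](_ : _ = (t - s) + (s - i)); last by ring.
by rewrite (le_lt_trans (ler_normD _ _))// [D i]splitr ltrD.
Qed.

End CurveContinuity.

(** * Integrals on segments *)

Section RealIntegral.
Context {R : realType}.
Implicit Types (f g h F : R -> R) (a b c d K k t : R).
Local Notation mu := (@lebesgue_measure R).

Definition rin a b f : Prop := mu.-integrable `[a, b] (EFin \o f).

Lemma rin_sub a b c d f : a <= c -> d <= b -> rin a b f -> rin c d f.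
Proof.
move=> ac db; apply: integrableS => //.
move=> x /=; rewrite !in_itv/= => /andP[cx xd].
by rewrite (le_trans ac)// (le_trans xd).
Qed.

Lemma rin_ext a b f g : (forall t, a <= t <= b -> f t = g t) ->
  rin a b f -> rin a b g.
Proof.
move=> fg; apply: eq_integrable => // t; rewrite inE/= in_itv/= => tab.
by rewrite /= fg.
Qed.

Lemma rint_ext a b f g : (forall t, a <= t <= b -> f t = g t) ->
  \int[mu]_(s in `[a, b]) f s = \int[mu]_(s in `[a, b]) g s.
Proof.
move=> fg; apply: eq_Rintegral => t; rewrite inE/= in_itv/= => tab.
exact: fg.
Qed.

Lemma rinD a b f g : rin a b f -> rin a b g -> rin a b (fun t => f t + g t).
Proof. by move=> fi gi; exact: (integrableD _ fi gi). Qed.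

Lemma rinZ a b k f : rin a b f -> rin a b (fun t => k * f t).
Proof. by move=> fi; exact: (integrableZl _ k fi). Qed.

Lemma rinN a b f : rin a b f -> rin a b (fun t => - f t).
Proof. by move=> /(rinZ (-1)); apply: rin_ext => t _; rewrite mulN1r. Qed.

Lemma rinB a b f g : rin a b f -> rin a b g -> rin a b (fun t => f t - g t).
Proof. by move=> fi gi; apply: rinD => //; exact: rinN. Qed.

Lemma rin_cont a b f : continuous f -> rin a b f.
Proof.
move=> cf; apply: continuous_compact_integrable; first exact: segment_compact.
exact: continuous_subspaceT.
Qed.

Lemma rinM a b f h : rin a b f -> continuous h -> rin a b (fun t => f t * h t).
Proof.
move=> fi ch.
have mh : measurable_fun (`[a, b] : set R) h.
  exact: (measurable_funTS (continuous_measurable_fun ch)).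
have bh : [bounded h x | x in `[a, b]].
  have := @segment_compact R a b.
  move=> /(@continuous_compact _ _ h _ (continuous_subspaceT ch)).
  move=> /compact_bounded[M [? HM]]; exists M; split => // x xM y yab.
  by apply: HM => //; exists y.
exact: (integrableMl _ fi mh bh).
Qed.

Lemma rin_norm a b f : rin a b f -> rin a b (fun t => `|f t|).
Proof. exact: integrable_norm. Qed.

Lemma rintD a b f g : rin a b f -> rin a b g ->
  \int[mu]_(s in `[a, b]) (f s + g s) =
  \int[mu]_(s in `[a, b]) f s + \int[mu]_(s in `[a, b]) g s.
Proof. by move=> fi gi; exact: RintegralD. Qed.

Lemma rintZ a b k f : rin a b f ->
  \int[mu]_(s in `[a, b]) (k * f s) = k * \int[mu]_(s in `[a, b]) f s.
Proof. by move=> fi; exact: RintegralZl. Qed.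

Lemma rintB a b f g : rin a b f -> rin a b g ->
  \int[mu]_(s in `[a, b]) (f s - g s) =
  \int[mu]_(s in `[a, b]) f s - \int[mu]_(s in `[a, b]) g s.
Proof. by move=> fi gi; exact: RintegralB. Qed.

Lemma rint_split a b c f : a <= c <= b -> rin a b f ->
  \int[mu]_(s in `[a, b]) f s =
  \int[mu]_(s in `[a, c]) f s + \int[mu]_(s in `[c, b]) f s.
Proof.
move=> /andP[ac cb] fi.
have := @Rintegral_itvB R f (BLeft a) (BRight b) c fi.
rewrite !bnd_simp => /(_ ac cb) H.
rewrite -(@Rintegral_itv_obnd_cbnd _ c (BRight b)).
  by rewrite -H addrC subrK.
by apply: integrableS fi => //; apply: subset_itvr; rewrite bnd_simp.
Qed.

Lemma rint_pt a f : \int[mu]_(s in `[a, a]) f s = 0.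
Proof. by rewrite set_itv1 Rintegral_set1. Qed.

Lemma rint_cst a b k : a <= b -> \int[mu]_(s in `[a, b]) k = k * (b - a).
Proof.
move=> ab; rewrite Rintegral_cst//.
transitivity (k * fine (if a%:E < b%:E then b%:E - a%:E else 0)%E).
  congr (_ * fine _); exact: (lebesgue_measure_itv `[a, b]).
rewrite lte_fin.
case: ltP => [_|ba]; first by rewrite -EFinD.
have -> : a = b by apply/eqP; rewrite eq_le ab.
by rewrite subrr.
Qed.

Lemma rint_le a b f g : rin a b f -> rin a b g ->
  (forall t, a <= t <= b -> f t <= g t) ->
  \int[mu]_(s in `[a, b]) f s <= \int[mu]_(s in `[a, b]) g s.
Proof.
move=> fi gi fg; apply: le_Rintegral => // t /=; rewrite in_itv/=; exact: fg.
Qed.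

Lemma rint_ge0 a b f : (forall t, a <= t <= b -> 0 <= f t) ->
  0 <= \int[mu]_(s in `[a, b]) f s.
Proof.
by move=> f0; apply: Rintegral_ge0 => t /=; rewrite in_itv/=; exact: f0.
Qed.

Lemma rint_norm a b f : rin a b f ->
  `|\int[mu]_(s in `[a, b]) f s| <= \int[mu]_(s in `[a, b]) `|f s|.
Proof. by move=> fi; exact: le_normr_Rintegral. Qed.

Lemma derivable_continuous F : (forall t, derivable F t 1) -> continuous F.
Proof.
by move=> dF t; apply: differentiable_continuous; apply/derivable1_diffP.
Qed.

Lemma rint_FTC2 a b f F : a <= b -> continuous f ->
  (forall t, is_derive t 1 F (f t)) ->
  \int[mu]_(s in `[a, b]) f s = F b - F a.
Proof.
rewrite le_eqVlt => /predU1P[<- _ _|ab cf dF]; first by rewrite rint_pt subrr.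
have cF : continuous F.
  by apply: derivable_continuous => t; have [] := dF t.
rewrite /Rintegral (@continuous_FTC2 _ f F)//.
- exact: continuous_subspaceT.
- split.
  + by move=> x _; have [] := dF x.
  + by apply: cvg_at_right_filter; exact: cF.
  + by apply: cvg_at_left_filter; exact: cF.
- by move=> x _; rewrite derive1E; apply: derive_val.
Qed.

End RealIntegral.

Section ComplexIntegral.
Context {R : realType}.
Implicit Types (f g h : R -> R[i]) (a b c d K t : R) (k : R[i]).
Local Notation mu := (@lebesgue_measure R).

Definition cin a b f : Prop :=
  rin a b (fun t => complex.Re (f t)) /\ rin a b (fun t => complex.Im (f t)).

Lemma cin_sub a b c d f : a <= c -> d <= b -> cin a b f -> cin c d f.
Proof. by move=> ac db [f1 f2]; split; exact: (rin_sub ac db). Qed.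

Lemma cin_ext a b f g : (forall t, a <= t <= b -> f t = g t) ->
  cin a b f -> cin a b g.
Proof.
by move=> fg [f1 f2]; split; [move: f1|move: f2]; apply: rin_ext => t tab;
  rewrite fg.
Qed.

Lemma CI_ext a b f g : (forall t, a <= t <= b -> f t = g t) ->
  Cintegral a b f = Cintegral a b g.
Proof.
by move=> fg; rewrite /Cintegral; congr (_ +i* _); apply: rint_ext => t tab;
  rewrite fg.
Qed.

Lemma cin_cont a b f : ccont f -> cin a b f.
Proof. by move=> [f1 f2]; split; exact: rin_cont. Qed.

Lemma cinD a b f g : cin a b f -> cin a b g -> cin a b (fun t => f t + g t).
Proof.
move=> [f1 f2] [g1 g2]; split.
  by apply: rin_ext (rinD f1 g1) => t _; rewrite ReD.
by apply: rin_ext (rinD f2 g2) => t _; rewrite ImD.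
Qed.

Lemma cinM a b f h : cin a b f -> ccont h -> cin a b (fun t => f t * h t).
Proof.
move=> [f1 f2] [h1 h2]; split.
  by apply: rin_ext (rinB (rinM f1 h1) (rinM f2 h2)) => t _; rewrite ReM.
by apply: rin_ext (rinD (rinM f1 h2) (rinM f2 h1)) => t _; rewrite ImM.
Qed.

Lemma cinZ a b k f : cin a b f -> cin a b (fun t => k * f t).
Proof.
move=> fi; apply: cin_ext (cinM fi (ccont_cst k)) => t _; exact: mulrC.
Qed.

Lemma cinN a b f : cin a b f -> cin a b (fun t => - f t).
Proof. by move=> /(cinZ (-1)); apply: cin_ext => t _; rewrite mulN1r. Qed.

Lemma cinB a b f g : cin a b f -> cin a b g -> cin a b (fun t => f t - g t).
Proof. by move=> fi gi; apply: cinD => //; exact: cinN. Qed.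

Lemma cinJ a b f : cin a b f -> cin a b (fun t => (f t)^*%C).
Proof.
move=> [f1 f2]; split; first by apply: rin_ext f1 => t _; rewrite ReJ.
by apply: rin_ext (rinN f2) => t _; rewrite ImJ.
Qed.

Lemma CID a b f g : cin a b f -> cin a b g ->
  Cintegral a b (fun t => f t + g t) = Cintegral a b f + Cintegral a b g.
Proof.
move=> [f1 f2] [g1 g2]; apply: complexP; rewrite !ReImE /=.
  by rewrite -rintD//; apply: rint_ext => t _; rewrite ReD.
by rewrite -rintD//; apply: rint_ext => t _; rewrite ImD.
Qed.

Lemma CIZ a b k f : cin a b f ->
  Cintegral a b (fun t => k * f t) = k * Cintegral a b f.
Proof.
move=> [f1 f2]; apply: complexP; rewrite !ReImE /=; rewrite -!rintZ//.
  by rewrite -rintB; [apply: rint_ext => t _; rewrite ReM|exact: rinZ..].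
by rewrite -rintD; [apply: rint_ext => t _; rewrite ImM|exact: rinZ..].
Qed.

Lemma CIN a b f : cin a b f ->
  Cintegral a b (fun t => - f t) = - Cintegral a b f.
Proof.
by move=> fi; rewrite -mulN1r -CIZ//; apply: CI_ext => t _; rewrite mulN1r.
Qed.

Lemma CIB a b f g : cin a b f -> cin a b g ->
  Cintegral a b (fun t => f t - g t) = Cintegral a b f - Cintegral a b g.
Proof. by move=> fi gi; rewrite CID ?CIN//; exact: cinN. Qed.

Lemma CI_split a b c f : a <= c <= b -> cin a b f ->
  Cintegral a b f = Cintegral a c f + Cintegral c b f.
Proof.
move=> acb [f1 f2]; apply: complexP; rewrite ReImE /=; exact: rint_split.
Qed.

Lemma CI_pt a f : Cintegral a a f = 0.
Proof. by rewrite /Cintegral !rint_pt. Qed.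

Lemma CI_cst a b k : a <= b -> Cintegral a b (fun=> k) = k * (b - a)%:C.
Proof.
move=> ab; apply: complexP; rewrite ReImE /= rint_cst//; ring.
Qed.

Lemma CIJ a b f : cin a b f ->
  Cintegral a b (fun t => (f t)^*%C) = (Cintegral a b f)^*%C.
Proof.
move=> [f1 f2]; apply: complexP; rewrite ReImE /=.
  by apply: rint_ext => t _; rewrite ReJ.
by rewrite -mulN1r -rintZ//; apply: rint_ext => t _; rewrite ImJ mulN1r.
Qed.

(** Comparable with the integral of [nc (f s)], but made of two real integrals; passing from one to
    the other costs the factors 2 in the bounds below. *)
Definition L1norm a b f : R := \int[mu]_(s in `[a, b]) `|complex.Re (f s)| +
  \int[mu]_(s in `[a, b]) `|complex.Im (f s)|.

Lemma L1_ge0 a b f : 0 <= L1norm a b f.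
Proof. by rewrite addr_ge0//; apply: rint_ge0. Qed.

Lemma L1_split a b c f : a <= c <= b -> cin a b f ->
  L1norm a b f = L1norm a c f + L1norm c b f.
Proof.
move=> acb [f1 f2]; rewrite /L1norm.
rewrite (@rint_split _ a b c)//; last exact: rin_norm.
rewrite (@rint_split _ a b c (fun s => `|complex.Im (f s)|))//;
  last exact: rin_norm.
ring.
Qed.

Lemma L1_sub a b c d f : a <= c -> c <= d -> d <= b -> cin a b f ->
  L1norm c d f <= L1norm a b f.
Proof.
move=> ac cd db fi; rewrite (@L1_split a b c) ?ac ?(le_trans cd)//.
rewrite (@L1_split c b d) ?cd//; last exact: (cin_sub ac _ fi).
by rewrite addrCA ler_wpDr// addr_ge0// L1_ge0.
Qed.

Lemma nc_CI_L1 a b f : cin a b f -> nc (Cintegral a b f) <= L1norm a b f.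
Proof.
by move=> [f1 f2]; rewrite (le_trans (nc_le _))// lerD//= rint_norm.
Qed.

Lemma L1_le a b f h K : cin a b f -> cin a b h ->
  (forall t, a <= t <= b -> nc (h t) <= K * nc (f t)) ->
  L1norm a b h <= 2 * K * L1norm a b f.
Proof.
move=> [f1 f2] [h1 h2] hf.
have fi : rin a b (fun t => `|complex.Re (f t)| + `|complex.Im (f t)|).
  by apply: rinD; exact: rin_norm.
rewrite /L1norm -[X in _ <= _ * X]rintD; [|exact: rin_norm..].
have K0 t : a <= t <= b -> nc (h t) <= `|K| *
    (`|complex.Re (f t)| + `|complex.Im (f t)|).
  move=> tab; rewrite (le_trans (hf t tab))//.
  by rewrite (le_trans (ler_wpM2r (nc_ge0 _) (ler_norm K)))// ler_wpM2l// nc_le.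
have [K_ge0|K_lt0] := leP 0 K.
  rewrite -mulrA -rintZ// mulr_natl mulr2n.
  rewrite ger0_norm// in K0.
  apply: lerD; apply: rint_le; [exact: rin_norm|exact: rinZ| |exact: rin_norm
    |exact: rinZ|] => t tab; rewrite (le_trans _ (K0 t tab))//.
    exact: nc_Re.
  exact: nc_Im.
(* For [K < 0] the hypothesis forces [f] and [h] to vanish on the segment. *)
have f0 t : a <= t <= b -> nc (f t) = 0.
  move=> tab; apply/eqP; rewrite eq_le nc_ge0 andbT.
  by have := le_trans (nc_ge0 _) (hf t tab); rewrite nmulr_rge0.
have h0 t : a <= t <= b -> h t = 0.
  move=> tab; apply/eqP; rewrite -nc_eq0 eq_le nc_ge0 andbT.
  by rewrite (le_trans (hf t tab))// f0// mulr0.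
have ff0 t : a <= t <= b -> f t = 0 by move=> tab; apply/eqP; rewrite -nc_eq0 f0.
rewrite (@rint_ext _ _ _ _ (fun=> 0)); last by move=> t tab; rewrite h0//= normr0.
rewrite [X in _ + X](@rint_ext _ _ _ _ (fun=> 0)); last first.
  by move=> t tab; rewrite h0//= normr0.
rewrite [X in _ * X](@rint_ext _ _ _ _ (fun=> 0)); last first.
  by move=> t tab; rewrite ff0//= normr0 addr0.
by rewrite /Rintegral integral0 /= addr0 mulr0.
Qed.

Lemma nc_CIM_le a b f h K : cin a b f -> ccont h ->
  (forall t, a <= t <= b -> nc (h t) <= K) ->
  nc (Cintegral a b (fun t => f t * h t)) <= 2 * K * L1norm a b f.
Proof.
move=> fi ch hK; have fhi := cinM fi ch.
rewrite (le_trans (nc_CI_L1 fhi))//; apply: L1_le => // t tab.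
by rewrite ncM mulrC ler_wpM2r ?nc_ge0// hK.
Qed.

Lemma nc_CI_le a b f K : a <= b -> cin a b f ->
  (forall t, a <= t <= b -> nc (f t) <= K) ->
  nc (Cintegral a b f) <= 2 * K * (b - a).
Proof.
move=> ab fi fK; have c1 : cin a b (fun=> 1) by apply: cin_cont; exact: ccont_cst.
rewrite (le_trans (nc_CI_L1 fi))//.
have -> : b - a = L1norm a b (fun=> 1).
  by rewrite /L1norm /= !rint_cst// normr0 mul0r addr0 normr1 mul1r.
by apply: L1_le => // t tab; rewrite nc1 mulr1 fK.
Qed.

Definition cder f g : Prop := forall t,
  is_derive t 1 (fun s => complex.Re (f s)) (complex.Re (g t)) /\
  is_derive t 1 (fun s => complex.Im (f s)) (complex.Im (g t)).

Lemma CI_FTC2 a b f g : a <= b -> ccont g -> cder f g ->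
  Cintegral a b g = f b - f a.
Proof.
move=> ab [g1 g2] fg; apply: complexP; rewrite !ReImE /=.
  apply: (@rint_FTC2 _ a b _ (fun s => complex.Re (f s)) ab g1) => t.
  by have [] := fg t.
apply: (@rint_FTC2 _ a b _ (fun s => complex.Im (f s)) ab g2) => t.
by have [] := fg t.
Qed.

Lemma cder_ccont f g : cder f g -> ccont f.
Proof.
move=> fg; split.
  apply: (@derivable_continuous _ (fun s => complex.Re (f s))) => t.
  by have [[]] := fg t.
apply: (@derivable_continuous _ (fun s => complex.Im (f s))) => t.
by have [_ []] := fg t.
Qed.

End ComplexIntegral.

(** * Complex differentiability and Cauchy's theorem on squares *)

Section ComplexDerivative.
Context {R : realType}.
Implicit Types (f g : R[i] -> R[i]) (z w D : R[i]) (e d K : R).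

(** Complex differentiability with derivative [D], restated with the real-valued norm so that
    estimates become real inequalities. *)
Definition cdiff f z D : Prop := forall e, 0 < e -> exists2 d : R, 0 < d &
  forall w, nc (w - z) < d -> nc (f w - f z - D * (w - z)) <= e * nc (w - z).

Definition ccontC f z : Prop := forall e, 0 < e -> exists2 d : R, 0 < d &
  forall w, nc (w - z) < d -> nc (f w - f z) < e.

Lemma nbhsC_ballP z (P : set R[i]) : nbhs (z : R[i]^o) P <->
  exists2 d : R, 0 < d & forall w, nc (w - z) < d -> P w.
Proof.
split => [/nbhs_ballP[d /= d0 Hd]|[d d0 Hd]].
  have dr : d = (complex.Re d)%:C by rewrite RRe_real// gtr0_real.
  exists (complex.Re d); first by rewrite -ltcR -dr.
  by move=> w wz; apply: Hd; rewrite /ball /= dr normr_nc ltcR nc_sub.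
apply/nbhs_ballP; exists d%:C => /=; first by rewrite ltcR.
by move=> w; rewrite /ball /= normr_nc ltcR nc_sub => /Hd.
Qed.

Lemma derivableC_cdiff f z :
  derivable (f : R[i]^o -> R[i]^o) z 1 <-> exists D, cdiff f z D.
Proof.
split.
  move=> /cvg_ex[/= D fD]; exists D => e e0.
  have e0C : 0 < e%:C by rewrite ltcR.
  have := fD => /cvgrPdist_le /(_ _ e0C).
  rewrite /dnbhs /within /= => /nbhsC_ballP[d d0 Hd].
  exists d => // w wz; have [->|wz0] := eqVneq w z.
    by rewrite !subrr mulr0 subr0 nc0 mulr0.
  have := Hd (w - z); rewrite subr0 subr_eq0 => /(_ wz wz0).
  rewrite normr_nc lecR /GRing.scale /= mulr1 subrK => H.
  rewrite -[X in nc X]opprK ncN.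
  have -> : - (f w - f z - D * (w - z)) =
      (D - (w - z)^-1 * (f w - f z)) * (w - z).
    by rewrite mulrBl mulrAC mulVf ?subr_eq0// mul1r; ring.
  by rewrite ncM ler_wpM2r// nc_ge0.
move=> [D fD]; apply/cvg_ex; exists D; apply/cvgrPdist_le => /= e e0.
have er : e = (complex.Re e)%:C by rewrite RRe_real// gtr0_real.
have e0R : 0 < complex.Re e by rewrite -ltcR -er.
have [d d0 Hd] := fD _ e0R.
rewrite /dnbhs /within /=; apply/nbhsC_ballP; exists d => // h.
rewrite subr0 => hd h0; rewrite er normr_nc lecR /GRing.scale /= mulr1.
have := Hd (h + z); rewrite addrK => /(_ hd) H.
have h0' : 0 < nc h by rewrite nc_gt0.
rewrite -(ler_pM2r h0') -ncM; apply: le_trans H.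
rewrite -ncN.
have -> // : - ((D - h^-1 * (f (h + z) - f z)) * h) = f (h + z) - f z - D * h.
by rewrite mulrBl mulrAC mulVf// mul1r; ring.
Qed.

Lemma entireP f : entire f <-> forall z, exists D, cdiff f z D.
Proof. by split=> H z; apply/derivableC_cdiff. Qed.

Lemma cdiff_cont f z D : cdiff f z D -> ccontC f z.
Proof.
move=> fD e e0; have [d d0 Hd] := fD 1 ltr01.
have K0 : 0 < 1 + nc D + 1 by have := nc_ge0 D; lra.
exists (Num.min d (e / (1 + nc D + 1))) => [|w].
  by rewrite lt_min d0 divr_gt0.
rewrite lt_min => /andP[/Hd wd]; rewrite ltr_pdivlMr// => we.
apply: le_lt_trans we.
have -> : f w - f z = (f w - f z - D * (w - z)) + D * (w - z) by ring.
rewrite (le_trans (ncD _ _))// ncM.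
by have := nc_ge0 (w - z); have := nc_ge0 D; nra.
Qed.

Lemma ccont_compC f (h : R -> R[i]) : ccont h -> (forall t, ccontC f (h t)) ->
  ccont (fun t => f (h t)).
Proof.
move=> /ccontP ch cf; apply/ccontP => t e e0.
have [d d0 Hd] := cf t e e0; have [d' d'0 Hd'] := ch t d d0.
by exists d' => // s /Hd' /Hd.
Qed.

Lemma cdiff_quad f z D K d : 0 < d ->
  (forall w, nc (w - z) < d -> nc (f w - f z - D * (w - z)) <= K * nc (w - z) ^+ 2) ->
  cdiff f z D.
Proof.
move=> d0 H e e0; have K0 : 0 < `|K| + 1 by rewrite ltr_wpDl.
exists (Num.min d (e / (`|K| + 1))) => [|w].
  by rewrite lt_min d0 divr_gt0.
rewrite lt_min => /andP[/H wd]; rewrite ltr_pdivlMr// => we.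
apply: (le_trans wd); rewrite expr2 mulrA ler_wpM2r ?nc_ge0//.
rewrite (le_trans _ (ltW we))// mulrC ler_wpM2l ?nc_ge0//.
by rewrite (le_trans (ler_norm K))// lerDl.
Qed.

Lemma cdiff_ext f g z D d : 0 < d ->
  (forall w, nc (w - z) < d -> f w = g w) -> cdiff f z D -> cdiff g z D.
Proof.
move=> d0 fg fD e e0; have [d' d'0 Hd'] := fD e e0.
exists (Num.min d d') => [|w]; first by rewrite lt_min d0.
rewrite lt_min => /andP[wd wd']; rewrite -!fg ?subrr ?nc0//; exact: Hd'.
Qed.

Lemma entire_ext f g : f =1 g -> entire f -> entire g.
Proof. by move=> /funext ->. Qed.

Lemma entire_cst k : entire (fun=> k : R[i]).
Proof. by move=> z; exact: derivable_cst. Qed.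

Lemma entire_id : entire (@id R[i]).
Proof. by move=> z; exact: derivable_id. Qed.

Lemma entireD f g : entire f -> entire g -> entire (fun z => f z + g z).
Proof. by move=> ef eg z; exact: (derivableD (ef z) (eg z)). Qed.

Lemma entireN f : entire f -> entire (fun z => - f z).
Proof. by move=> ef z; exact: (derivableN (ef z)). Qed.

Lemma entireB f g : entire f -> entire g -> entire (fun z => f z - g z).
Proof. by move=> ef eg z; exact: (derivableB (ef z) (eg z)). Qed.

Lemma entireM f g : entire f -> entire g -> entire (fun z => f z * g z).
Proof. by move=> ef eg z; exact: (derivableM (ef z) (eg z)). Qed.

Lemma derivableC_V f z : f z != 0 ->
  derivable (f : R[i]^o -> R[i]^o) z 1 ->
  derivable ((fun z => (f z)^-1) : R[i]^o -> R[i]^o) z 1.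
Proof. by move=> fz df; exact: (derivableV fz df). Qed.

Lemma derivableC_M f g z : derivable (f : R[i]^o -> R[i]^o) z 1 ->
  derivable (g : R[i]^o -> R[i]^o) z 1 ->
  derivable ((fun w => f w * g w) : R[i]^o -> R[i]^o) z 1.
Proof. by move=> df dg; exact: (derivableM df dg). Qed.

Lemma derivableC_B f g z : derivable (f : R[i]^o -> R[i]^o) z 1 ->
  derivable (g : R[i]^o -> R[i]^o) z 1 ->
  derivable ((fun w => f w - g w) : R[i]^o -> R[i]^o) z 1.
Proof. by move=> df dg; exact: (derivableB df dg). Qed.

Lemma entireV f : (forall z, f z != 0) -> entire f ->
  entire (fun z => (f z)^-1).
Proof. by move=> f0 ef z; apply: derivableC_V. Qed.

Lemma entire_shift f w : entire f -> entire (fun z => f (z + w)).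
Proof.
move=> /entireP ef; apply/entireP => z; have [D fD] := ef (z + w).
exists D => e /fD[d d0 Hd]; exists d => // v vz.
have E : v + w - (z + w) = v - z by ring.
by have := Hd (v + w); rewrite E; apply.
Qed.

Lemma entire_cont f z : entire f -> ccontC f z.
Proof. by move=> /entireP /(_ z)[D]; exact: cdiff_cont. Qed.

End ComplexDerivative.

(** * Goursat's theorem by bisection *)

Section Bisection.
Context {R : realType}.
Implicit Types (a b c d : R).

Lemma nested_intervals (u v : nat -> R) : (forall n, u n <= u n.+1) ->
  (forall n, v n.+1 <= v n) -> (forall n, u n <= v n) ->
  exists x, forall n, u n <= x <= v n.
Proof.
move=> uS vS uv.
have um m n : (m <= n)%N -> u m <= u n.
  move=> /subnKC <-; elim: (n - m)%N => [|k IH]; first by rewrite addn0.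
  by rewrite addnS (le_trans IH).
have vm m n : (m <= n)%N -> v n <= v m.
  move=> /subnKC <-; elim: (n - m)%N => [|k IH]; first by rewrite addn0.
  by rewrite addnS (le_trans (vS _)).
have uvm m n : u m <= v n.
  rewrite (le_trans (um _ _ (leq_maxl m n)))// (le_trans (uv _))//.
  by rewrite vm// leq_maxr.
exists (sup (range u)) => n; apply/andP; split.
  by apply: ub_le_sup; [exists (v 0%N) => _ [m _ <-]; exact: uvm|exists n].
by apply: ge_sup; [exists (u 0%N), 0%N|move=> _ [m _ <-]; exact: uvm].
Qed.

Lemma rect_bisection (P : R -> R -> R -> R -> Prop) :
  (forall a b c d, a <= b -> c <= d ->
    P a ((a + b) / 2) c ((c + d) / 2) -> P ((a + b) / 2) b c ((c + d) / 2) ->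
    P a ((a + b) / 2) ((c + d) / 2) d -> P ((a + b) / 2) b ((c + d) / 2) d ->
    P a b c d) ->
  (forall x y, exists2 e : R, 0 < e & forall a b c d, a <= x <= b ->
    c <= y <= d -> b - a < e -> d - c < e -> P a b c d) ->
  forall a b c d, a <= b -> c <= d -> P a b c d.
Proof.
move=> Psplit Ploc a0 b0 c0 d0 ab0 cd0; apply: contrapT => nP0.
pose T := (R * R * (R * R))%type.
pose bad (r : T) := [/\ r.1.1 <= r.1.2, r.2.1 <= r.2.2 &
  ~ P r.1.1 r.1.2 r.2.1 r.2.2].
have stepP (r : T) : exists r' : T, bad r -> bad r' /\
    [/\ r.1.1 <= r'.1.1, r'.1.2 <= r.1.2, r'.1.2 - r'.1.1 = (r.1.2 - r.1.1) / 2,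
    r.2.1 <= r'.2.1 & r'.2.2 <= r.2.2 /\ r'.2.2 - r'.2.1 = (r.2.2 - r.2.1) / 2].
  case: (pselect (bad r)) => [[]|nb]; last by exists r.
  case: r => [[a b] [c d]] /= ab cd nP.
  have [H|H1] := pselect (P a ((a + b) / 2) c ((c + d) / 2)); last first.
    by exists ((a, (a + b) / 2), (c, (c + d) / 2)) => _; split; split => //=; lra.
  have [H'|H1] := pselect (P ((a + b) / 2) b c ((c + d) / 2)); last first.
    by exists (((a + b) / 2, b), (c, (c + d) / 2)) => _; split; split => //=; lra.
  have [H''|H1] := pselect (P a ((a + b) / 2) ((c + d) / 2) d); last first.
    by exists ((a, (a + b) / 2), ((c + d) / 2, d)) => _; split; split => //=; lra.
  have [H'''|H1] := pselect (P ((a + b) / 2) b ((c + d) / 2) d); last first.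
    by exists (((a + b) / 2, b), ((c + d) / 2, d)) => _; split; split => //=; lra.
  by case: nP; exact: Psplit.
have [step Hstep] := choice stepP.
pose s n := iter n step ((a0, b0), (c0, d0)).
have sbad n : bad (s n) by elim: n => [|n /Hstep[]//]; split.
have sS n := (Hstep _ (sbad n)).2.
have [x Hx] : exists x, forall n, (s n).1.1 <= x <= (s n).1.2.
  apply: nested_intervals => n; first by have [] := sS n.
    by have [] := sS n.
  by have [] := sbad n.
have [y Hy] : exists y, forall n, (s n).2.1 <= y <= (s n).2.2.
  apply: nested_intervals => n; first by have [] := sS n.
    by have [_ _ _ _ []] := sS n.
  by have [] := sbad n.
have sx n : (s n).1.2 - (s n).1.1 = (b0 - a0) / 2 ^+ n.
  elim: n => [|n IH]; first by rewrite expr0 divr1.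
  have [_ _ E _ _] := sS n; rewrite [LHS]E IH exprS; field.
  by rewrite expf_neq0.
have sy n : (s n).2.2 - (s n).2.1 = (d0 - c0) / 2 ^+ n.
  elim: n => [|n IH]; first by rewrite expr0 divr1.
  have [_ _ _ _ [_ E]] := sS n; rewrite [LHS]E IH exprS; field.
  by rewrite expf_neq0.
have [e e0 He] := Ploc x y.
(* One [n] serves both sides of the rectangle, because [n < 2 ^ n]. *)
pose n := Num.bound ((b0 - a0 + (d0 - c0)) / e).
have L : (b0 - a0 + (d0 - c0)) / e < 2 ^+ n.
  apply: (lt_trans (archi_boundP _)); first by rewrite divr_ge0 ?(ltW e0)//; lra.
  by rewrite -natrX ltr_nat ltn_expl.
rewrite ltr_pdivrMr// in L.
have p0 : 0 < 2 ^+ n :> R by rewrite exprn_gt0.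
have [_ _ []] := sbad n; apply: He => //.
  by rewrite sx ltr_pdivrMr//; lra.
by rewrite sy ltr_pdivrMr//; lra.
Qed.

End Bisection.

Section RectangleIntegral.
Context {R : realType}.
Implicit Types (f g : R[i] -> R[i]) (z w D : R[i]) (a b c d e K r : R).

Definition econt f a b c d : Prop :=
  [/\ ccont (fun x => f (x +i* c)), ccont (fun y => f (b +i* y)),
      ccont (fun x => f (x +i* d)) & ccont (fun y => f (a +i* y))].

(* Integral along the positively oriented boundary of [a, b] x [c, d]. *)
Definition eta f a b c d : R[i] :=
  Cintegral a b (fun x => f (x +i* c)) + 'i%C * Cintegral c d (fun y => f (b +i* y))
  - Cintegral a b (fun x => f (x +i* d)) - 'i%C * Cintegral c d (fun y => f (a +i* y)).

Definition onedge a b c d z : Prop :=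
  (a <= complex.Re z <= b /\ (complex.Im z = c \/ complex.Im z = d)) \/
  (c <= complex.Im z <= d /\ (complex.Re z = a \/ complex.Re z = b)).

Lemma etaZ k f a b c d : econt f a b c d ->
  eta (fun z => k * f z) a b c d = k * eta f a b c d.
Proof.
by move=> [f1 f2 f3 f4]; rewrite /eta !CIZ; try exact: cin_cont; ring.
Qed.

Lemma etaB f g a b c d : econt f a b c d -> econt g a b c d ->
  eta (fun z => f z - g z) a b c d = eta f a b c d - eta g a b c d.
Proof.
move=> [f1 f2 f3 f4] [g1 g2 g3 g4].
by rewrite /eta !CIB; try exact: cin_cont; ring.
Qed.

Lemma eta_ext f g a b c d : (forall z, onedge a b c d z -> f z = g z) ->
  eta f a b c d = eta g a b c d.
Proof.
move=> fg; rewrite /eta; congr (_ + 'i%C * _ - _ - 'i%C * _); apply: CI_ext => t tab;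
  apply: fg; rewrite /onedge /=; tauto.
Qed.

Lemma eta_bound f a b c d K : a <= b -> c <= d -> econt f a b c d ->
  (forall z, onedge a b c d z -> nc (f z) <= K) ->
  nc (eta f a b c d) <= 4 * K * ((b - a) + (d - c)).
Proof.
move=> ab cd [f1 f2 f3 f4] fK; rewrite /eta.
have H1 : nc (Cintegral a b (fun x => f (x +i* c))) <= 2 * K * (b - a).
  apply: nc_CI_le => //; first exact: cin_cont.
  by move=> t tab; apply: fK; rewrite /onedge /=; tauto.
have H2 : nc (Cintegral c d (fun y => f (b +i* y))) <= 2 * K * (d - c).
  apply: nc_CI_le => //; first exact: cin_cont.
  by move=> t tab; apply: fK; rewrite /onedge /=; tauto.
have H3 : nc (Cintegral a b (fun x => f (x +i* d))) <= 2 * K * (b - a).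
  apply: nc_CI_le => //; first exact: cin_cont.
  by move=> t tab; apply: fK; rewrite /onedge /=; tauto.
have H4 : nc (Cintegral c d (fun y => f (a +i* y))) <= 2 * K * (d - c).
  apply: nc_CI_le => //; first exact: cin_cont.
  by move=> t tab; apply: fK; rewrite /onedge /=; tauto.
rewrite (le_trans (ncB _ _))// ncM nc_i mul1r.
have := ncB (Cintegral a b (fun x => f (x +i* c)) +
  'i%C * Cintegral c d (fun y => f (b +i* y))) (Cintegral a b (fun x => f (x +i* d))).
have := ncD (Cintegral a b (fun x => f (x +i* c)))
  ('i%C * Cintegral c d (fun y => f (b +i* y))).
rewrite ncM nc_i mul1r; lra.
Qed.

Lemma ccont_line (p q : R[i]) : ccont (fun x : R => p + x%:C * q).
Proof.
apply: ccontD; first exact: ccont_cst.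
by apply: ccontM; [apply: ccont_real => x; exact: cvg_id|exact: ccont_cst].
Qed.

Lemma line_h c : (fun x : R => x +i* c) = (fun x => 'i%C * c%:C + x%:C * 1).
Proof. by apply/funext => x; apply: complexP; rewrite !ReImE /=; ring. Qed.

Lemma line_v a : (fun y : R => a +i* y) = (fun y => a%:C + y%:C * 'i%C).
Proof. by apply/funext => x; apply: complexP; rewrite !ReImE /=; ring. Qed.

Lemma ccont_h c : ccont (fun x : R => x +i* c).
Proof. by rewrite line_h; exact: ccont_line. Qed.

Lemma ccont_v a : ccont (fun y : R => a +i* y).
Proof. by rewrite line_v; exact: ccont_line. Qed.

Lemma econt_cont f a b c d : (forall z, ccontC f z) -> econt f a b c d.
Proof.
by move=> cf; split; apply: ccont_compC => //; (exact: ccont_h || exact: ccont_v).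
Qed.

Lemma CI_affine a b (p q : R[i]) : a <= b ->
  Cintegral a b (fun x => p + x%:C * q) =
  p * (b%:C - a%:C) + q * (b%:C ^+ 2 - a%:C ^+ 2) / 2.
Proof.
move=> ab; have idC : ccont (fun x : R => x%:C).
  by apply: ccont_real => x; exact: cvg_id.
rewrite CID; last 2 first.
- exact/cin_cont/ccont_cst.
- by apply: cin_cont; apply: ccontM => //; exact: ccont_cst.
rewrite CI_cst// rmorphB/=; congr (_ + _).
rewrite (@CI_ext _ _ _ _ (fun x => q * x%:C)); last by move=> t _; rewrite mulrC.
rewrite CIZ; last exact: cin_cont.
rewrite -mulrA; congr (_ * _).
rewrite (@CI_FTC2 _ a b (fun x => (x ^+ 2 / 2)%:C) (fun x => x%:C))//.
  have E x : (x ^+ 2 / 2)%:C = x%:C ^+ 2 / 2 :> R[i].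
    by rewrite rmorphM fmorphV rmorph_nat rmorphXn.
  by rewrite !E; ring.
move=> t /=; split; last exact: is_derive_cst.
by apply: is_derive_eq; rewrite /GRing.scale /=; field.
Qed.

Lemma eta_affine (p q : R[i]) a b c d : a <= b -> c <= d ->
  eta (fun z => p + q * z) a b c d = 0.
Proof.
move=> ab cd; rewrite /eta.
have Eh (k : R) : Cintegral a b (fun x => p + q * (x +i* k)) =
    Cintegral a b (fun x => (p + q * 'i%C * k%:C) + x%:C * q).
  by apply: CI_ext => t _; apply: complexP; rewrite !ReImE /=; ring.
have Ev (k : R) : Cintegral c d (fun y => p + q * (k +i* y)) =
    Cintegral c d (fun y => (p + q * k%:C) + y%:C * (q * 'i%C)).
  by apply: CI_ext => t _; apply: complexP; rewrite !ReImE /=; ring.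
by rewrite !Eh !Ev !CI_affine//; field.
Qed.

Lemma eta_splitv f a b c d m : a <= m <= b -> (forall z, ccontC f z) ->
  eta f a b c d = eta f a m c d + eta f m b c d.
Proof.
move=> amb cf; have cin_h k : cin a b (fun x => f (x +i* k)).
  by apply: cin_cont; apply: ccont_compC => //; exact: ccont_h.
rewrite /eta (CI_split amb (cin_h c)) (CI_split amb (cin_h d)); ring.
Qed.

Lemma eta_splith f a b c d m : c <= m <= d -> (forall z, ccontC f z) ->
  eta f a b c d = eta f a b c m + eta f a b m d.
Proof.
move=> cmd cf; have cin_v k : cin c d (fun y => f (k +i* y)).
  by apply: cin_cont; apply: ccont_compC => //; exact: ccont_v.
rewrite /eta (CI_split cmd (cin_v a)) (CI_split cmd (cin_v b)); ring.
Qed.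

Lemma ccontC_affine (p q : R[i]) z : ccontC (fun w => p + q * w) z.
Proof.
apply: entire_cont.
exact: (entireD (@entire_cst R p) (entireM (@entire_cst R q) (@entire_id R))).
Qed.

Lemma ccontCB f g z : ccontC f z -> ccontC g z -> ccontC (fun w => f w - g w) z.
Proof.
move=> cf cg e e0; have e20 : 0 < e / 2 by lra.
have [d d0 Hd] := cf _ e20; have [d' d'0 Hd'] := cg _ e20.
exists (Num.min d d') => [|w]; first by rewrite lt_min d0.
rewrite lt_min => /andP[/Hd w1 /Hd' w2].
have -> : f w - g w - (f z - g z) = (f w - f z) - (g w - g z) by ring.
by rewrite (le_lt_trans (ncB _ _))// [e]splitr ltrD.
Qed.

Lemma mid_bounds a b : a <= b -> a <= (a + b) / 2 <= b.
Proof. by move=> ab; apply/andP; split; lra. Qed.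

(** With [S] the half perimeter, the bound [e * S ^ 2] is stable under quartering, as the quarters
    contribute [4 * (S / 2) ^ 2]. Near a point it follows from differentiability, because the affine
    part of [f] integrates to 0. *)
Lemma goursat f a b c d : a <= b -> c <= d -> (forall z, ccontC f z) ->
  (forall x y, a <= x <= b -> c <= y <= d -> exists D, cdiff f (x +i* y) D) ->
  eta f a b c d = 0.
Proof.
move=> ab cd cf df.
suff H e : 0 < e -> nc (eta f a b c d) <= e * ((b - a) + (d - c)) ^+ 2.
  apply/eqP; rewrite -nc_eq0 eq_le nc_ge0 andbT leNgt; apply/negP => E0.
  pose S := ((b - a) + (d - c)) ^+ 2.
  have S0 : 0 <= S by rewrite sqr_ge0.
  have e0 : 0 < nc (eta f a b c d) / (2 * (S + 1)) by rewrite divr_gt0//; lra.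
  have := H _ e0; rewrite -/S mulrAC ler_pdivlMr; last by lra.
  nra.
move=> e0.
(* The four inclusions confine the bisection to subrectangles, where differentiability is
   available. *)
pose P a' b' c' d' := a <= a' -> b' <= b -> c <= c' -> d' <= d ->
  nc (eta f a' b' c' d') <= e * ((b' - a') + (d' - c')) ^+ 2.
suff : P a b c d by apply.
apply: (@rect_bisection _ P) => //; rewrite /P.
  move=> a1 b1 c1 d1 ab1 cd1 H1 H2 H3 H4 aa bb cc dd.
  have /andP[ma mb] := mid_bounds ab1; have /andP[mc md] := mid_bounds cd1.
  rewrite (@eta_splitv _ _ _ _ _ ((a1 + b1) / 2)) ?ma//.
  rewrite !(@eta_splith _ _ _ c1 d1 ((c1 + d1) / 2)) ?mc//.
  have {}H1 := H1 aa (le_trans mb bb) cc (le_trans md dd).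
  have {}H2 := H2 (le_trans aa ma) bb cc (le_trans md dd).
  have {}H3 := H3 aa (le_trans mb bb) (le_trans cc mc) dd.
  have {}H4 := H4 (le_trans aa ma) bb (le_trans cc mc) dd.
  apply: (le_trans (ncD _ _)); apply: (le_trans (lerD (ncD _ _) (ncD _ _))).
  apply: (le_trans (lerD (lerD H1 H3) (lerD H2 H4))).
  by rewrite le_eqVlt; apply/orP; left; apply/eqP; field.
move=> x y.
have [xab|nx] := boolP (a <= x <= b); last first.
  exists 1 => // a1 b1 c1 d1 /andP[ax xb] _ _ _ aa bb; exfalso.
  by move/negP: nx; apply; rewrite (le_trans aa ax) (le_trans xb bb).
have [ycd|ny] := boolP (c <= y <= d); last first.
  exists 1 => // a1 b1 c1 d1 _ /andP[cy yd] _ _ _ _ cc dd; exfalso.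
  by move/negP: ny; apply; rewrite (le_trans cc cy) (le_trans yd dd).
have [D fD] := df x y xab ycd; set z := x +i* y in fD *.
(* The quarter compensates the factor 4 of [eta_bound]. *)
have e40 : 0 < e / 4 by lra.
have [r r0 Hr] := fD _ e40.
exists (r / 2) => [|a1 b1 c1 d1 axb cyd br dr _ _ _ _]; first by lra.
have ab1 : a1 <= b1 by lra.
have cd1 : c1 <= d1 by lra.
have -> : eta f a1 b1 c1 d1 =
    eta (fun w => f w - ((f z - D * z) + D * w)) a1 b1 c1 d1.
  rewrite etaB ?eta_affine ?subr0//; apply: econt_cont => // w.
  exact: ccontC_affine.
apply: (le_trans (@eta_bound _ _ _ _ _ (e / 4 * ((b1 - a1) + (d1 - c1))) _ _ _ _)) => //.
- by apply: econt_cont => w; apply: ccontCB => //; exact: ccontC_affine.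
- move=> w wE.
  have wz : nc (w - z) <= (b1 - a1) + (d1 - c1).
    rewrite (le_trans (nc_le _))// !ReImE /= lerD// ler_norml.
      by case: wE => -[] ? []; lra.
    by case: wE => -[] ? []; lra.
  have -> : f w - (f z - D * z + D * w) = f w - f z - D * (w - z) by ring.
  apply: (le_trans (Hr w _)); first by lra.
  by rewrite ler_wpM2l//; lra.
by rewrite le_eqVlt; apply/orP; left; apply/eqP; field.
Qed.

(** A continuous function is bounded near [z], so its integral around a small square there tends to
    0 with the size of the square. *)
Lemma goursat_except f z a b c d : a < complex.Re z < b -> c < complex.Im z < d ->
  (forall w, ccontC f w) -> (forall w, w != z -> exists D, cdiff f w D) ->
  eta f a b c d = 0.
Proof.
case: z => x y /= axb cyd cf df; set z := x +i* y in df *.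
have [r1 r10 Hr1] := cf z 1 ltr01.
apply/eqP; rewrite -nc_eq0 eq_le nc_ge0 andbT leNgt; apply/negP => E0.
set E := nc _ in E0; pose K := nc (f z) + 1.
have K0 : 0 < K by rewrite ltr_wpDl// nc_ge0.
(* On the square of half side [e] around [z], [eta_bound] gives [16 * K * e], which the last
   condition makes smaller than [E / 2]. *)
have [e [e0 ea eb ec [ed er eE]]] : exists e, [/\ 0 < e, a + e < x, x + e < b,
    c + e < y & [/\ y + e < d, e < r1 / 4 & e < E / (32 * K)]].
  have r4 : 0 < r1 / 4 by lra.
  have EK : 0 < E / (32 * K) by rewrite divr_gt0//; lra.
  pose m := Num.min (Num.min (Num.min (x - a) (b - x)) (Num.min (y - c) (d - y)))
    (Num.min (r1 / 4) (E / (32 * K))).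
  have m0 : 0 < m.
    rewrite /m !lt_min r4 EK !andbT.
    by apply/andP; split; apply/andP; split; lra.
  have : m <= m by [].
  rewrite {2}/m !le_min; move: m m0 => m m0.
  move=> /andP[/andP[/andP[h1 h2] /andP[h3 h4]] /andP[h5 h6]].
  by exists (m / 2); split; [lra..|split; lra].
have G a' b' c' d' : a' <= b' -> c' <= d' ->
    ~ (a' <= x <= b' /\ c' <= y <= d') -> eta f a' b' c' d' = 0.
  move=> ab' cd' nin; apply: goursat => // x' y' xab ycd; apply: df.
  by apply/eqP => -[xx yy]; apply: nin; rewrite -xx -yy.
(* Cut off the strips on which f is differentiable, leaving a small square around z. *)
have E1 : eta f a b c d = eta f (x - e) (x + e) (y - e) (y + e).
  rewrite (@eta_splitv _ a b c d (x - e))//; last by lra.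
  rewrite (G a) ?add0r; [|by lra..].
  rewrite (@eta_splitv _ (x - e) b c d (x + e))//; last by lra.
  rewrite (G (x + e)) ?addr0; [|by lra..].
  rewrite (@eta_splith _ _ _ c d (y - e))//; last by lra.
  rewrite (G _ _ c) ?add0r; [|by lra..].
  rewrite (@eta_splith _ _ _ (y - e) d (y + e))//; last by lra.
  by rewrite (G _ _ (y + e)) ?addr0//; lra.
have : E <= 4 * K * ((x + e - (x - e)) + (y + e - (y - e))).
  rewrite /E E1; apply: eta_bound; [by lra..| |].
    exact: econt_cont.
  move=> w wE; have wz : nc (w - z) < r1.
    rewrite (le_lt_trans (nc_le _))// !ReImE /=.
    have : `|complex.Re w - x| <= e by rewrite ler_norml; case: wE => -[] ? []; lra.
    have : `|complex.Im w - y| <= e by rewrite ler_norml; case: wE => -[] ? []; lra.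
    lra.
  have := Hr1 w wz; have := ncD (f w - f z) (f z); rewrite subrK /K; lra.
rewrite ltr_pdivlMr in eE; last by lra.
lra.
Qed.

End RectangleIntegral.

(** * Cauchy's formula on squares, division and Liouville's theorem *)

Section CauchySquare.
Context {R : realType}.
Implicit Types (f g phi : R[i] -> R[i]) (z w D : R[i]) (e d K r : R).

(** The Cauchy kernel with pole at [z]. *)
Definition ck z w : R[i] := (w - z)^-1.

Local Notation sq r f := (eta f (- r) r (- r) r).
Local Notation sqcont r f := (econt f (- r) r (- r) r).
Local Notation onsq r z := (onedge (- r) r (- r) r z).

Lemma econtM f g a b c d : econt f a b c d -> econt g a b c d ->
  econt (fun z => f z * g z) a b c d.
Proof. by move=> [f1 f2 f3 f4] [g1 g2 g3 g4]; split; exact: ccontM. Qed.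

Lemma ccont_inv (h : R -> R[i]) : ccont h -> (forall t, h t != 0) ->
  ccont (fun t => (h t)^-1).
Proof.
move=> ch h0; apply: (ccont_compC (f := fun z => z^-1) ch) => t.
have /derivableC_cdiff[D HD] := derivableC_V (f := id) (h0 t) (@entire_id R (h t)).
exact: cdiff_cont HD.
Qed.

Lemma nc_lt_sq z r : nc z < r ->
  (- r < complex.Re z < r) /\ (- r < complex.Im z < r).
Proof.
move=> zr; have := nc_Re z; have := nc_Im z; rewrite !ler_norml.
by move=> /andP[h1 h2] /andP[h3 h4]; split; apply/andP; split; lra.
Qed.

Lemma ccont_ck (h : R -> R[i]) z : ccont h -> (forall t, h t != z) ->
  ccont (fun t => ck z (h t)).
Proof.
move=> ch hz; apply: (ccont_inv (ccontB ch (ccont_cst z))) => t.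
by rewrite subr_eq0.
Qed.

Lemma sqcont_ck r z : nc z < r -> sqcont r (ck z).
Proof.
move=> /nc_lt_sq[/andP[h1 h2] /andP[h3 h4]].
split.
- by apply: (ccont_ck (ccont_h _)) => t; apply/eqP => E; move: h3; rewrite -E ltxx.
- by apply: (ccont_ck (ccont_v _)) => t; apply/eqP => E; move: h2; rewrite -E ltxx.
- by apply: (ccont_ck (ccont_h _)) => t; apply/eqP => E; move: h4; rewrite -E ltxx.
- by apply: (ccont_ck (ccont_v _)) => t; apply/eqP => E; move: h1; rewrite -E ltxx.
Qed.

Lemma onsq_nc r z : onsq r z -> r <= nc z.
Proof.
move=> H; have := nc_Re z; have := nc_Im z; rewrite !ler_norml.
by move=> /andP[h1 h2] /andP[h3 h4]; case: H => -[] /andP[h5 h6] []; lra.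
Qed.

Lemma ck_bound r z w : nc z < r -> onsq r w -> nc (ck z w) <= (r - nc z)^-1.
Proof.
move=> zr /onsq_nc wr; rewrite /ck ncV.
have := nc_lb w (- z); rewrite ncN => wz.
by rewrite lef_pV2 ?posrE; lra.
Qed.

Lemma econt_bounded f a b c d : a <= b -> c <= d -> econt f a b c d ->
  exists2 K : R, 0 < K & forall z, onedge a b c d z -> nc (f z) <= K.
Proof.
move=> ab cd [f1 f2 f3 f4].
have [K1 k1 H1] := ccont_bounded a b f1; have [K2 k2 H2] := ccont_bounded c d f2.
have [K3 k3 H3] := ccont_bounded a b f3; have [K4 k4 H4] := ccont_bounded c d f4.
exists (K1 + K2 + K3 + K4) => [|[x y] /=]; first by lra.
case=> -[] /= xab [] ->.
- have := H1 _ xab; lra.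
- have := H3 _ xab; lra.
- have := H4 _ xab; lra.
- have := H2 _ xab; lra.
Qed.

(** The factor [sq r (ck z)], whose value is 2 pi i, is left unevaluated: lower bounds for its norm
    will be enough. *)
Lemma cauchy_square f z r : entire f -> nc z < r ->
  sq r (fun w => f w * ck z w) = f z * sq r (ck z).
Proof.
move=> ef zr; have [D fD] := (entireP f).1 ef z.
(* The difference quotient is continuous once completed by [D], and differentiable off [z], so
   [goursat_except] applies to it. *)
pose f1 w := if w == z then D else (f w - f z) / (w - z).
have f1d w : w != z -> exists D, cdiff f1 w D.
  move=> wz; have wz0 : w - z != 0 by rewrite subr_eq0.
  have dn := entireB ef (@entire_cst R (f z)).
  have dd := entireB (@entire_id R) (@entire_cst R z).
  have /derivableC_cdiff[D' HD'] := derivableC_M (dn w)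
    (derivableC_V (f := fun w => w - z) wz0 (dd w)).
  exists D'; apply: (@cdiff_ext _ _ _ _ _ (nc (w - z))) HD'.
    by rewrite nc_gt0.
  move=> v vw; rewrite /f1 ifN//; apply/eqP => E.
  by move: vw; rewrite E nc_sub ltxx.
have f1c w : ccontC f1 w.
  have [->|/f1d[D' /cdiff_cont//]] := eqVneq w z.
  move=> e e0; have e20 : 0 < e / 2 by lra.
  have [d d0 Hd] := fD _ e20; exists d => // v vz.
  rewrite /f1 eqxx; have [_|vz0] := eqVneq v z; first by rewrite subrr nc0.
  have vz1 : v - z != 0 by rewrite subr_eq0.
  have vz2 : 0 < nc (v - z) by rewrite nc_gt0.
  have -> : (f v - f z) / (v - z) - D = (f v - f z - D * (v - z)) / (v - z).
    by rewrite [in RHS]mulrBl mulfK.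
  rewrite ncM ncV ltr_pdivrMr// (le_lt_trans (Hd v vz))// ltr_pM2r//; lra.
have r0 : 0 < r by rewrite (le_lt_trans _ zr) ?nc_ge0.
have [h1 h2] := nc_lt_sq zr.
have := goursat_except h1 h2 f1c f1d.
have zk := sqcont_ck zr.
rewrite (@eta_ext _ _ (fun w => f w * ck z w - f z * ck z w)); last first.
  move=> w /onsq_nc wr; rewrite /f1 ifN ?mulrBl//.
  by apply/eqP => E; move: zr; rewrite -E ltNge wr.
have fc : sqcont r f by apply: econt_cont => w; exact: entire_cont.
have fkc := econtM fc zk.
have ckc : sqcont r (fun w => f z * ck z w).
  by apply: econtM zk; apply: econt_cont => w; apply: entire_cont; exact: entire_cst.
by rewrite etaB// etaZ// => /eqP; rewrite subr_eq0 => /eqP.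
Qed.

Definition cauchyJ r phi z := sq r (fun w => phi w * ck z w).

Lemma ck_sub z z' w : w != z -> w != z' ->
  ck z w - ck z' w = (z - z') * (ck z w * ck z' w).
Proof.
by move=> wz wz'; rewrite /ck; field; rewrite !subr_eq0 wz wz'.
Qed.

(** The resolvent identity [ck_sub] under the integral sign. It yields continuity and
    differentiability of Cauchy integrals, and also the division of an entire function by [z]. *)
Lemma cauchyJ_sub r phi z z' : sqcont r phi -> nc z < r -> nc z' < r ->
  cauchyJ r phi z - cauchyJ r phi z' =
  (z - z') * cauchyJ r (fun w => phi w * ck z' w) z.
Proof.
move=> cphi zr z'r; have zk := sqcont_ck zr; have z'k := sqcont_ck z'r.
rewrite /cauchyJ -etaZ; last exact: econtM (econtM cphi z'k) zk.
rewrite -etaB; [|exact: econtM cphi zk|exact: econtM cphi z'k].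
apply: eta_ext => w /onsq_nc wr; rewrite -mulrBr ck_sub.
- ring.
- by apply/eqP => E; move: zr; rewrite -E ltNge wr.
- by apply/eqP => E; move: z'r; rewrite -E ltNge wr.
Qed.

Lemma cauchyJ_bound r phi K z : nc z < r -> sqcont r phi ->
  (forall w, onsq r w -> nc (phi w) <= K) ->
  nc (cauchyJ r phi z) <= 16 * r * K / (r - nc z).
Proof.
move=> zr cphi HK; have r0 : 0 < r by rewrite (le_lt_trans _ zr) ?nc_ge0.
rewrite /cauchyJ; have cc := econtM cphi (sqcont_ck zr).
apply: (le_trans (@eta_bound _ _ _ _ _ _ (K / (r - nc z)) _ _ cc _)); try lra.
by move=> w wr; rewrite ncM ler_pM ?nc_ge0// ?HK// ck_bound.
Qed.

(** Applying [cauchyJ_sub] twice shows the remainder as [(w - z) ^+ 2] times the Cauchy integral of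
    [chi], which stays bounded while [w] is within half of [r - nc z] of [z]. *)
Lemma cauchyJ_cdiff r phi z : sqcont r phi -> nc z < r ->
  exists D, cdiff (cauchyJ r phi) z D.
Proof.
move=> cphi zr; have zk := sqcont_ck zr.
have r0 : 0 < r by rewrite (le_lt_trans _ zr) ?nc_ge0.
pose psi w := phi w * ck z w; have cpsi : sqcont r psi := econtM cphi zk.
pose chi w := psi w * ck z w; have cchi : sqcont r chi := econtM cpsi zk.
have rr : - r <= r by lra.
have [K K0 HK] := econt_bounded rr rr cchi.
exists (cauchyJ r psi z).
apply: (@cdiff_quad _ _ _ _ (16 * r * K / ((r - nc z) / 2)) ((r - nc z) / 2)).
  lra.
move=> w wz.
have zw : nc w <= nc z + nc (w - z) by rewrite -[X in nc X <= _](subrK z) addrC ncD.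
have wr : nc w < r by lra.
rewrite cauchyJ_sub// -/psi.
have -> : (w - z) * cauchyJ r psi w - cauchyJ r psi z * (w - z) =
  (w - z) * (cauchyJ r psi w - cauchyJ r psi z) by ring.
rewrite cauchyJ_sub// -/chi !ncM mulrA -expr2 mulrC ler_wpM2r ?sqr_ge0//.
apply: (le_trans (cauchyJ_bound wr cchi HK)).
rewrite ler_wpM2l//; first by rewrite !mulr_ge0//; lra.
by rewrite lef_pV2 ?posrE; lra.
Qed.

(** Each side contributes at least 1: it has length [2 * r], and the relevant part of the kernel on
    it is [r / (r ^+ 2 + t ^+ 2)], at least [1 / (2 * r)] for [t] between [- r] and [r]. *)
Lemma winding_ge r : 0 < r -> 4 <= complex.Im (sq r (ck 0)).
Proof.
move=> r0; have nr : nc (0 : R[i]) < r by rewrite nc0.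
have [c1 c2 c3 c4] := sqcont_ck nr.
rewrite /eta !(ReD, ImD, ReN, ImN, ReM, ImM) /= !mul0r !mul1r !add0r.
have rr : - r <= r by lra.
have den t : 0 < r ^+ 2 + t ^+ 2 by rewrite ltr_pwDl ?exprn_gt0// sqr_ge0.
have lb t : - r <= t <= r -> (2 * r)^-1 <= r / (r ^+ 2 + t ^+ 2).
  move=> /andP[t1 t2]; rewrite -div1r ler_pdivrMr; last by lra.
  rewrite mulrAC ler_pdivlMr//.
  have : 0 <= (r - t) * (r + t) by rewrite mulr_ge0//; lra.
  nra.
have K1 : (1 : R) = (2 * r)^-1 * (r - - r) by field; lra.
have B (h : R -> R) : rin (- r) r h -> (forall t, - r <= t <= r ->
    (2 * r)^-1 <= h t) -> 1 <= \int[lebesgue_measure]_(s in `[(- r), r]) h s.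
  move=> hi hb; rewrite [X in X <= _]K1 -rint_cst//; apply: rint_le => //.
  by apply: rin_cont => x; exact: cvg_cst.
have -> : (4 : R) = 1 + 1 + 1 + 1 by ring.
have k1 : 1 <= \int[lebesgue_measure]_(s in `[(- r), r])
    complex.Im (ck 0 (s +i* - r)).
  apply: B; first by have [_] := cin_cont (- r) r c1.
  move=> t tr; rewrite /ck subr0 /= sqrrN addrC mulNr opprK; exact: lb.
have k2 : 1 <= \int[lebesgue_measure]_(s in `[(- r), r])
    complex.Re (ck 0 (r +i* s)).
  apply: B; first by have [] := cin_cont (- r) r c2.
  by move=> t tr; rewrite /ck subr0 /=; exact: lb.
have k3 : 1 <= - \int[lebesgue_measure]_(s in `[(- r), r])
    complex.Im (ck 0 (s +i* r)).
  rewrite -mulN1r -rintZ; last by have [_] := cin_cont (- r) r c3.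
  apply: B; first by apply: rinZ; have [_] := cin_cont (- r) r c3.
  by move=> t tr; rewrite /ck subr0 /= mulN1r opprK addrC; exact: lb.
have k4 : 1 <= - \int[lebesgue_measure]_(s in `[(- r), r])
    complex.Re (ck 0 (- r +i* s)).
  rewrite -mulN1r -rintZ; last by have [] := cin_cont (- r) r c4.
  apply: B; first by apply: rinZ; have [] := cin_cont (- r) r c4.
  by move=> t tr; rewrite /ck subr0 /= sqrrN mulN1r mulNr opprK; exact: lb.
by rewrite !lerD.
Qed.

Lemma nc_winding_ge r : 0 < r -> 4 <= nc (sq r (ck 0)).
Proof.
by move=> r0; rewrite (le_trans (winding_ge r0))// (le_trans (ler_norm _))// nc_Im.
Qed.

(** The quotient is the difference quotient away from 0. Only its differentiability at 0 is in
    question, and there it agrees with a quotient [h] of Cauchy integrals. *)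
Lemma entire_div0 f : entire f -> exists2 g, entire g &
  forall z, f z = f 0 + z * g z.
Proof.
move=> ef; pose one (w : R[i]) := 1 : R[i].
have nr : nc (0 : R[i]) < 1 by rewrite nc0.
have fc : sqcont 1 f by apply: econt_cont => w; exact: entire_cont.
have oc : sqcont 1 one by apply: econt_cont => w; apply: entire_cont; exact: entire_cst.
have kc := sqcont_ck nr.
(* Cauchy's formula reads [f z * J1 z = cauchyJ 1 f z], and [h] comes from subtracting its values at
   [z] and 0. As [J1] has not been shown to be constant, [J3] accounts for its variation. *)
pose J1 := cauchyJ 1 one; pose J2 := cauchyJ 1 (fun w => f w * ck 0 w).
pose J3 := cauchyJ 1 (fun w => one w * ck 0 w).
pose h z := (J2 z - f 0 * J3 z) / J1 z.
have J1E z : J1 z = sq 1 (ck z) by apply: eta_ext => w _; rewrite /one mul1r.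
have J10 : J1 0 != 0.
  by rewrite J1E -nc_gt0 (lt_le_trans _ (nc_winding_ge ltr01)).
have [D1 HD1] := cauchyJ_cdiff oc nr.
have [D2 HD2] := cauchyJ_cdiff (econtM fc kc) nr.
have [D3 HD3] := cauchyJ_cdiff (econtM oc kc) nr.
have [d d0 Hd] : exists2 d : R, 0 < d & forall z, nc z < d -> J1 z != 0 /\ nc z < 1.
  have J0 : 0 < nc (J1 0) by rewrite nc_gt0.
  have [d d0 Hd] := cdiff_cont HD1 J0.
  exists (Num.min d 1) => [|z]; first by rewrite lt_min d0 ltr01.
  rewrite lt_min => /andP[zd z1]; split=> //; apply/eqP => E.
  by have := Hd z; rewrite -/J1 E sub0r ncN subr0 ltxx => /(_ zd).
have fh z : nc z < d -> f z = f 0 + z * h z.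
  move=> /Hd[J1z z1].
  have E1 : J1 z - J1 0 = z * J3 z by have := cauchyJ_sub oc z1 nr; rewrite subr0.
  have E2 : f z * J1 z - f 0 * J1 0 = z * J2 z.
    rewrite !J1E -(cauchy_square ef z1) -(cauchy_square ef nr).
    by have := cauchyJ_sub fc z1 nr; rewrite subr0.
  apply: (mulIf J1z); rewrite /h mulrDl -mulrA divfK//.
  have -> : z * (J2 z - f 0 * J3 z) = z * J2 z - f 0 * (z * J3 z) by ring.
  by rewrite -E1 -E2; ring.
pose g z := if z == 0 then h 0 else (f z - f 0) / z.
have gh z : nc z < d -> g z = h z.
  move=> zd; rewrite /g; have [->//|z0] := eqVneq z 0.
  by rewrite (fh z zd) addrAC subrr add0r mulrC mulKf.
exists g; last first.
  move=> z; rewrite /g; have [->|z0] := eqVneq z 0; first by rewrite mul0r addr0.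
  by rewrite mulrC divfK// addrC subrK.
move=> z; apply/derivableC_cdiff; have [->|z0] := eqVneq z 0.
  have [] : exists D, cdiff h 0 D.
    apply/derivableC_cdiff.
    have dJ1 : derivable (J1 : R[i]^o -> R[i]^o) 0 1 by apply/derivableC_cdiff; exists D1.
    have dJ2 : derivable (J2 : R[i]^o -> R[i]^o) 0 1 by apply/derivableC_cdiff; exists D2.
    have dJ3 : derivable (J3 : R[i]^o -> R[i]^o) 0 1 by apply/derivableC_cdiff; exists D3.
    exact: (derivableC_M (derivableC_B dJ2 (derivableC_M (@entire_cst R (f 0) 0) dJ3))
      (derivableC_V J10 dJ1)).
  move=> D HD; exists D; apply: cdiff_ext d0 _ HD => w.
  by rewrite subr0 => /gh ->.
have dn := entireB ef (@entire_cst R (f 0)).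
have /derivableC_cdiff[D HD] := derivableC_M (dn z)
  (derivableC_V (f := id) z0 (@entire_id R z)).
exists D; apply: (@cdiff_ext _ _ _ _ _ (nc z)) HD; first by rewrite nc_gt0.
move=> w wz; rewrite /g ifN//; apply/eqP => E.
by move: wz; rewrite E sub0r ncN ltxx.
Qed.

Lemma entire_div f z0 : entire f -> exists2 g, entire g &
  forall z, f z = f z0 + (z - z0) * g z.
Proof.
move=> ef; have [g eg Hg] := entire_div0 (@entire_shift _ _ z0 ef).
exists (fun z => g (z + - z0)); first exact: (@entire_shift _ _ (- z0) eg).
by move=> z; have := Hg (z - z0); rewrite subrK add0r.
Qed.

(** By Cauchy's formula [f z] times the winding integral around [z] is [O(1 / r)]. That integral is
    at least 4 in norm for the centre 0 and changes by at most 2 when the pole moves to [z]. *)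
Lemma liouville_decay f C : entire f ->
  (forall K, exists2 r : R, K <= r & forall w, onsq r w -> nc (f w) <= C / r) ->
  forall z, f z = 0.
Proof.
move=> ef H z; apply/eqP; rewrite -nc_eq0 eq_le nc_ge0 andbT leNgt.
apply/negP => fz.
have z0 := nc_ge0 z.
(* From [2 * nc z < r] the pole keeps distance [r / 2] from the square; from [18 * nc z < r] the
   winding integral changes by at most 2; the last summand makes [r * nc (f z)] exceed [32 * |C|],
   which is the contradiction. *)
pose K := 2 * nc z + 16 * nc z + 1 + (32 * `|C| + 1) / nc (f z).
have K0 : 0 <= (32 * `|C| + 1) / nc (f z).
  by rewrite divr_ge0 ?nc_ge0//; have := normr_ge0 C; lra.
have [r Kr Hr] := H K.
have rz : nc z < r by rewrite /K in Kr; lra.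
have r0 : 0 < r by rewrite (le_lt_trans _ rz).
have nr : nc (0 : R[i]) < r by rewrite nc0.
have fc : sqcont r f by apply: econt_cont => w; exact: entire_cont.
have ck0 := sqcont_ck nr.
have H1 : nc (f z) * nc (sq r (ck z)) <= 32 * `|C| / r.
  rewrite -ncM -(cauchy_square ef rz).
  apply: (le_trans (cauchyJ_bound rz fc Hr)).
  rewrite ler_pdivrMr; last by lra.
  have -> : 16 * r * (C / r) = 16 * C by field; lra.
  rewrite mulrAC ler_pdivlMr//.
  have Kz : 2 * nc z < r by rewrite /K in Kr; lra.
  have := ler_norm C; have := normr_ge0 C; nra.
have H2 : 2 <= nc (sq r (ck z)).
  have one0 : sqcont r (fun _ : R[i] => 1).
    by apply: econt_cont => w; apply: entire_cont; exact: entire_cst.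
  have E : sq r (ck z) - sq r (ck 0) = z * cauchyJ r (ck 0) z.
    have := cauchyJ_sub one0 rz nr; rewrite subr0 /cauchyJ.
    under eq_fun do rewrite mul1r.
    under [in X in _ - X]eq_fun do rewrite mul1r.
    by under [in X in _ = X]eq_fun do rewrite mul1r.
  have K1 w : onsq r w -> nc (ck 0 w) <= r^-1.
    by move=> wr; have := ck_bound nr wr; rewrite nc0 subr0.
  have := cauchyJ_bound rz ck0 K1.
  have -> : 16 * r / r = 16 by field; lra.
  rewrite ler_pdivlMr; last by lra.
  move=> B; have E' : nc (sq r (ck z) - sq r (ck 0)) <= 2.
    rewrite E ncM.
    have B2 := nc_ge0 (cauchyJ r (ck 0) z).
    have Kz : 18 * nc z < r by rewrite /K in Kr; lra.
    nra.
  have := nc_winding_ge r0.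
  have := ncB (sq r (ck z)) (sq r (ck z) - sq r (ck 0)).
  by rewrite opprB addrCA subrr addr0; lra.
have H3 : nc (f z) * 2 <= 32 * `|C| / r.
  by apply: le_trans H1; rewrite ler_wpM2l// nc_ge0.
have Kr' : (32 * `|C| + 1) / nc (f z) <= r by rewrite /K in Kr; lra.
move: H3 Kr'; rewrite ler_pdivlMr// ler_pdivrMr//.
have := normr_ge0 C; nra.
Qed.

(** Each division by [z] lowers the exponent by one, until [liouville_decay] applies. Only an
    unbounded set of squares is asked for, since the trace will be bounded below on selected squares
    only. *)
Lemma liouville_poly f n C : entire f ->
  (forall K, exists2 r : R, K <= r & forall w, onsq r w -> nc (f w) <= C * r ^+ n) ->
  exists2 p : {poly R[i]}, (size p <= n.+1)%N & forall z, f z = p.[z].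
Proof.
elim: n f C => [|n IH] f C ef H; have [g eg Hg] := entire_div0 ef.
  exists (f 0)%:P; first by rewrite size_polyC; case: eqP.
  suff g0 z : g z = 0 by move=> z; rewrite hornerC Hg g0 mulr0 addr0.
  apply: (@liouville_decay _ (`|C| + nc (f 0))) => // K.
  have [r Kr Hr] := H (Num.max K 1); move: Kr; rewrite ge_max => /andP[Kr r1].
  exists r => // w wr; have r0 : 0 < r by lra.
  have rw := onsq_nc wr; rewrite ler_pdivlMr//.
  apply: (@le_trans _ _ (nc (w * g w))).
    by rewrite ncM mulrC ler_wpM2r// nc_ge0.
  have -> : w * g w = f w - f 0 by rewrite (Hg w) addrAC subrr add0r.
  rewrite (le_trans (ncB _ _))// lerD2r (le_trans (Hr w wr))//.
  by rewrite expr0 mulr1 ler_norm.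
have [|p sp Hp] := IH g (`|C| + nc (f 0)) eg.
  (* With [1 <= r] the constant [nc (f 0)] is absorbed into the power of [r]. *)
  move=> K; have [r Kr Hr] := H (Num.max K 1); move: Kr; rewrite ge_max => /andP[Kr r1].
  exists r => // w wr; have r0 : 0 < r by lra.
  have rw := onsq_nc wr; rewrite -(ler_pM2l r0).
  apply: (@le_trans _ _ (nc (w * g w))).
    by rewrite ncM ler_wpM2r// nc_ge0.
  have -> : w * g w = f w - f 0 by rewrite (Hg w) addrAC subrr add0r.
  have -> : r * ((`|C| + nc (f 0)) * r ^+ n) = `|C| * r ^+ n.+1 + nc (f 0) * r ^+ n.+1.
    by rewrite exprS; ring.
  rewrite (le_trans (ncB _ _))// lerD//.
    by rewrite (le_trans (Hr w wr))// ler_wpM2r ?exprn_ge0 ?(ltW r0)// ler_norm.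
  by rewrite ler_peMr ?nc_ge0// exprn_ege1.
exists (p * 'X + (f 0)%:P) => [|z]; last by rewrite hornerMXaddC -Hp Hg addrC mulrC.
by rewrite size_MXaddC; case: ifP => //.
Qed.

End CauchySquare.

(** * Primitives of integrable functions *)

Section Primitive.
Context {R : realType}.
Implicit Types (f g F G : R -> R[i]) (a b c d e s t : R) (k z w : R[i]).

(** [F] is a primitive of [f] on [[a, b]] in the sense of Caratheodory. The integral identity is
    stable under sums and products and stands in for almost everywhere derivatives. *)
Definition prim a b f F : Prop := [/\ cin a b f, ccont F &
  forall s t, a <= s -> s <= t -> t <= b -> F t - F s = Cintegral s t f].

Lemma prim_ext a b f g F : (forall t, a <= t <= b -> f t = g t) ->
  prim a b f F -> prim a b g F.
Proof.
move=> fg [fi cF H]; split=> //; first exact: cin_ext fi.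
move=> s t as_ st tb; rewrite H//; apply: CI_ext => u /andP[su ut].
by apply: fg; rewrite (le_trans as_ su) (le_trans ut tb).
Qed.

Lemma prim_sub a b c d f F : a <= c -> d <= b -> prim a b f F -> prim c d f F.
Proof.
move=> ac db [fi cF H]; split=> //; first exact: cin_sub ac db fi.
by move=> s t cs st td; apply: H => //; [exact: le_trans cs|exact: le_trans db].
Qed.

Lemma prim_cst a b k : prim a b (fun=> 0) (fun=> k).
Proof.
split; [exact/cin_cont/ccont_cst|exact: ccont_cst|].
by move=> s t _ st _; rewrite CI_cst// mul0r subrr.
Qed.

Lemma primD a b f g F G : prim a b f F -> prim a b g G ->
  prim a b (fun t => f t + g t) (fun t => F t + G t).
Proof.
move=> [fi cF HF] [gi cG HG]; split; [exact: cinD|exact: ccontD|].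
move=> s t as_ st tb; rewrite CID; try exact: (cin_sub as_ tb).
by rewrite -HF// -HG//; ring.
Qed.

Lemma primZ a b k f F : prim a b f F -> prim a b (fun t => k * f t) (fun t => k * F t).
Proof.
move=> [fi cF HF]; split; [exact: cinZ|exact: ccontM (ccont_cst k) cF|].
by move=> s t as_ st tb; rewrite CIZ; [rewrite -HF// mulrBr|exact: (cin_sub as_ tb)].
Qed.

Lemma primN a b f F : prim a b f F -> prim a b (fun t => - f t) (fun t => - F t).
Proof.
move=> [fi cF HF]; split; [exact: cinN|exact: ccontN|].
move=> s t as_ st tb; rewrite CIN; last exact: (cin_sub as_ tb).
by rewrite -HF// opprB opprK addrC.
Qed.

Lemma primB a b f g F G : prim a b f F -> prim a b g G ->
  prim a b (fun t => f t - g t) (fun t => F t - G t).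
Proof. by move=> pf /primN pg; exact: (primD pf pg). Qed.

Lemma primJ a b f F : prim a b f F -> prim a b (fun t => (f t)^*%C) (fun t => (F t)^*%C).
Proof.
move=> [fi cF HF]; split; [exact: cinJ|exact: ccontJ|].
move=> s t as_ st tb; rewrite (CIJ (f := f)); last exact: (cin_sub as_ tb).
by rewrite -HF// rmorphB.
Qed.

Lemma prim_cder a b f F : ccont f -> cder F f -> prim a b f F.
Proof.
move=> cf Ff; split; [exact: cin_cont|exact: cder_ccont Ff|].
by move=> s t _ st _; rewrite (CI_FTC2 st cf Ff).
Qed.

(** Integration by parts for integrable [f] and [g]. On a short interval [F] and [G] vary by less
    than [e / 2], so the defect of the identity is at most [e * W] there. Defects and [W] are both
    additive, so this bound passes to every interval, and [e] is arbitrary. *)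
Lemma primM a b f g F G : prim a b f F -> prim a b g G ->
  prim a b (fun t => f t * G t + F t * g t) (fun t => F t * G t).
Proof.
move=> [fi cF HF] [gi cG HG].
pose h t := f t * G t + F t * g t.
have fGi := cinM fi cG.
have gFi : cin a b (fun t => F t * g t).
  by apply: cin_ext (cinM gi cF) => t _; rewrite mulrC.
have hi : cin a b h by exact: cinD.
split=> //; first exact: ccontM.
pose W s t : R := L1norm s t f + L1norm s t g.
have small e : 0 < e -> exists2 d : R, 0 < d & forall s t, a <= s -> s <= t ->
    t <= b -> t - s < d -> nc (F t * G t - F s * G s - Cintegral s t h) <= e * W s t.
  move=> e0; have e20 : 0 < e / 2 by lra.
  have [d1 d10 H1] := ccont_unif a b cF e20.
  have [d2 d20 H2] := ccont_unif a b cG e20.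
  exists (Num.min d1 d2) => [|s t as_ st tb]; first by rewrite lt_min d10.
  rewrite lt_min => /andP[td1 td2].
  have fsi := cin_sub as_ tb fi; have gsi := cin_sub as_ tb gi.
  have cc1 : ccont (fun u => G t - G u) by apply: ccontB cG; exact: ccont_cst.
  have cc2 : ccont (fun u => F s - F u) by apply: ccontB cF; exact: ccont_cst.
  have -> : F t * G t - F s * G s - Cintegral s t h =
      Cintegral s t (fun u => f u * (G t - G u)) +
      Cintegral s t (fun u => g u * (F s - F u)).
    have -> : F t * G t - F s * G s = (F t - F s) * G t + F s * (G t - G s) by ring.
    rewrite HF// HG// -CID; [|exact: cinM..].
    have -> : Cintegral s t f * G t = Cintegral s t (fun u => G t * f u).
      by rewrite CIZ// mulrC.
    rewrite -CIZ// -CID; [|exact: cinZ..].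
    rewrite -CIB; last 2 first.
    - by apply: cinD; exact: cinZ.
    - exact: (cin_sub as_ tb).
    by apply: CI_ext => u _; rewrite /h; ring.
  rewrite (le_trans (ncD _ _))// mulrDr lerD//.
    rewrite (le_trans (nc_CIM_le (K := e / 2) fsi cc1 _))//.
      move=> u /andP[su ut]; apply: ltW; apply: H2.
      - by rewrite (le_trans as_ st).
      - by rewrite (le_trans as_ su) (le_trans ut tb).
      - by rewrite ger0_norm; lra.
    by rewrite mulrCA divff// mulr1.
  rewrite (le_trans (nc_CIM_le (K := e / 2) gsi cc2 _))//.
    move=> u /andP[su ut]; apply: ltW; apply: H1.
    - by rewrite as_ (le_trans st tb).
    - by rewrite (le_trans as_ su) (le_trans ut tb).
    - by rewrite ler0_norm; lra.
  by rewrite mulrCA divff// mulr1.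
have Wsplit s m t : a <= s -> s <= m -> m <= t -> t <= b -> W s t = W s m + W m t.
  move=> as_ sm mt tb; rewrite /W (@L1_split _ s t m f) ?sm//; last exact: cin_sub fi.
  rewrite (@L1_split _ s t m g) ?sm//; last exact: cin_sub gi.
  ring.
move=> s t as_ st tb; apply/eqP; rewrite -subr_eq0 -nc_eq0 eq_le nc_ge0 andbT.
set E := nc _; rewrite leNgt; apply/negP => E0.
have W0 : 0 <= W s t by rewrite addr_ge0// L1_ge0.
(* Chosen so that [e * W s t < E]. *)
pose e := E / (2 * (W s t + 1)).
have e0 : 0 < e by rewrite divr_gt0//; lra.
have [d d0 Hd] := small e e0.
(* The interval is exhausted in [n] steps of length [d / 2], strictly shorter than the [d] of
   [small]. *)
have main n : forall m, s <= m -> m <= t -> m - s <= n%:R * (d / 2) ->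
    nc (F m * G m - F s * G s - Cintegral s m h) <= e * W s m.
  elim: n => [|n IH] m sm mt ms.
    rewrite mul0r in ms; apply: Hd => //; first exact: le_trans mt tb.
    lra.
  pose p := Num.max s (m - d / 2).
  have sp : s <= p by rewrite le_max lexx.
  have pm : p <= m by rewrite ge_max sm; lra.
  have ps : p - s <= n%:R * (d / 2).
    rewrite -natr1 mulrDl mul1r in ms.
    have n0 : 0 <= n%:R * (d / 2) by rewrite mulr_ge0//; lra.
    by rewrite /p lerBlDr ge_max; apply/andP; split; lra.
  have mp : m - p < d.
    have : m - d / 2 <= p by rewrite le_max lexx orbT.
    lra.
  have hsm : cin s m h by apply: cin_sub hi => //; exact: le_trans mt tb.
  have spm : s <= p <= m by rewrite sp.
  rewrite (CI_split spm hsm) (Wsplit s p m)//; last exact: le_trans mt tb.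
  have -> : F m * G m - F s * G s - (Cintegral s p h + Cintegral p m h) =
    (F p * G p - F s * G s - Cintegral s p h) +
    (F m * G m - F p * G p - Cintegral p m h) by ring.
  rewrite (le_trans (ncD _ _))// mulrDr lerD//.
    by apply: IH => //; exact: le_trans pm mt.
  apply: Hd => //; [exact: le_trans sp|exact: le_trans mt tb].
have := main (Num.bound ((t - s) / (d / 2))) t st (lexx t).
have d20 : 0 < d / 2 by lra.
rewrite -ler_pdivrMr// => /(_ (ltW (archi_boundP _))).
rewrite divr_ge0; [|by lra..] => /(_ isT).
rewrite -/E /e mulrAC ler_pdivlMr; last by lra.
nra.
Qed.

End Primitive.

Section ComplexExponential.
Context {R : realType}.
Implicit Types (z w c : R[i]) (t : R).

Definition cexp z : R[i] := (expR (complex.Re z) * cos (complex.Im z)) +i*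
  (expR (complex.Re z) * sin (complex.Im z)).

Lemma cexp0 : cexp 0 = 1.
Proof. by rewrite /cexp /= expR0 cos0 sin0 mulr1 mulr0. Qed.

Lemma cexpD z w : cexp (z + w) = cexp z * cexp w.
Proof.
apply: complexP; rewrite !ReImE /= !ReImE expRD ?cosD ?sinD; ring.
Qed.

Lemma cexpN z : cexp z * cexp (- z) = 1.
Proof. by rewrite -cexpD subrr cexp0. Qed.

Lemma nc_cexp z : nc (cexp z) = expR (complex.Re z).
Proof.
by rewrite /nc /= !exprMn -mulrDr cos2Dsin2 mulr1 sqrtr_sqr ger0_norm// expR_ge0.
Qed.

Lemma cder_cexp c : cder (fun t => cexp (c * t%:C)) (fun t => c * cexp (c * t%:C)).
Proof.
move=> t; have E (s : R) : (c * s%:C) = (complex.Re c * s) +i* (complex.Im c * s).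
  by apply: complexP; rewrite !ReImE /=; ring.
split; rewrite /cexp !E /=.
  under eq_fun do rewrite E /=.
  by apply: is_derive_eq; rewrite /GRing.scale !ReImE /=; ring.
under eq_fun do rewrite E /=.
by apply: is_derive_eq; rewrite /GRing.scale !ReImE /=; ring.
Qed.

Lemma ccont_cexp c : ccont (fun t => cexp (c * t%:C)).
Proof. exact: cder_ccont (cder_cexp c). Qed.

Lemma prim_cexp a b c :
  prim a b (fun t => c * cexp (c * t%:C)) (fun t => cexp (c * t%:C)).
Proof.
apply: prim_cder (cder_cexp c).
by apply: ccontM (ccont_cexp c); exact: ccont_cst.
Qed.

End ComplexExponential.

(** * The linear system *)

Section Clamp.
Context {R : realType}.
Implicit Types (a b s t T : R).

(** The 1-Lipschitz retraction of the line onto [[0, T]]. *)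
Definition clamp T t : R := Num.max 0 (Num.min t T).

Lemma clamp_id T t : 0 <= t <= T -> clamp T t = t.
Proof. by move=> /andP[t0 tT]; rewrite /clamp min_l// max_r. Qed.

Lemma clamp_itv T t : 0 <= T -> 0 <= clamp T t <= T.
Proof.
move=> T0; rewrite /clamp le_max lexx /= ge_max T0 /=.
by rewrite ge_min lexx orbT.
Qed.

Lemma clamp_lip T s t : 0 <= T -> `|clamp T s - clamp T t| <= `|s - t|.
Proof.
move=> T0; wlog st : s t / s <= t.
  move=> H; have [st|/ltW ts] := leP s t; first exact: H.
  by rewrite distrC (distrC s); exact: H.
suff /andP[h1 h2] : clamp T s <= clamp T t <= clamp T s + (t - s).
  by rewrite !ler0_norm; lra.
rewrite /clamp /Order.max /Order.min.
by case: (ltP s T) => ?; case: (ltP t T) => ?; case: (ltP 0 s) => ?;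
  case: (ltP 0 t) => ?; case: (ltP 0 T) => ?; apply/andP; split; lra.
Qed.

Lemma clamp_continuous T (f : R -> R) : 0 <= T ->
  {within `[0, T], continuous f} -> continuous (fun t => f (clamp T t)).
Proof.
move=> T0 /subspace_continuousP cf t.
have ct : `[0, T]%classic (clamp T t) by rewrite /= in_itv/= clamp_itv.
apply/cvgrPdist_lt => e e0.
have := cf _ ct => /cvgrPdist_lt/(_ _ e0).
rewrite /within /= => /nbhs_ballP[d /= d0 Hd].
apply/nbhs_ballP; exists d => //= s; rewrite /ball /= => st.
apply: Hd; last by rewrite /= in_itv/= clamp_itv.
by rewrite /ball /= (le_lt_trans (clamp_lip _ _ T0)).
Qed.

End Clamp.

Section RowSolutions.
Context {R : realType}.
Implicit Types (q x y : R -> R[i]) (a b c d s t T : R) (l k z : R[i]).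

(* (x, y) is a row of a solution of F' = F alpha. *)
Definition rowsol a b q l x y : Prop :=
  prim a b (fun t => 'i%C * l / 2 * x t - (q t)^*%C / 2 * y t) x /\
  prim a b (fun t => q t / 2 * x t - 'i%C * l / 2 * y t) y.

Lemma rowsol_sub a b c d q l x y : a <= c -> d <= b ->
  rowsol a b q l x y -> rowsol c d q l x y.
Proof. by move=> ac db [px py]; split; exact: (prim_sub ac db). Qed.

Lemma rowsol_lin a b q l x y x' y' k k' : rowsol a b q l x y ->
  rowsol a b q l x' y' ->
  rowsol a b q l (fun t => k * x t + k' * x' t) (fun t => k * y t + k' * y' t).
Proof.
move=> [px py] [px' py']; split.
  by apply: prim_ext (primD (primZ k px) (primZ k' px')) => t _; ring.
by apply: prim_ext (primD (primZ k py) (primZ k' py')) => t _; ring.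
Qed.

(** This symmetry will reduce the second diagonal entry of the monodromy to the first. *)
Lemma rowsol_swap a b q l x y : rowsol a b q l x y ->
  rowsol a b (fun t => - (q t)^*%C) (- l) y x.
Proof.
move=> [px py]; split.
  by apply: prim_ext py => t _; rewrite !conjCE; ring.
by apply: prim_ext px => t _; ring.
Qed.

(** The potential cancels and only [l - l'] survives. For [l = l'] this is the constancy of the
    determinant; otherwise it gives the dependence of the frame on the spectral parameter. *)
Lemma wronskian a b q l l' x y x' y' : rowsol a b q l x y ->
  rowsol a b q l' x' y' ->
  prim a b (fun t => 'i%C * (l - l') / 2 * (x t * y' t + y t * x' t))
    (fun t => x t * y' t - y t * x' t).
Proof.
move=> [px py] [px' py'].
by apply: prim_ext (primB (primM px py') (primM py px')) => t _; ring.
Qed.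

(** For real [l] the matrix [alpha] is skew-hermitian, so the norm of a row changes only through
    [Im l]; in particular [q] does not enter. *)
Lemma energy a b q l x y : rowsol a b q l x y ->
  prim a b (fun t => (complex.Im l)%:C * (y t * (y t)^*%C - x t * (x t)^*%C))
    (fun t => x t * (x t)^*%C + y t * (y t)^*%C).
Proof.
move=> [px py].
apply: prim_ext (primD (primM px (primJ px)) (primM py (primJ py))) => t _.
by rewrite !conjCE ImJ_sub; field.
Qed.

Lemma mulJ_nc z : z * z^*%C = (nc z ^+ 2)%:C.
Proof. by rewrite -sqr_normc normr_nc rmorphXn. Qed.

(** By [energy] the squared norm changes at a rate of at most [|Im l|] times itself, so its product
    with [e^(-|Im l| t)] does not increase. The bound does not depend on [q]. *)
Lemma gronwall a b q l x y s t : rowsol a b q l x y ->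
  a <= s -> s <= t -> t <= b ->
  nc (x t) ^+ 2 + nc (y t) ^+ 2 <=
  expR (`|complex.Im l| * (t - s)) * (nc (x s) ^+ 2 + nc (y s) ^+ 2).
Proof.
move=> xy as_ st tb; set v := complex.Im l.
have := primM (energy xy) (prim_cexp a b (- `|v|%:C)).
set h := fun t => _ : R[i]; move=> [hi _ H].
have E u : cexp (- `|v|%:C * u%:C) = (expR (- `|v| * u))%:C.
  by rewrite -rmorphN -rmorphM /cexp /= cos0 sin0 mulr1 mulr0.
have hre u : complex.Re (h u) <= 0.
  rewrite /h !mulJ_nc E !ReImE /= -/v.
  set A := nc _ ^+ 2; set B := nc _ ^+ 2; set X := expR _.
  have A0 : 0 <= A by rewrite sqr_ge0.
  have B0 : 0 <= B by rewrite sqr_ge0.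
  have X0 : 0 <= X by rewrite expR_ge0.
  rewrite -oppr_ge0 [leRHS](_ : _ = X * ((`|v| - v) * A + (`|v| + v) * B)).
    rewrite mulr_ge0// addr_ge0// mulr_ge0//.
      by rewrite subr_ge0 ler_norm.
    by have := ler_norm (- v); rewrite normrN; lra.
  ring.
have := H s t as_ st tb => /(congr1 (@complex.Re R)).
rewrite !mulJ_nc !E !ReImE /= !mulr0 !subr0.
have : \int[lebesgue_measure]_(s in `[s, t]) complex.Re (h s) <= 0.
  rewrite -[X in _ <= X](mul0r (t - s)) -rint_cst//; apply: rint_le => //.
    by have [] := cin_sub as_ tb hi.
  by apply: rin_cont => u; exact: cvg_cst.
move=> I0 E1.
have E2 : expR (`|v| * (t - s)) = expR (`|v| * t) * expR (- `|v| * s).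
  by rewrite -expRD; congr expR; ring.
have E3 : expR (`|v| * t) * expR (- `|v| * t) = 1.
  by rewrite -expRD -mulrDl subrr mul0r expR0.
rewrite E2; set N := nc (x t) ^+ 2 + _ in E1 *; set N' := nc (x s) ^+ 2 + _ in E1 *.
have -> : N = expR (`|v| * t) * (N * expR (- `|v| * t)) by rewrite mulrCA E3 mulr1.
rewrite -mulrA ler_wpM2l ?expR_ge0//; lra.
Qed.

Lemma rowsol_bound a b q l x y s t : rowsol a b q l x y ->
  a <= s -> s <= t -> t <= b -> nc (x s) ^+ 2 + nc (y s) ^+ 2 = 1 ->
  nc (x t) <= expR (`|complex.Im l| * (t - s) / 2) /\
  nc (y t) <= expR (`|complex.Im l| * (t - s) / 2).
Proof.
move=> xy as_ st tb N1; have := gronwall xy as_ st tb; rewrite N1 mulr1.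
set E := _ * (t - s).
have -> : expR E = expR (E / 2) ^+ 2 by rewrite expr2 -expRD -splitr.
move=> H; split; rewrite -(@ler_pXn2r _ 2) ?nnegrE ?nc_ge0 ?expR_ge0//;
  apply: le_trans H; rewrite ?lerDl ?lerDr sqr_ge0//.
Qed.

Lemma frame_rowsol T q l (F : R -> 'M[R[i]]_2) (i : 'I_2) : 0 <= T -> cin 0 T q ->
  frame_solution T q l F ->
  rowsol 0 T q l (fun t => F (clamp T t) i 0) (fun t => F (clamp T t) i 1).
Proof.
move=> T0 qi HF.
have cF j : ccont (fun t => F (clamp T t) i j).
  have [c1 c2 _] := HF i j.
  by split; [exact: (clamp_continuous T0 c1)|exact: (clamp_continuous T0 c2)].
have aux j f : cin 0 T f -> (forall t, 0 <= t <= T -> f t = (F t *m alpha q t l) i j) ->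
    prim 0 T f (fun t => F (clamp T t) i j).
  move=> fi fE; split=> // s t s0 st tT.
  have [_ _ H] := HF i j.
  have tI : 0 <= t <= T by rewrite (le_trans s0).
  have sI : 0 <= s <= T by rewrite s0 (le_trans st).
  rewrite !clamp_id// !H//.
  have E u : 0 <= u <= T -> Cintegral 0 u (fun s => (F s *m alpha q s l) i j) =
      Cintegral 0 u f.
    move=> /andP[u0 uT]; apply: CI_ext => w /andP[w0 wu].
    by rewrite fE// w0 (le_trans wu).
  rewrite !E// (@CI_split _ 0 t s f) ?s0//; last exact: cin_sub fi.
  ring.
have qJi := cinJ qi.
have hc : ccont (fun=> 'i%C * l / 2 : R[i]) := ccont_cst _.
have E2 u j : (F u *m alpha q u l) i j =
    F u i 0 * alpha q u l 0 j + F u i 1 * alpha q u l 1 j.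
  rewrite mxE big_ord_recl big_ord1.
  by rewrite (_ : lift ord0 ord0 = 1)//; apply: val_inj.
split; apply: aux.
- apply: cinB; first exact/cin_cont/ccontM.
  by apply: cinM => //; apply: cin_ext (cinZ 2^-1 qJi) => t _; rewrite mulrC.
- by move=> t tI; rewrite clamp_id// E2 !mxE /=; ring.
- apply: cinB; last exact/cin_cont/ccontM.
  by apply: cinM => //; apply: cin_ext (cinZ 2^-1 qi) => t _; rewrite mulrC.
- by move=> t tI; rewrite clamp_id// E2 !mxE /=; ring.
Qed.

(** On a bounded interval square integrable functions are integrable, by [|u| <= 1 + u^2 + w^2]. *)
Lemma L2_cin T q : L2_potential T q -> cin 0 T q.
Proof.
move=> [mr mi ri].
have one : rin 0 T (fun=> 1) by apply: rin_cont => t; exact: cvg_cst.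
have H := rinD one ri.
have le u w : `|u| <= `|1 + (u ^+ 2 + w ^+ 2)| :> R.
  have u2 := sqr_ge0 u; have w2 := sqr_ge0 w.
  rewrite [X in _ <= X]ger0_norm; last by lra.
  rewrite -(real_normK (num_real u)).
  by have := sqr_ge0 (`|u| - 1); have := normr_ge0 u; nra.
split; apply: (le_integrable _ _ _ H) => //.
- exact/measurable_EFinP.
- by move=> t _; rewrite /= lee_fin.
- exact/measurable_EFinP.
- by move=> t _; rewrite /= lee_fin [X in 1 + X]addrC.
Qed.

End RowSolutions.

(** * Asymptotics of the trace of the monodromy *)

Section RiemannLebesgue.
Context {R : realType}.
Implicit Types (q f g x y : R -> R[i]) (a b e s t T K L v : R) (l z : R[i]).
Local Notation mu := (@lebesgue_measure R).

Lemma rin_approx a b (f : R -> R) e : a <= b -> rin a b f -> 0 < e ->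
  exists2 g : R -> R, continuous g & \int[mu]_(s in `[a, b]) `|f s - g s| < e.
Proof.
move=> ab fi e0.
have [//|||g [cg gi Hg]] := @approximation_continuous_integrable R `[a, b] f.
  by rewrite /= lebesgue_measure_itv/=; case: ifP => // _; rewrite -EFinD ltry.
  exact: fi.
move/fine_cvgP: Hg => [_ /cvgrPdist_lt/(_ _ e0)[N _ HN]].
exists (g N) => //; have := HN N (leqnn N); rewrite sub0r normrN.
by apply: le_lt_trans; exact: ler_norm.
Qed.

Lemma cin_approx a b q e : a <= b -> cin a b q -> 0 < e ->
  exists2 g, ccont g & L1norm a b (fun t => q t - g t) < e.
Proof.
move=> ab [q1 q2] e0; have e20 : 0 < e / 2 by lra.
have [g1 c1 H1] := rin_approx ab q1 e20; have [g2 c2 H2] := rin_approx ab q2 e20.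
exists (fun t => g1 t +i* g2 t); first by split.
rewrite /L1norm [e]splitr; apply: ltrD.
  by rewrite (@rint_ext _ _ _ _ (fun s => `|complex.Re (q s) - g1 s|))// => t _;
    rewrite !ReImE.
by rewrite (@rint_ext _ _ _ _ (fun s => `|complex.Im (q s) - g2 s|))// => t _;
  rewrite !ReImE.
Qed.

Lemma Re_il l t : complex.Re ('i%C * l * t%:C) = - (complex.Im l * t).
Proof. by rewrite !ReImE /=; ring. Qed.

Lemma expR_between v s t u : s <= u -> u <= t ->
  expR (- (v * u)) <= expR (- (v * s)) + expR (- (v * t)).
Proof.
move=> su ut; have [v0|v0] := leP 0 v.
  by rewrite ler_wpDr ?expR_ge0// ler_expR; nra.
by rewrite ler_wpDl ?expR_ge0// ler_expR; nra.
Qed.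

(** Replace [q] by a continuous [g] close in the L^1 norm, treat [g] as constant on short pieces,
    and integrate the exponential exactly, which gains [1 / nc l]. As [l] is complex, the
    exponential is unbounded; it is monotone in norm, so its two end values dominate it, and this is
    the weight in the bound. *)
Lemma riemann_lebesgue T q e : 0 <= T -> cin 0 T q -> 0 < e ->
  exists2 L : R, 0 < L & forall l s t, L <= nc l -> 0 <= s -> s <= t -> t <= T ->
  nc (Cintegral s t (fun u => q u * cexp ('i%C * l * u%:C))) <=
  e * (expR (- (complex.Im l * s)) + expR (- (complex.Im l * t))).
Proof.
move=> T0 qi e0; have e40 : 0 < e / 4 by lra.
have [g cg Hg] := cin_approx T0 qi e40.
have [K K0 HK] := ccont_bounded 0 T cg.
(* Budget, in units of the weight [E0]: [e / 2] for replacing [q] by [g], [e / 4] for the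
   oscillation of [g] on the pieces (through [e1]), and [e / 4] for the exact integrals over at most
   [N + 1] pieces (through [L]). *)
pose e1 := e / (8 * (T + 1)).
have e10 : 0 < e1 by rewrite divr_gt0//; lra.
have [d d0 Hd] := ccont_unif 0 T cg e10.
pose N := Num.bound (T / (d / 2)).
pose L := 8 * (N%:R + 1) * K / e + 1.
have N0 : 0 <= N%:R :> R by [].
have LK : 0 <= 8 * (N%:R + 1) * K / e.
  by rewrite divr_ge0 ?(ltW e0)// !mulr_ge0//; lra.
exists L => [|l s0 t0 Ll s00 st0 tT0]; first by rewrite /L; lra.
set E0 := _ + expR _; pose c := 'i%C * l.
have l0 : 0 < nc l by rewrite (lt_le_trans _ Ll)// /L; lra.
have E00 : 0 < E0 by rewrite addr_gt0// expR_gt0.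
have Eb u : s0 <= u <= t0 -> nc (cexp (c * u%:C)) <= E0.
  by move=> /andP[su ut]; rewrite nc_cexp Re_il expR_between.
have cc := ccont_cexp c.
have cint s t : s0 <= s -> s <= t -> t <= t0 ->
    nc (Cintegral s t (fun u => cexp (c * u%:C))) <= 2 * E0 / nc l.
  move=> s0s st tt0; have [_ _ /(_ s t) H] := prim_cexp s0 t0 c.
  have ccu : cin s t (fun u => cexp (c * u%:C)) by exact: cin_cont.
  rewrite ler_pdivlMr//.
  have -> : nc (Cintegral s t (fun u => cexp (c * u%:C))) * nc l =
      nc (Cintegral s t (fun u => c * cexp (c * u%:C))).
    by rewrite CIZ// !ncM nc_i mul1r mulrC.
  rewrite -H// (le_trans (ncB _ _))//.
  have := Eb s; rewrite s0s (le_trans st tt0) => /(_ isT).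
  have := Eb t; rewrite tt0 (le_trans s0s st) => /(_ isT); lra.
pose h u := g u * cexp (c * u%:C).
have ch : ccont h by exact: ccontM.
have small s t : s0 <= s -> s <= t -> t <= t0 -> t - s < d ->
    nc (Cintegral s t h) <= 2 * e1 * E0 * (t - s) + 2 * K * E0 / nc l.
  move=> s0s st tt0 tsd.
  have -> : Cintegral s t h = Cintegral s t (fun u => (g u - g s) * cexp (c * u%:C)) +
      g s * Cintegral s t (fun u => cexp (c * u%:C)).
    have ccu : cin s t (fun u => cexp (c * u%:C)) by exact: cin_cont.
    rewrite -CIZ// -CID; last exact: cinZ.
      by apply: CI_ext => u _; rewrite /h; ring.
    by apply/cin_cont/ccontM => //; apply: ccontB => //; exact: ccont_cst.
  rewrite (le_trans (ncD _ _))// lerD//.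
    rewrite -mulrA (mulrC 2); rewrite (le_trans (nc_CI_le (K := e1 * E0) st _ _))//; last by lra.
      by apply/cin_cont/ccontM => //; apply: ccontB => //; exact: ccont_cst.
    move=> u /andP[su ut]; rewrite ncM ler_pM ?nc_ge0//.
      apply: ltW; apply: Hd.
      - by rewrite (le_trans s00)/= ?(le_trans s0s)// (le_trans ut)// (le_trans tt0).
      - by rewrite (le_trans s00)//= (le_trans st)// (le_trans tt0).
      - by rewrite ger0_norm; lra.
    by apply: Eb; rewrite (le_trans s0s su) (le_trans ut tt0).
  rewrite ncM; have -> : 2 * K * E0 / nc l = K * (2 * E0 / nc l) by field; lra.
  rewrite ler_pM ?nc_ge0//; last exact: cint.
  by apply: HK; rewrite (le_trans s00 s0s) (le_trans st (le_trans tt0 tT0)).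
have main n : forall t, s0 <= t -> t <= t0 -> t - s0 <= n%:R * (d / 2) ->
    nc (Cintegral s0 t h) <= 2 * e1 * E0 * (t - s0) + (n%:R + 1) * (2 * K * E0 / nc l).
  elim: n => [|n IH] t st tt0 tn.
    rewrite mul0r in tn; rewrite add0r mul1r; apply: small => //; lra.
  pose p := Num.max s0 (t - d / 2).
  have sp : s0 <= p by rewrite le_max lexx.
  have pt : p <= t by rewrite ge_max st; lra.
  have ps : p - s0 <= n%:R * (d / 2).
    rewrite -natr1 mulrDl mul1r in tn.
    have n0 : 0 <= n%:R * (d / 2) by rewrite mulr_ge0//; lra.
    by rewrite /p lerBlDr ge_max; apply/andP; split; lra.
  have tp : t - p < d.
    have : t - d / 2 <= p by rewrite le_max lexx orbT.
    lra.
  have spt : s0 <= p <= t by rewrite sp.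
  rewrite (CI_split spt (cin_cont _ _ ch)) (le_trans (ncD _ _))//.
  have H1 := IH p sp (le_trans pt tt0) ps.
  have H2 := small p t sp pt tt0 tp.
  rewrite -natr1; set A := 2 * K * E0 / nc l in H1 H2 *.
  have -> : 2 * e1 * E0 * (t - s0) = 2 * e1 * E0 * (p - s0) + 2 * e1 * E0 * (t - p).
    by ring.
  lra.
have Hh : nc (Cintegral s0 t0 h) <= e / 2 * E0.
  have := main N t0 st0 (lexx t0).
  have d20 : 0 < d / 2 by lra.
  have dN : t0 - s0 <= N%:R * (d / 2).
    rewrite -ler_pdivrMr//; apply: (@le_trans _ _ (T / (d / 2))).
      by rewrite ler_pM2r ?invr_gt0//; lra.
    by apply/ltW/archi_boundP; rewrite divr_ge0//; lra.
  move=> /(_ dN); set A := _ / nc l => H.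
  have A1 : (N%:R + 1) * A <= e / 4 * E0.
    have -> : (N%:R + 1) * A = (2 * (N%:R + 1) * K / nc l) * E0.
      by rewrite /A; field; lra.
    rewrite ler_wpM2r ?(ltW E00)// ler_pdivrMr//.
    have : 8 * (N%:R + 1) * K / e <= nc l by rewrite (le_trans _ Ll)// /L; lra.
    by rewrite ler_pdivrMr//; lra.
  have A2 : 2 * e1 * E0 * (t0 - s0) <= e / 4 * E0.
    have -> : 2 * e1 * E0 * (t0 - s0) = (2 * e1 * (t0 - s0)) * E0 by ring.
    rewrite ler_wpM2r ?(ltW E00)//.
    have -> : e / 4 = 2 * e1 * (T + 1) by rewrite /e1; field; lra.
    by rewrite ler_wpM2l//; lra.
  lra.
have qst : cin s0 t0 q by exact: cin_sub qi.
have gst : cin s0 t0 g by exact: cin_cont.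
have -> : Cintegral s0 t0 (fun u => q u * cexp (c * u%:C)) = Cintegral s0 t0 h +
    Cintegral s0 t0 (fun u => (q u - g u) * cexp (c * u%:C)).
  rewrite -CID; [|exact: cin_cont|apply: cinM => //; exact: cinB].
  by apply: CI_ext => u _; rewrite /h; ring.
rewrite (le_trans (ncD _ _))//.
have qgi : cin s0 t0 (fun u => q u - g u) by exact: cinB.
have B := nc_CIM_le qgi cc Eb.
have qg0 : cin 0 T (fun u => q u - g u) by apply: cinB => //; exact: cin_cont.
have := L1_sub s00 st0 tT0 qg0 => B1.
have : 2 * E0 * L1norm s0 t0 (fun u => q u - g u) <= 2 * E0 * (e / 4).
  by rewrite ler_wpM2l//; lra.
lra.
Qed.

End RiemannLebesgue.

Section Asymptotics.
Context {R : realType}.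
Implicit Types (q f g x y : R -> R[i]) (a b e s t T K L v r : R) (l z : R[i]).

Lemma rint_continuous T (f : R -> R) : 0 <= T -> rin 0 T f ->
  continuous (fun t => \int[lebesgue_measure]_(s in `[0, clamp T t]) f s).
Proof.
move=> T0 fi.
exact: (clamp_continuous T0 (parameterized_integral_continuous T0 fi)).
Qed.

Lemma prim_indefinite T f : 0 <= T -> cin 0 T f ->
  prim 0 T f (fun t => Cintegral 0 (clamp T t) f).
Proof.
move=> T0 [f1 f2]; split=> //; first by split; exact: rint_continuous.
move=> s t s0 st tT.
rewrite !clamp_id ?s0 ?(le_trans s0 st) ?(le_trans st tT)//.
rewrite (@CI_split _ 0 t s f) ?s0//; last exact: (cin_sub _ tT (conj f1 f2)).
by rewrite addrAC subrr add0r.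
Qed.

Lemma prim_FTC a b f F : a <= b -> prim a b f F -> Cintegral a b f = F b - F a.
Proof. by move=> ab [_ _ H]; rewrite H. Qed.

(** With [h = i l / 2], the variables [x e^(-ht)] and [y e^(ht)] satisfy an off-diagonal system
    ([pX], [pY]). The bound [ylt] shows that [y e^(ht)] is smaller than its a priori size by the
    factor [C * e1]; inserted in the equation for [x e^(-ht)], it keeps this variable close to its
    initial value 1. *)
Lemma rowsol_asymptotics T q e : 0 <= T -> cin 0 T q -> 0 < e ->
  exists2 L : R, 0 < L & forall l x y, L <= nc l -> rowsol 0 T q l x y ->
  x 0 = 1 -> y 0 = 0 ->
  nc (x T - cexp ('i%C * l / 2 * T%:C)) <= e * expR (`|complex.Im l| * T / 2).
Proof.
move=> T0 qi e0; pose Q := L1norm 0 T (fun t => q t / 2).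
pose QJ := L1norm 0 T (fun t => (q t)^*%C / 2).
have Q0 : 0 <= Q by exact: L1_ge0.
have QJ0 : 0 <= QJ by exact: L1_ge0.
(* In the bound for [y e^(ht)], the boundary term [kap 0] contributes 2 and the remaining integral
   [4 * QJ]. The final estimate is [2 * C * e1 * QJ], whence the choice of [e1]. *)
have [C C0 CE] : exists2 C, 0 < C & C = 2 + 4 * QJ.
  by exists (2 + 4 * QJ) => //; lra.
have [e1 e10 e1E] : exists2 e1, 0 < e1 & e = 2 * C * e1 * (QJ + 1).
  exists (e / (2 * C * (QJ + 1))); first by rewrite divr_gt0// mulr_gt0//; lra.
  by field; apply/andP; split; lra.
have q2i : cin 0 T (fun t => q t / 2) by apply: cinM => //; exact: ccont_cst.
have qJ2i : cin 0 T (fun t => (q t)^*%C / 2).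
  by apply: cinM; [exact: cinJ|exact: ccont_cst].
have [L L0 HL] := riemann_lebesgue T0 q2i e10.
exists L => // l x y Ll xy x0 y0.
pose h : R[i] := 'i%C * l / 2; pose v := complex.Im l.
have hre t : complex.Re (h * t%:C) = - (v * t / 2).
  rewrite /h (_ : _ / 2 * t%:C = 'i%C * l * (t / 2)%:C) ?Re_il ?mulrA//.
  by rewrite rmorphM fmorphV rmorph_nat; ring.
have h2 t : cexp (h * t%:C) = cexp ('i%C * l * t%:C) * cexp (- h * t%:C).
  by rewrite -cexpD; congr cexp; rewrite /h; field.
have [px py] := xy.
have [_ cx _] := px; have [_ cy _] := py.
have ce z := ccont_cexp z.
have pY : prim 0 T (fun t => q t / 2 * (x t * cexp (h * t%:C)))
    (fun t => y t * cexp (h * t%:C)).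
  by apply: prim_ext (primM py (prim_cexp 0 T h)) => t _; rewrite /h; ring.
have pX : prim 0 T (fun t => - ((q t)^*%C / 2 * (y t * cexp (- h * t%:C))))
    (fun t => x t * cexp (- h * t%:C)).
  by apply: prim_ext (primM px (prim_cexp 0 T (- h))) => t _; rewrite /h; ring.
pose k t := q t / 2 * cexp ('i%C * l * t%:C).
have ki : cin 0 T k by exact: cinM.
pose Phi t := Cintegral 0 (clamp T t) k.
have pPhi : prim 0 T k Phi := prim_indefinite T0 ki.
have [_ cPhi HPhi] := pPhi.
have N01 : nc (x 0) ^+ 2 + nc (y 0) ^+ 2 = 1.
  by rewrite x0 y0 nc1 nc0 expr1n expr0n /= addr0.
have yb t : 0 <= t -> t <= T -> nc (y t) <= expR (`|v| * t / 2).
  move=> t0 tT; have [_] := rowsol_bound xy (lexx 0) t0 tT N01.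
  by rewrite subr0.
have vv : v <= `|v| by rewrite ler_norm.
have vv' : - v <= `|v| by rewrite -normrN ler_norm.
have ylt b : 0 <= b -> b <= T ->
    nc (y b * cexp (h * b%:C)) <= C * e1 * expR ((`|v| - v) * b / 2).
  move=> b0 bT; set W := expR ((`|v| - v) * b / 2).
  have W0 : 0 <= W by rewrite expR_ge0.
  (* kap is small by Riemann-Lebesgue, and adding kap x e^(-ht) to y e^(ht) removes
     the term with x, which is not small, from the derivative. *)
  pose kap t := Phi b - Phi t.
  have pkap : prim 0 b (fun t => 0 - k t) kap.
    by apply: primB; [exact: prim_cst|exact: (prim_sub (lexx 0) bT pPhi)].
  have pX' := prim_sub (lexx 0) bT pX; have pY' := prim_sub (lexx 0) bT pY.
  have pS := primD (primM pkap pX') pY'.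
  have pS' : prim 0 b
      (fun t => - ((q t)^*%C / 2 * (kap t * (y t * cexp (- h * t%:C)))))
      (fun t => kap t * (x t * cexp (- h * t%:C)) + y t * cexp (h * t%:C)).
    apply: prim_ext pS => t _; rewrite (h2 t) /k; ring.
  have := prim_FTC b0 pS'.
  rewrite {2}/kap subrr mul0r add0r x0 y0 mul0r addr0 mulr0 cexp0 mul1r mulr1.
  move=> /eqP; rewrite eq_sym subr_eq => /eqP ->.
  have kapE t : 0 <= t -> t <= b -> kap t = Cintegral t b k.
    by move=> t0 tb; rewrite -HPhi.
  have kapb t : 0 <= t -> t <= b ->
      nc (kap t) <= e1 * (expR (- (v * t)) + expR (- (v * b))).
    by move=> t0 tb; rewrite kapE// HL.
  (* After expansion both exponents are nondecreasing in [t], and at [t = b] each equals the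
     exponent of [W]. *)
  have Wt t : 0 <= t -> t <= b ->
      (expR (- (v * t)) + expR (- (v * b))) * expR ((`|v| + v) * t / 2) <= 2 * W.
    move=> t0 tb; rewrite mulrDl -!expRD mulr_natl mulr2n.
    have p1 : 0 <= (`|v| - v) * (b - t) by rewrite mulr_ge0//; lra.
    have p2 : 0 <= (`|v| + v) * (b - t) by rewrite mulr_ge0//; lra.
    apply: lerD; rewrite /W ler_expR -subr_ge0.
      rewrite (_ : _ - _ = (`|v| - v) * (b - t) / 2); first lra.
      by field.
    rewrite (_ : _ - _ = (`|v| + v) * (b - t) / 2); first lra.
    by field.
  have ck : ccont (fun t => kap t * (y t * cexp (- h * t%:C))).
    by have [_ ck _] := pkap; apply: ccontM => //; exact: ccontM.
  have qJb : cin 0 b (fun t => (q t)^*%C / 2) by exact: cin_sub qJ2i.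
  have B1 : nc (Cintegral 0 b (fun t => - ((q t)^*%C / 2 *
      (kap t * (y t * cexp (- h * t%:C)))))) <= 4 * e1 * W * QJ.
    rewrite CIN; last exact: cinM.
    rewrite ncN; apply: (@le_trans _ _ (2 * (2 * e1 * W) * L1norm 0 b (fun t => (q t)^*%C / 2))).
      apply: nc_CIM_le => // t /andP[t0 tb].
      rewrite !ncM nc_cexp mulNr ReN hre opprK.
      have H1 := kapb t t0 tb; have H2 := yb t t0 (le_trans tb bT).
      apply: (@le_trans _ _ (e1 * (expR (- (v * t)) + expR (- (v * b))) *
        (expR (`|v| * t / 2) * expR (v * t / 2)))).
        apply: ler_pM => //; first exact: nc_ge0.
          by rewrite mulr_ge0 ?nc_ge0// expR_ge0.
        by rewrite ler_wpM2r// expR_ge0.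
      rewrite -mulrA -expRD (_ : 2 * e1 * W = e1 * (2 * W)); last by ring.
      rewrite (_ : `|v| * t / 2 + v * t / 2 = (`|v| + v) * t / 2); last by ring.
      by rewrite ler_wpM2l ?Wt// ltW.
    have -> : 2 * (2 * e1 * W) = 4 * e1 * W by ring.
    rewrite ler_wpM2l//; last exact: L1_sub bT qJ2i.
    by rewrite mulr_ge0// mulr_ge0// ltW.
  have B2 : nc (kap 0) <= 2 * e1 * W.
    rewrite (le_trans (kapb 0 (lexx 0) b0))// -mulrA mulrCA ler_wpM2l//; first lra.
    have := Wt 0 (lexx 0) b0.
    by rewrite [in X in X <= _](_ : (`|v| + v) * 0 / 2 = 0) ?expR0 ?mulr1//; ring.
  rewrite (le_trans (ncD _ _))//.
  rewrite CE; have -> : (2 + 4 * QJ) * e1 * W = 4 * e1 * W * QJ + 2 * e1 * W by ring.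
  exact: lerD.
have H : x T * cexp (- h * T%:C) - 1 =
    Cintegral 0 T (fun t => - ((q t)^*%C / 2 * (y t * cexp (- h * t%:C)))).
  by rewrite (prim_FTC T0 pX) x0 mulr0 cexp0 mulr1.
have cyc : ccont (fun t => y t * cexp (- h * t%:C)) by exact: ccontM.
pose W := expR ((`|v| + v) * T / 2).
have BX : nc (x T * cexp (- h * T%:C) - 1) <= 2 * (C * e1 * W) * QJ.
  rewrite H CIN; last exact: cinM.
  rewrite ncN; apply: nc_CIM_le => // t /andP[t0 tT].
  have := ylt t t0 tT; rewrite !ncM !nc_cexp mulNr ReN hre opprK => B.
  have -> : expR (v * t / 2) = expR (- (v * t / 2)) * expR (v * t).
    by rewrite -expRD; congr expR; field.
  rewrite mulrA.
  apply: (@le_trans _ _ (C * e1 * expR ((`|v| - v) * t / 2) * expR (v * t))).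
    by rewrite ler_wpM2r// expR_ge0.
  rewrite -mulrA -expRD ler_wpM2l//; first by rewrite mulr_ge0// ltW.
  rewrite ler_expR.
  have -> : (`|v| - v) * t / 2 + v * t = (`|v| + v) / 2 * t by field.
  have -> : (`|v| + v) * T / 2 = (`|v| + v) / 2 * T by ring.
  by rewrite ler_wpM2l//; lra.
have -> : x T - cexp ('i%C * l / 2 * T%:C) =
    (x T * cexp (- h * T%:C) - 1) * cexp (h * T%:C).
  by rewrite mulrBl mul1r -[in RHS]mulrA -cexpD mulNr addNr cexp0 mulr1.
rewrite ncM nc_cexp hre.
apply: (@le_trans _ _ (2 * (C * e1 * W) * QJ * expR (- (v * T / 2)))).
  by rewrite ler_wpM2r// expR_ge0.
have -> : 2 * (C * e1 * W) * QJ * expR (- (v * T / 2)) =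
    (2 * C * e1 * QJ) * (W * expR (- (v * T / 2))) by ring.
have -> : W * expR (- (v * T / 2)) = expR (`|v| * T / 2).
  by rewrite /W -expRD; congr expR; field.
rewrite -/v ler_wpM2r ?expR_ge0//.
by rewrite e1E ler_wpM2l//; [rewrite mulr_ge0// ?mulr_ge0// ltW|lra].
Qed.

End Asymptotics.

(** * Lower bound for [Delta^2 - 4] on large squares *)

Section TraceBound.
Context {R : realType}.
Implicit Types (q x y : R -> R[i]) (e s t T L r : R) (l z : R[i]).

Lemma mxtrace2 (M : 'M[R[i]]_2) : \tr M = M 0 0 + M 1 1.
Proof.
by rewrite /mxtrace big_ord_recl big_ord1 (_ : lift ord0 ord0 = 1)//; apply: val_inj.
Qed.

Lemma frame0 T q l (F : R -> 'M[R[i]]_2) i j : 0 <= T -> frame_solution T q l F ->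
  F 0 i j = (i == j)%:R.
Proof.
move=> T0 /(_ i j)[_ _ /(_ 0)]; rewrite lexx T0 => /(_ isT) ->.
by rewrite CI_pt addr0 mxE.
Qed.

(** By [rowsol_swap] the entry [F T 1 1] is the first diagonal entry for the potential [- q^*] at
    [- l], so [rowsol_asymptotics] covers both. *)
Lemma trace_asymptotics T q e : 0 <= T -> cin 0 T q -> 0 < e ->
  exists2 L : R, 0 < L & forall l F, L <= nc l -> frame_solution T q l F ->
  nc (\tr (F T) - (cexp ('i%C * l / 2 * T%:C) + cexp (- ('i%C * l / 2 * T%:C)))) <=
  e * expR (`|complex.Im l| * T / 2).
Proof.
move=> T0 qi e0; have e20 : 0 < e / 2 by lra.
have q'i : cin 0 T (fun t => - (q t)^*%C) by apply: cinN; exact: cinJ.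
have [L1 L10 H1] := rowsol_asymptotics T0 qi e20.
have [L2 L20 H2] := rowsol_asymptotics T0 q'i e20.
exists (Num.max L1 L2) => [|l F]; first by rewrite lt_max L10.
rewrite ge_max => /andP[l1 l2] HF.
have TT : clamp T T = T by rewrite clamp_id// T0 lexx.
have c0 : clamp T 0 = 0 by rewrite clamp_id// T0 lexx.
have r1 := frame_rowsol 0 T0 qi HF; have r2 := rowsol_swap (frame_rowsol 1 T0 qi HF).
have := H1 _ _ _ l1 r1; rewrite c0 !(frame0 _ _ T0 HF) TT /= => /(_ erefl erefl) B1.
rewrite -(ncN l) in l2.
have := H2 _ _ _ l2 r2; rewrite c0 !(frame0 _ _ T0 HF) TT /= => /(_ erefl erefl).
rewrite ImN normrN mulrN mulNr mulNr => B2.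
rewrite mxtrace2.
set z := cexp _ in B1 *; set z' := cexp _ in B2 *.
have -> : F T 0 0 + F T 1 1 - (z + z') = (F T 0 0 - z) + (F T 1 1 - z') by ring.
by rewrite (le_trans (ncD _ _))// [e]splitr mulrDl lerD.
Qed.

Lemma nc_cexp_sub2 z : nc ((cexp z - cexp (- z)) ^+ 2) =
  expR (2 * complex.Re z) + expR (- (2 * complex.Re z)) - 2 * cos (2 * complex.Im z).
Proof.
rewrite ncX nc_sqr /cexp !ReImE /= cosN sinN.
set E := expR _; set E' := expR _; set c := cos _; set s := sin _.
have cs : c ^+ 2 + s ^+ 2 = 1 by rewrite cos2Dsin2.
have EE : E * E' = 1 by rewrite -expRD subrr expR0.
have -> : expR (2 * complex.Re z) = E ^+ 2 by rewrite mulr_natl mulr2n expRD -expr2.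
have -> : expR (- (2 * complex.Re z)) = E' ^+ 2.
  by rewrite mulr_natl mulr2n opprD expRD -expr2.
have -> : cos (2 * complex.Im z) = c ^+ 2 - s ^+ 2.
  by rewrite mulr_natl mulr2n cosD -!expr2.
rewrite (_ : _ + _ = (E ^+ 2 + E' ^+ 2) * (c ^+ 2 + s ^+ 2) -
  2 * (E * E') * (c ^+ 2 - s ^+ 2)); last by ring.
by rewrite cs EE mulr1 mulr1.
Qed.

Lemma cos_odd_pi n : cos ((2 * n%:R + 1) * pi) = -1 :> R.
Proof.
elim: n => [|n IH]; first by rewrite mulr0 add0r mul1r cospi.
rewrite -natr1 (_ : _ * pi = (2 * n%:R + 1) * pi + pi *+ 2); last by ring.
by rewrite cosD2pi.
Qed.

(** The leading term of [Delta^2 - 4] is [(e^z - e^(-z))^2] with [z = i l T / 2], whose norm is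
    given by [nc_cexp_sub2]. On the horizontal sides [|Re z|] is large and the exponentials win; on
    the vertical sides [2 Im z] is an odd multiple of [pi], so that the cosine helps. *)
Lemma trace_lower_bound T q : 0 < T -> cin 0 T q ->
  exists2 L : R, 0 < L & forall n l F, L <= (2 * n%:R + 1) * pi / T ->
  onedge (- ((2 * n%:R + 1) * pi / T)) ((2 * n%:R + 1) * pi / T)
    (- ((2 * n%:R + 1) * pi / T)) ((2 * n%:R + 1) * pi / T) l ->
  frame_solution T q l F ->
  expR (`|complex.Im l| * T) / 4 <= nc ((\tr (F T)) ^+ 2 - 4).
Proof.
(* The leading term is at least [W^2 / 2]. An error of [W / 20] in the trace costs
   [W^2 / 5 + W^2 / 400], which leaves more than [W^2 / 4]. *)
move=> T0 qi; have e0 : 0 < 1 / 20 :> R by lra.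
have [L L0 HL] := trace_asymptotics (ltW T0) qi e0.
(* On the horizontal sides [4 / T] gives [4 <= v], hence [e^v >= 5] and [e^v - 2 >= e^v / 2]. *)
exists (Num.max L (4 / T)) => [|n l F]; first by rewrite lt_max L0.
set r := (2 * n%:R + 1) * pi / T; rewrite ge_max => /andP[Lr r4] lsq HF.
have {HL} := HL l F (le_trans Lr (onsq_nc lsq)) HF.
set z : R[i] := 'i%C * l / 2 * T%:C; set d : R[i] := _ - _ => Hd.
have zE : z = 'i%C * l * (T / 2)%:C.
  by rewrite /z rmorphM fmorphV rmorph_nat; ring.
have zre : complex.Re z = - (complex.Im l * (T / 2)) by rewrite zE Re_il.
have zim : complex.Im z = complex.Re l * (T / 2).
  by rewrite zE !ReImE /=; ring.
set v : R := `|complex.Im l| * T; set W := expR (v / 2).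
have W0 : 0 < W by rewrite expR_gt0.
have WW : expR v = W ^+ 2 by rewrite expr2 -expRD -splitr.
have W1 : 1 <= W.
  by rewrite -expR0 ler_expR divr_ge0// mulr_ge0// ltW.
have nre : `|2 * complex.Re z| = v.
  by rewrite zre normrM normrN normrM (ger0_norm (_ : 0 <= T / 2))// /v; [rewrite ger0_norm//; field|lra].
have ncz : nc (cexp z) <= W.
  rewrite nc_cexp ler_expR; have := ler_norm (2 * complex.Re z); rewrite nre; lra.
have ncz' : nc (cexp (- z)) <= W.
  rewrite nc_cexp ReN ler_expR; have := ler_norm (- (2 * complex.Re z)).
  rewrite normrN nre; lra.
have Eb : expR v <= expR (2 * complex.Re z) + expR (- (2 * complex.Re z)).
  rewrite -nre; have [h|h] := leP 0 (2 * complex.Re z).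
    by rewrite ger0_norm// lerDl expR_ge0.
  by rewrite ltr0_norm// lerDr expR_ge0.
have lower : expR v / 2 <= nc ((cexp z - cexp (- z)) ^+ 2).
  rewrite nc_cexp_sub2; case: lsq => -[_].
    move=> Hi; have vr : v = r * T.
      rewrite /v; congr (_ * _); have r0 : 0 < r := lt_le_trans L0 Lr.
      by case: Hi => ->; rewrite ?normrN ger0_norm// ltW.
    have v4 : 4 <= v by rewrite vr -ler_pdivrMr.
    have := expR_ge1Dx v; have := cos_le1 (2 * complex.Im z); lra.
  move=> Hr; have -> : cos (2 * complex.Im z) = -1.
    have rT : 2 * (r * (T / 2)) = (2 * n%:R + 1) * pi by rewrite /r; field; lra.
    rewrite zim; case: Hr => ->; last by rewrite rT cos_odd_pi.
    by rewrite mulNr mulrN cosN rT cos_odd_pi.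
  have := expR_ge0 v; lra.
have trE : \tr (F T) = (cexp z + cexp (- z)) + d by rewrite /d; ring.
have D : (\tr (F T)) ^+ 2 - 4 = (cexp z - cexp (- z)) ^+ 2 +
    ((cexp z + cexp (- z)) * d + (cexp z + cexp (- z)) * d + d ^+ 2).
  have -> : (4 : R[i]) = 4 * (cexp z * cexp (- z)) by rewrite cexpN mulr1.
  by rewrite trE; ring.
rewrite D -/v; apply: le_trans (nc_lb _ _).
set A := (_ + _) * d; have HA : nc A <= 2 * W * (1 / 20 * W).
  rewrite ncM ler_pM ?nc_ge0//.
  by rewrite (le_trans (ncD _ _))//; lra.
have Hd2 : nc (d ^+ 2) <= (1 / 20 * W) ^+ 2.
  by rewrite ncX ler_pXn2r// ?nnegrE ?nc_ge0//; lra.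
have := ncD (A + A) (d ^+ 2); have := ncD A A.
rewrite WW in lower *; nra.
Qed.

End TraceBound.

(** * The frame as a function of the spectral parameter *)

Section ZeroRemoval.
Context {R : realType}.
Implicit Types (f g u : R[i] -> R[i]) (z : R[i]).

(** Dividing [g] by [l - z] drops the pair [(z, 0)] and lowers the index of the other pairs at [z]
    by one ([phi]), so the list that bounds the zeros becomes shorter. *)
Lemma zeros_removal_seq (s : seq (R[i] * nat)) g : entire g ->
  (forall zk : R[i] * nat, entire_dvd (fun l => (l - zk.1) ^+ zk.2.+1) g -> zk \in s) ->
  exists (p : {poly R[i]}) (u : R[i] -> R[i]),
    [/\ entire u, forall z, u z != 0 & forall z, g z = p.[z] * u z].
Proof.
have [n] := ubnP (size s); elim: n s g => // n IH s g ns eg Hs.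
have [g0|] := pselect (forall z, g z != 0).
  by exists 1, g; split=> // z; rewrite hornerE mul1r.
move=> /existsNP[z /negP/negPn/eqP gz]; have [g1 eg1 Hg1] := entire_div z eg.
have gE w : g w = (w - z) * g1 w by rewrite Hg1 gz add0r.
have zs : (z, 0%N) \in s by apply: Hs; exists g1 => // w; rewrite expr1 gE.
pose phi (x : R[i] * nat) := (x.1, if x.1 == z then x.2.-1 else x.2).
have [|||p [u [eu u0 Hu]]] := IH (map phi (seq.filter (predC1 (z, 0%N)) s)) g1 => //.
- rewrite size_map -ltnS; apply: leq_trans ns.
  rewrite ltnS size_filter ltn_neqAle count_size andbT -all_count.
  by apply/negP => /allP/(_ _ zs); rewrite /= eqxx.
- move=> [z' k] /= [h eh Hh]; apply/mapP.
  exists (z', if z' == z then k.+1 else k); last first.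
    by rewrite /phi /=; case: (z' == z).
  rewrite mem_filter /= xpair_eqE; apply/andP; split.
    by case: eqP.
  apply: Hs; have [E|z'z] := eqVneq z' z.
    by exists h => // w /=; rewrite gE Hh -E [in RHS]exprS mulrA.
  exists (fun w => (w - z) * h w).
    exact: (entireM (entireB (@entire_id R) (@entire_cst R z)) eh).
  by move=> w /=; rewrite gE Hh; ring.
exists (p * ('X - z%:P)), u; split=> // w.
by rewrite gE Hu hornerM hornerXsubC; ring.
Qed.

Lemma zeros_removal g : entire g -> finitely_many_zeros g ->
  exists (p : {poly R[i]}) (u : R[i] -> R[i]),
    [/\ entire u, forall z, u z != 0 & forall z, g z = p.[z] * u z].
Proof.
move=> eg /finite_seqP[s Hs]; apply: (@zeros_removal_seq s) => // zk H.
by have : [set` s] zk by rewrite -Hs.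
Qed.

End ZeroRemoval.

Section Frames.
Context {R : realType}.
Variables (T : R) (q : R -> R[i]) (F : R -> R[i] -> 'M[R[i]]_2).
Hypotheses (T0 : 0 < T) (qi : cin 0 T q)
  (HF : forall l, frame_solution T q l (fun t => F t l)).
Implicit Types (s t : R) (l w : R[i]) (i j : 'I_2).

Let X i l t := F (clamp T t) l i 0.
Let Y i l t := F (clamp T t) l i 1.

Lemma frame_rows i l : rowsol 0 T q l (X i l) (Y i l).
Proof. exact: (frame_rowsol i (ltW T0) qi (HF l)). Qed.

Lemma frame_init i l : X i l 0 = (i == 0)%:R /\ Y i l 0 = (i == 1)%:R.
Proof.
by rewrite /X /Y clamp_id ?lexx ?(ltW T0)// !(frame0 _ _ (ltW T0) (HF l)).
Qed.

Lemma frame_init_norm i l : nc (X i l 0) ^+ 2 + nc (Y i l 0) ^+ 2 = 1.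
Proof.
have [-> ->] := frame_init i l; rewrite !nc_nat.
by case: i => -[|[|//]] ? /=; rewrite expr1n expr0n /= ?addr0 ?add0r.
Qed.

Lemma frame_bound i l t : 0 <= t -> t <= T ->
  nc (X i l t) <= expR (`|complex.Im l| * t / 2) /\ nc (Y i l t) <= expR (`|complex.Im l| * t / 2).
Proof.
move=> t0 tT.
have := rowsol_bound (frame_rows i l) (lexx 0) t0 tT (frame_init_norm i l).
by rewrite subr0.
Qed.

Lemma frame_det l t : 0 <= t -> t <= T ->
  X 0 l t * Y 1 l t - Y 0 l t * X 1 l t = 1.
Proof.
move=> t0 tT; have [_ _ /(_ 0 t (lexx 0) t0 tT)] :=
  wronskian (frame_rows 0 l) (frame_rows 1 l).
have [-> ->] := frame_init 0 l; have [-> ->] := frame_init 1 l.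
rewrite /= !mulr0 mulr1 subr0 (_ : Cintegral _ _ _ = 0).
  by move=> /eqP; rewrite subr_eq0 => /eqP.
rewrite (@CI_ext _ _ _ _ (fun=> 0)); first by rewrite CI_cst// mul0r.
by move=> s _; rewrite subrr mulr0 !mul0r.
Qed.

(* Variation of constants: the Wronskians of row i at w with the two rows at l are
   its coordinates in the basis formed by these rows. *)
Lemma frame_variation i l w t : 0 <= t -> t <= T ->
  let J j := Cintegral 0 t (fun s => X i w s * Y j l s + Y i w s * X j l s) in
  X i w t - X i l t = 'i%C * (w - l) / 2 * (J 1 * X 0 l t - J 0 * X 1 l t) /\ Y i w t - Y i l t = 'i%C * (w - l) / 2 * (J 1 * Y 0 l t - J 0 * Y 1 l t).
Proof.
move=> t0 tT J.
have ci v k u : ccont (X k v) /\ ccont (Y k u).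
  by have [[_ ? _] _] := frame_rows k v; have [_ [_ ? _]] := frame_rows k u.
have WJ j : X i w t * Y j l t - Y i w t * X j l t =
    X i l t * Y j l t - Y i l t * X j l t + 'i%C * (w - l) / 2 * J j.
  have [_ _ /(_ 0 t (lexx 0) t0 tT) H1] := wronskian (frame_rows i w) (frame_rows j l).
  have [_ _ /(_ 0 t (lexx 0) t0 tT) H2] := wronskian (frame_rows i l) (frame_rows j l).
  have E : 'i%C * (w - l) / 2 * J j =
      Cintegral 0 t (fun s => 'i%C * (w - l) / 2 * (X i w s * Y j l s + Y i w s * X j l s)).
    rewrite CIZ//; apply: cin_cont.
    have [c1 c2] := ci w i w; have [c3 c4] := ci l j l.
    by apply: ccontD; exact: ccontM.
  have Z : Cintegral 0 t (fun s => 'i%C * (l - l) / 2 *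
      (X i l s * Y j l s + Y i l s * X j l s)) = 0.
    rewrite (@CI_ext _ _ _ _ (fun=> 0)); first by rewrite CI_cst// mul0r.
    by move=> s _; rewrite subrr mulr0 !mul0r.
  rewrite Z in H2; rewrite E -H1.
  have [e1 e2] := frame_init i w; have [e3 e4] := frame_init i l.
  rewrite e1 e2; rewrite e3 e4 in H2; move/eqP: H2; rewrite subr_eq0 => /eqP ->.
  by ring.
have D := frame_det l t0 tT; have W1 := WJ 1; have W0 := WJ 0.
split.
  have -> : X i w t = (X i w t * Y 1 l t - Y i w t * X 1 l t) * X 0 l t -
      (X i w t * Y 0 l t - Y i w t * X 0 l t) * X 1 l t.
    rewrite -[LHS]mulr1 -D; ring.
  rewrite W1 W0 -[in X in _ - X = _](mulr1 (X i l t)) -D; ring.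
have -> : Y i w t = (X i w t * Y 1 l t - Y i w t * X 1 l t) * Y 0 l t -
    (X i w t * Y 0 l t - Y i w t * X 0 l t) * Y 1 l t.
  rewrite -[LHS]mulr1 -D; ring.
rewrite W1 W0 -[in X in _ - X = _](mulr1 (Y i l t)) -D; ring.
Qed.

(** [frame_variation] is used twice. With [J] bounded it makes the frame Lipschitz in the spectral
    parameter ([Kb]); then [J] is Lipschitz too ([Jd]), so the remainder of the first-order
    expansion is quadratic. *)
Lemma frame_entire_clamp i t : 0 <= t -> t <= T ->
  entire (fun l => X i l t) /\ entire (fun l => Y i l t).
Proof.
move=> t0 tT; suff H l : exists D D', cdiff (fun l => X i l t) l D /\ cdiff (fun l => Y i l t) l D'.
  by split; apply/entireP => l; have [D [D' [H1 H2]]] := H l; [exists D|exists D'].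
(* Bounds the frame on [[0, T]] uniformly for all parameters within distance 1 of [l]. *)
pose B := expR ((`|complex.Im l| + 1) * T / 2).
have B0 : 0 < B by exact: expR_gt0.
have bnd w k s : nc (w - l) < 1 -> 0 <= s -> s <= T ->
    nc (X k w s) <= B /\ nc (Y k w s) <= B.
  move=> wl s0 sT; have [h1 h2] := frame_bound k w s0 sT.
  have : expR (`|complex.Im w| * s / 2) <= B.
    rewrite ler_expR ler_pM2r ?invr_gt0// ler_pM//.
    by have := nc_Im (w - l); have := lerB_dist (complex.Im w) (complex.Im l);
      rewrite !ReImE; lra.
  by move=> h; split; [exact: le_trans h1 h|exact: le_trans h2 h].
have l1 : nc (l - l) < 1 by rewrite subrr nc0.
pose J s w j := Cintegral 0 s (fun s => X i w s * Y j l s + Y i w s * X j l s).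
have ci v k : ccont (X k v) /\ ccont (Y k v).
  by have [[_ ? _] [_ ? _]] := frame_rows k v.
have cJ w j : ccont (fun s => X i w s * Y j l s + Y i w s * X j l s).
  have [c1 c2] := ci w i; have [c3 c4] := ci l j.
  by apply: ccontD; exact: ccontM.
have Jb s w j : nc (w - l) < 1 -> 0 <= s -> s <= T -> nc (J s w j) <= 4 * B ^+ 2 * T.
  move=> wl s0 sT; apply: (@le_trans _ _ (2 * (2 * B ^+ 2) * (s - 0))).
    apply: nc_CI_le => //; first exact: cin_cont.
    move=> u /andP[u0 us]; have uT := le_trans us sT.
    have [h1 h2] := bnd w i u wl u0 uT; have [h3 h4] := bnd l j u l1 u0 uT.
    have P1 : nc (X i w u * Y j l u) <= B * B by rewrite ncM ler_pM ?nc_ge0.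
    have P2 : nc (Y i w u * X j l u) <= B * B by rewrite ncM ler_pM ?nc_ge0.
    by rewrite (le_trans (ncD _ _))// expr2; lra.
  have B2 : 0 <= B ^+ 2 by rewrite sqr_ge0.
  by nra.
pose K := 4 * B ^+ 3 * T.
have B3 : 0 <= B ^+ 3 by rewrite exprn_ge0// ltW.
have half a : nc ('i%C * a / 2 : R[i]) = nc a / 2.
  by rewrite !ncM ncV nc_nat nc_i mul1r.
have Kb w s : nc (w - l) < 1 -> 0 <= s -> s <= T ->
    nc (X i w s - X i l s) <= K * nc (w - l) /\ nc (Y i w s - Y i l s) <= K * nc (w - l).
  move=> wl s0 sT; have [-> ->] := frame_variation i l w s0 sT.
  rewrite -!/(J s w _) !(ncM (_ / 2)) half.
  have [h1 h2] := bnd l 0 s l1 s0 sT; have [h3 h4] := bnd l 1 s l1 s0 sT.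
  have J1 := Jb s w 1 wl s0 sT; have J0 := Jb s w 0 wl s0 sT.
  have KE : K = 4 * B ^+ 2 * T * B by rewrite /K exprSr; ring.
  have est a b : nc a <= B -> nc b <= B ->
      nc (w - l) / 2 * nc (J s w 1 * a - J s w 0 * b) <= K * nc (w - l).
    move=> ha hb; have -> : K * nc (w - l) = nc (w - l) / 2 * (K + K) by field.
    rewrite ler_wpM2l//; first by rewrite divr_ge0// nc_ge0.
    rewrite (le_trans (ncB _ _))// !ncM KE.
    by apply: lerD; rewrite ler_pM ?nc_ge0.
  by split; exact: est.
pose K2 := 4 * K * B ^+ 2 * T.
have Jd w j : nc (w - l) < 1 -> nc (J t w j - J t l j) <= 4 * K * B * T * nc (w - l).
  move=> wl; rewrite /J -CIB; [|exact: cin_cont..].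
  apply: (@le_trans _ _ (2 * (2 * (K * nc (w - l) * B)) * (t - 0))).
    apply: nc_CI_le => //; first by apply: cin_cont; exact: ccontB.
    move=> u /andP[u0 ut]; have uT := le_trans ut tT.
    have [h1 h2] := Kb w u wl u0 uT; have [h3 h4] := bnd l j u l1 u0 uT.
    have -> : X i w u * Y j l u + Y i w u * X j l u -
      (X i l u * Y j l u + Y i l u * X j l u) =
      (X i w u - X i l u) * Y j l u + (Y i w u - Y i l u) * X j l u by ring.
    rewrite (le_trans (ncD _ _))// !ncM mulr_natl mulr2n.
    by apply: lerD; rewrite ler_pM ?nc_ge0.
  have -> : 4 * K * B * T * nc (w - l) = 2 * (2 * (K * nc (w - l) * B)) * T by ring.
  rewrite subr0 ler_wpM2l// !mulr_ge0 ?nc_ge0 ?(ltW B0)//.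
  exact: ltW.
have main (V : 'I_2 -> R[i] -> R -> R[i]) : (forall k, nc (V k l t) <= B) ->
    (forall w, V i w t - V i l t =
      'i%C * (w - l) / 2 * (J t w 1 * V 0 l t - J t w 0 * V 1 l t)) ->
    cdiff (fun l => V i l t) l ('i%C / 2 * (J t l 1 * V 0 l t - J t l 0 * V 1 l t)).
  move=> Vb VE; apply: (@cdiff_quad _ _ _ _ K2 1) => // w wl.
  have -> : V i w t - V i l t - 'i%C / 2 * (J t l 1 * V 0 l t - J t l 0 * V 1 l t) * (w - l)
    = 'i%C * (w - l) / 2 * ((J t w 1 - J t l 1) * V 0 l t - (J t w 0 - J t l 0) * V 1 l t).
    by rewrite VE; ring.
  rewrite (ncM (_ / 2)) half.
  have -> : K2 * nc (w - l) ^+ 2 = nc (w - l) / 2 *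
    (4 * K * B * T * nc (w - l) * B + 4 * K * B * T * nc (w - l) * B).
    by rewrite /K2; field.
  rewrite ler_wpM2l//; first by rewrite divr_ge0// nc_ge0.
  rewrite (le_trans (ncB _ _))// !ncM.
  by apply: lerD; rewrite ler_pM ?nc_ge0// Jd.
exists ('i%C / 2 * (J t l 1 * X 0 l t - J t l 0 * X 1 l t)).
exists ('i%C / 2 * (J t l 1 * Y 0 l t - J t l 0 * Y 1 l t)).
split; apply: main => [k|w].
- by have [] := bnd l k t l1 t0 tT.
- by have [] := frame_variation i l w t0 tT.
- by have [] := bnd l k t l1 t0 tT.
- by have [] := frame_variation i l w t0 tT.
Qed.

End Frames.

(** * The polynomial Killing field *)

Section KillingField.
Context {R : realType}.
Implicit Types (na nb nd k l z : R[i]) (a b r s t : R).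

Lemma horner_inj (p1 p2 : {poly R[i]}) : (forall l, p1.[l] = p2.[l]) -> p1 = p2.
Proof.
move=> H; apply/eqP; rewrite -subr_eq0; apply/negPn/negP => p0.
have := @max_poly_roots R[i] _ [seq (j%:R : R[i]) | j <- iota 0 (size (p1 - p2))] p0.
rewrite size_map size_iota ltnn => F0; suff : false by [].
apply: F0; first by apply/allP => x _; rewrite rootE hornerD hornerN H subrr.
by rewrite map_inj_uniq ?iota_uniq// => i j /eqP; rewrite eqr_nat => /eqP.
Qed.

(** The condition [nc z <= 2 * r] is what holds on the boundary of the square of half side [r]. *)
Lemma poly_growth (P : {poly R[i]}) : exists C n, 0 <= C /\
  forall r z, 1 <= r -> nc z <= 2 * r -> nc P.[z] <= C * r ^+ n.
Proof.
elim/poly_ind: P => [|P c [C [n [C0 H]]]].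
  by exists 0, 0%N; split=> // r z _ _; rewrite horner0 nc0 mul0r.
exists (C * 2 + nc c), n.+1; split; first by have := nc_ge0 c; lra.
move=> r z r1 zr; rewrite hornerMXaddC (le_trans (ncD _ _))// ncM mulrDl.
apply: lerD; last by rewrite ler_peMr ?nc_ge0// exprn_ege1.
have := H r z r1 zr => {}H.
rewrite exprS (_ : C * 2 * (r * r ^+ n) = C * r ^+ n * (2 * r)); last by ring.
by rewrite ler_pM ?nc_ge0.
Qed.

Lemma onsq_nc_le r z : onedge (- r) r (- r) r z -> nc z <= 2 * r.
Proof.
move=> zr; rewrite (le_trans (nc_le _))//.
have -> : 2 * r = r + r by ring.
by apply: lerD; rewrite ler_norml; case: zr => -[] ? []; lra.
Qed.

(* Entries of F^-1 N F, where F has rows (x1, y1), (x2, y2) and determinant 1 and N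
   has rows (na, nb), (nd, - na). *)
Definition conj11 (x1 y1 x2 y2 na nb nd : R[i]) : R[i] :=
  y2 * (na * x1 + nb * x2) - y1 * (nd * x1 - na * x2).
Definition conj12 (x1 y1 x2 y2 na nb nd : R[i]) : R[i] :=
  y2 * (na * y1 + nb * y2) - y1 * (nd * y1 - na * y2).
Definition conj21 (x1 y1 x2 y2 na nb nd : R[i]) : R[i] :=
  x1 * (nd * x1 - na * x2) - x2 * (na * x1 + nb * x2).

Lemma entire_conj (x1 y1 x2 y2 na nb nd : R[i] -> R[i]) :
  entire x1 -> entire y1 -> entire x2 -> entire y2 ->
  entire na -> entire nb -> entire nd ->
  let c e l := e (x1 l) (y1 l) (x2 l) (y2 l) (na l) (nb l) (nd l) : R[i] in
  [/\ entire (c conj11), entire (c conj12) & entire (c conj21)].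
Proof.
move=> ex1 ey1 ex2 ey2 ena enb ed c; rewrite /c /conj11 /conj12 /conj21.
have eU := entireD (entireM ena ex1) (entireM enb ex2).
have eV := entireB (entireM ed ex1) (entireM ena ex2).
have eU' := entireD (entireM ena ey1) (entireM enb ey2).
have eV' := entireB (entireM ed ey1) (entireM ena ey2).
split.
- exact: (entireB (entireM ey2 eU) (entireM ey1 eV)).
- exact: (entireB (entireM ey2 eU') (entireM ey1 eV')).
- exact: (entireB (entireM ex1 eV) (entireM ex2 eU)).
Qed.

(** The first four arguments of [c] are the entries of [F^-1], so [c] undoes the conjugation. *)
Lemma conj_conj_inv (x1 y1 x2 y2 na nb nd : R[i]) : x1 * y2 - y1 * x2 = 1 ->
  let n e := e x1 y1 x2 y2 na nb nd in
  let c e := e y2 (- y1) (- x2) x1 (n conj11) (n conj12) (n conj21) : R[i] in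
  [/\ c conj11 = na, c conj12 = nb & c conj21 = nd].
Proof.
move=> D n c.
have DD : (x1 * y2 - y1 * x2) ^+ 2 = 1 by rewrite D expr1n.
by split; rewrite -[RHS]mulr1 -DD /c /n /conj11 /conj12 /conj21; ring.
Qed.

Lemma conjZ (k x1 y1 x2 y2 na nb nd : R[i]) :
  let c e := e x1 y1 x2 y2 (k * na) (k * nb) (k * nd) : R[i] in
  let d e := k * e x1 y1 x2 y2 na nb nd : R[i] in
  [/\ c conj11 = d conj11, c conj12 = d conj12 & c conj21 = d conj21].
Proof. by rewrite /conj11 /conj12 /conj21; split; ring. Qed.

(** The Lax equation for [F^-1 N F], entry by entry. The proof differentiates the rows of [N F],
    which are constant combinations of the rows of [F], and then applies the product rule. *)
Lemma conj_ode a b (q x1 y1 x2 y2 : R -> R[i]) l na nb nd :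
  rowsol a b q l x1 y1 -> rowsol a b q l x2 y2 ->
  let A t := conj11 (x1 t) (y1 t) (x2 t) (y2 t) na nb nd in
  let B t := conj12 (x1 t) (y1 t) (x2 t) (y2 t) na nb nd in
  let C t := conj21 (x1 t) (y1 t) (x2 t) (y2 t) na nb nd in
  [/\ prim a b (fun t => - ((q t)^*%C * B t + q t * C t) / 2) A,
      prim a b (fun t => q t * A t - 'i%C * (l * B t)) B &
      prim a b (fun t => (q t)^*%C * A t + 'i%C * (l * C t)) C].
Proof.
move=> [px1 py1] [px2 py2] A B C.
have pu := primD (primZ na px1) (primZ nb px2).
have pv := primB (primZ nd px1) (primZ na px2).
have pu' := primD (primZ na py1) (primZ nb py2).
have pv' := primB (primZ nd py1) (primZ na py2).
split.
- apply: prim_ext (primB (primM py2 pu) (primM py1 pv)) => t _.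
  by rewrite /A /B /C /conj11 /conj12 /conj21; field.
- apply: prim_ext (primB (primM py2 pu') (primM py1 pv')) => t _.
  by rewrite /A /B /C /conj11 /conj12 /conj21; field.
- apply: prim_ext (primB (primM px1 pv) (primM px2 pu)) => t _.
  by rewrite /A /B /C /conj11 /conj12 /conj21; field.
Qed.

End KillingField.

(** * Growth estimates and polynomiality in the spectral parameter *)

Section PolynomialKillingField.
Context {R : realType}.
Variables (T : R) (q : R -> R[i]) (F : R -> R[i] -> 'M[R[i]]_2).
Hypotheses (T0 : 0 < T) (qi : cin 0 T q)
  (HF : forall l, frame_solution T q l (fun t => F t l)).
Implicit Types (s t r : R) (l : R[i]) (i j : 'I_2).

Let X i l t := F (clamp T t) l i 0.
Let Y i l t := F (clamp T t) l i 1.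
Let rows i l : rowsol 0 T q l (X i l) (Y i l) := frame_rows T0 qi HF i l.

(** These are the entries of [F(t)^-1 F(T)], whose rows are solutions starting from unit vectors at
    time [t]. Estimating the two factors separately would lose the cancellation of the exponent. *)
Lemma transfer_bound l t : 0 <= t -> t <= T ->
  let W := expR (`|complex.Im l| * (T - t) / 2) in
  [/\ nc (Y 1 l t * X 0 l T - Y 0 l t * X 1 l T) <= W,
      nc (Y 1 l t * Y 0 l T - Y 0 l t * Y 1 l T) <= W,
      nc (X 0 l t * X 1 l T - X 1 l t * X 0 l T) <= W &
      nc (X 0 l t * Y 1 l T - X 1 l t * Y 0 l T) <= W].
Proof.
move=> t0 tT W; have D : X 0 l t * Y 1 l t - Y 0 l t * X 1 l t = 1 :=
  frame_det T0 qi HF l t0 tT.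
have rt i := rowsol_sub t0 (lexx T) (rows i l).
have [|h1 h2] := rowsol_bound (rowsol_lin (Y 1 l t) (- Y 0 l t) (rt 0) (rt 1))
  (lexx t) tT (lexx T).
  rewrite [X in nc X ^+ 2 + _](_ : _ = 1); last by rewrite -D /X /Y; ring.
  rewrite [X in _ + nc X ^+ 2](_ : _ = 0); last by ring.
  by rewrite nc0 nc1 expr1n expr0n addr0.
have [|h3 h4] := rowsol_bound (rowsol_lin (- X 1 l t) (X 0 l t) (rt 0) (rt 1))
  (lexx t) tT (lexx T).
  rewrite [X in nc X ^+ 2 + _](_ : _ = 0); last by ring.
  rewrite [X in _ + nc X ^+ 2](_ : _ = 1); last by rewrite -D /X /Y; ring.
  by rewrite nc0 nc1 expr1n expr0n add0r.
split.
- by apply: le_trans h1; rewrite mulNr.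
- by apply: le_trans h2; rewrite mulNr.
- by apply: le_trans h3; rewrite mulNr addrC.
- by apply: le_trans h4; rewrite mulNr addrC.
Qed.

Variables (p g na nb nd u : R[i] -> R[i]) (P : {poly R[i]}).
Hypotheses (ena : entire na) (enb : entire nb) (ed : entire nd) (eu : entire u)
  (u0 : forall l, u l != 0)
  (H1 : forall l, X 0 l T - Y 1 l T = p l * (2 * na l))
  (H2 : forall l, Y 0 l T = p l * nb l) (H3 : forall l, X 1 l T = p l * nd l)
  (Hg : forall l, (X 0 l T + Y 1 l T) ^+ 2 - 4 = g l * p l ^+ 2)
  (HgP : forall l, g l = P.[l] * u l).

(** [F(t)^-1 (p N) F(t)] is the product of [F(t)^-1 F(T)] and [F(t)], minus half the trace. The
    exponents [T - t] and [t] add up to [T]; each entry of the product costs at most [2 * W], and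
    half the trace at most [W]. *)
Lemma conj_bound l t : 0 <= t -> t <= T ->
  let W := expR (`|complex.Im l| * T / 2) in
  let c e := e (X 0 l t) (Y 0 l t) (X 1 l t) (Y 1 l t) (na l) (nb l) (nd l) in
  [/\ nc (p l * c conj11) <= 3 * W, nc (p l * c conj12) <= 3 * W &
      nc (p l * c conj21) <= 3 * W].
Proof.
move=> t0 tT W c; have D : X 0 l t * Y 1 l t - Y 0 l t * X 1 l t = 1 :=
  frame_det T0 qi HF l t0 tT.
have [b1 b2 b3 b4] := transfer_bound l t0 tT.
have [f1 f2] := frame_bound T0 qi HF 0 l t0 tT.
have [f3 f4] := frame_bound T0 qi HF 1 l t0 tT.
have [f5 _] := frame_bound T0 qi HF 0 l (ltW T0) (lexx T).
have [_ f6] := frame_bound T0 qi HF 1 l (ltW T0) (lexx T).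
rewrite -!/(X _ _ _) -!/(Y _ _ _) in f1 f2 f3 f4 f5 f6.
set W1 := expR _ in b1 b2 b3 b4; set W2 := expR _ in f1 f2 f3 f4.
have WW : W = W1 * W2 by rewrite /W1 /W2 -expRD /W; congr expR; field.
rewrite -/W in f5 f6.
pose S := (X 0 l T + Y 1 l T) / 2.
have SW : nc S <= W.
  rewrite /S ncM ncV nc_nat ler_pdivrMr//.
  by have := ncD (X 0 l T) (Y 1 l T); lra.
have aE : X 0 l T = S + p l * na l.
  have -> : p l * na l = (X 0 l T - Y 1 l T) / 2 by rewrite H1; field.
  by rewrite /S; field.
have dE : Y 1 l T = S - p l * na l.
  have -> : p l * na l = (X 0 l T - Y 1 l T) / 2 by rewrite H1; field.
  by rewrite /S; field.
have pr (a b a' b' : R[i]) : nc a <= W1 -> nc b <= W2 -> nc a' <= W1 ->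
    nc b' <= W2 -> nc (a * b + a' * b') <= 2 * W.
  move=> ha hb ha' hb'; rewrite (le_trans (ncD _ _))// !ncM WW mulr_natl mulr2n.
  by apply: lerD; rewrite ler_pM ?nc_ge0.
have W0 : 0 <= W by rewrite expR_ge0.
split.
- have -> : p l * c conj11 =
      (Y 1 l t * X 0 l T - Y 0 l t * X 1 l T) * X 0 l t +
      (Y 1 l t * Y 0 l T - Y 0 l t * Y 1 l T) * X 1 l t -
      S * (X 0 l t * Y 1 l t - Y 0 l t * X 1 l t).
    by rewrite aE dE H2 H3 /c /conj11; ring.
  rewrite D mulr1 (le_trans (ncB _ _))//.
  by have := pr _ _ _ _ b1 f1 b2 f3; lra.
- have -> : p l * c conj12 =
      (Y 1 l t * X 0 l T - Y 0 l t * X 1 l T) * Y 0 l t +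
      (Y 1 l t * Y 0 l T - Y 0 l t * Y 1 l T) * Y 1 l t.
    by rewrite aE dE H2 H3 /c /conj12; ring.
  by have := pr _ _ _ _ b1 f2 b2 f4; lra.
- have -> : p l * c conj21 =
      (X 0 l t * X 1 l T - X 1 l t * X 0 l T) * X 0 l t +
      (X 0 l t * Y 1 l T - X 1 l t * Y 0 l T) * X 1 l t.
    by rewrite aE dE H2 H3 /c /conj21; ring.
  by have := pr _ _ _ _ b3 f1 b4 f3; lra.
Qed.

Lemma large_squares : forall K, exists2 r : R, K <= r & 1 <= r /\
  forall l, onedge (- r) r (- r) r l ->
  expR (`|complex.Im l| * T) / 4 <= nc ((X 0 l T + Y 1 l T) ^+ 2 - 4).
Proof.
move=> K; have [L L0 HL] := trace_lower_bound T0 qi.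
pose K' := Num.max K (Num.max L 1).
pose n := Num.bound (K' * T).
pose r := (2 * n%:R + 1) * pi / T.
have K'r : K' <= r.
  rewrite /r ler_pdivlMr//.
  have h : K' * T < n%:R.
    by apply: archi_boundP; rewrite mulr_ge0 ?(ltW T0)// !le_max ler01 !orbT.
  have n0 : 0 <= n%:R :> R by [].
  have := pi_ge2 R; nra.
move: K'r; rewrite !ge_max => /andP[Kr /andP[Lr r1]].
exists r => //; split=> // l lr; have := HL n l _ Lr lr (HF l).
by rewrite mxtrace2 /X /Y clamp_id// (ltW T0) lexx.
Qed.

Lemma small_p_entry l : nc (p l * na l) <= expR (`|complex.Im l| * T / 2) /\
  nc (p l * nb l) <= expR (`|complex.Im l| * T / 2) /\
  nc (p l * nd l) <= expR (`|complex.Im l| * T / 2).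
Proof.
have [f1 f2] := frame_bound T0 qi HF 0 l (ltW T0) (lexx T).
have [f3 f4] := frame_bound T0 qi HF 1 l (ltW T0) (lexx T).
rewrite -H2 -H3; split=> //.
have -> : p l * na l = (X 0 l T - Y 1 l T) / 2 by rewrite H1; field.
rewrite ncM ncV nc_nat ler_pdivrMr//.
have := ncB (X 0 l T) (Y 1 l T); rewrite -/(X 0 l T) -/(Y 1 l T) in f1 f4; lra.
Qed.

(** [Delta^2 - 4 = P u p^2] absorbs one [p] for [w], one for [f], and the unit [u]. Dividing the
    bounds [W] and [3 * W] by the lower bound [W^2 / 4] leaves the constant 12. *)
Lemma scaled_entry_poly (w f : R[i] -> R[i]) : entire f ->
  (w = na \/ w = nb \/ w = nd) ->
  (forall l, nc (p l * f l) <= 3 * expR (`|complex.Im l| * T / 2)) ->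
  forall N C, (forall r l, 1 <= r -> nc l <= 2 * r -> nc P.[l] <= C * r ^+ N) ->
  exists2 P' : {poly R[i]}, (size P' <= N.+1)%N & forall l, w l / u l * f l = P'.[l].
Proof.
move=> ef Hw fb N C HC.
have ew : entire w by case: Hw => [->|[->|->]].
have eF : entire (fun l => w l / u l * f l).
  exact: (entireM (entireM ew (entireV u0 eu)) ef).
apply: (@liouville_poly _ _ N (12 * C) eF) => K.
have [r Kr [r1 Hr]] := large_squares K; exists r => // l lr.
have HP := HC r l r1 (onsq_nc_le lr).
have Hl := Hr l lr; set W := expR (`|complex.Im l| * T / 2).
have WW : expR (`|complex.Im l| * T) = W ^+ 2 by rewrite expr2 -expRD -splitr.
have W0 : 0 < W by rewrite expR_gt0.
have wb : nc (p l * w l) <= W.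
  have [s1 [s2 s3]] := small_p_entry l.
  by case: Hw => [->|[->|->]].
rewrite WW in Hl; have fbl := fb l; rewrite -/W in fbl.
set D := _ - 4 in Hl.
have D0 : 0 < nc D by apply: lt_le_trans Hl; rewrite divr_gt0// exprn_gt0.
have E : w l / u l * f l * D = P.[l] * (p l * w l) * (p l * f l).
  by rewrite /D Hg HgP; field; exact: u0.
rewrite -(ler_pM2r D0) -ncM E !ncM.
rewrite !ncM in wb fbl.
apply: (@le_trans _ _ (C * r ^+ N * W * (3 * W))).
  by rewrite ler_pM ?mulr_ge0 ?nc_ge0// ler_pM ?mulr_ge0 ?nc_ge0.
have -> : C * r ^+ N * W * (3 * W) = 12 * C * r ^+ N * (W ^+ 2 / 4) by field.
rewrite ler_wpM2l// -mulrA mulr_ge0//; exact: le_trans (nc_ge0 _) HP.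
Qed.

(** [M] is the sum of half its trace times the identity and of [p N], hence commutes with [N]. *)
Lemma frame_end_conj l :
  let c e := e (X 0 l T) (Y 0 l T) (X 1 l T) (Y 1 l T) (na l) (nb l) (nd l) : R[i] in
  [/\ c conj11 = na l, c conj12 = nb l & c conj21 = nd l].
Proof.
move=> c; have D : X 0 l T * Y 1 l T - Y 0 l T * X 1 l T = 1 :=
  frame_det T0 qi HF l (ltW T0) (lexx T).
pose S := (X 0 l T + Y 1 l T) / 2.
have aE : X 0 l T = S + p l * na l.
  have -> : p l * na l = (X 0 l T - Y 1 l T) / 2 by rewrite H1; field.
  by rewrite /S; field.
have dE : Y 1 l T = S - p l * na l.
  have -> : p l * na l = (X 0 l T - Y 1 l T) / 2 by rewrite H1; field.
  by rewrite /S; field.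
by split; rewrite -[RHS]mulr1 -D /c /conj11 /conj12 /conj21 aE dE H2 H3; ring.
Qed.

(** The polynomials depend on [t] through [clamp T t] only, so facts proved on [[0, T]] hold for all
    [t]. The last clause ensures that there is a top degree to compare coefficients in. *)
Lemma killing_field : exists (N : nat) (pA pB pC : R -> {poly R[i]}),
  [/\ forall t, [/\ (size (pA t) <= N)%N, (size (pB t) <= N)%N & (size (pC t) <= N)%N] /\
        [/\ pA (clamp T t) = pA t, pB (clamp T t) = pB t & pC (clamp T t) = pC t],
      forall l, [/\
        prim 0 T (fun t => - ((q t)^*%C * (pB t).[l] + q t * (pC t).[l]) / 2)
          (fun t => (pA t).[l]),
        prim 0 T (fun t => q t * (pA t).[l] - 'i%C * (l * (pB t).[l]))
          (fun t => (pB t).[l]) &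
        prim 0 T (fun t => (q t)^*%C * (pA t).[l] + 'i%C * (l * (pC t).[l]))
          (fun t => (pC t).[l])],
      [/\ pA 0 = pA T, pB 0 = pB T & pC 0 = pC T] &
      ~ [/\ pA 0 = 0, pB 0 = 0 & pC 0 = 0]].
Proof.
have [r0 _ [r01 Hr0]] := large_squares 0.
have [w Hw [l0 wl0]] : exists2 w, w = na \/ w = nb \/ w = nd & exists l, w l != 0.
  (* If all entries of [N] vanished, [M] would be scalar of determinant 1, so [Delta^2 - 4] would be
     0 also at a corner of a large square, against the lower bound. *)
  apply: contrapT => nw.
  have z w l : (w = na \/ w = nb \/ w = nd) -> w l = 0.
    move=> hw; apply/eqP/negPn/negP => wl; apply: nw; exists w => //; by exists l.
  pose l := r0 +i* r0.
  have lr : onedge (- r0) r0 (- r0) r0 l.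
    by left; rewrite /l /=; split; [apply/andP; split; lra|right].
  have := Hr0 l lr; have D : X 0 l T * Y 1 l T - Y 0 l T * X 1 l T = 1 :=
    frame_det T0 qi HF l (ltW T0) (lexx T).
  have -> : (X 0 l T + Y 1 l T) ^+ 2 - 4 = 0.
    have -> : (X 0 l T + Y 1 l T) ^+ 2 - 4 =
        (X 0 l T - Y 1 l T) ^+ 2 + 4 * (X 0 l T * Y 1 l T - 1) by ring.
    rewrite -D H1 (z na); last by left.
    by rewrite H2 (z nb); [ring|right; left].
  by rewrite nc0 leNgt divr_gt0// expR_gt0.
have [C [N [C0 HC]]] := poly_growth P.
pose c (e : R[i] -> R[i] -> R[i] -> R[i] -> R[i] -> R[i] -> R[i] -> R[i]) t l :=
  w l / u l * e (X 0 l t) (Y 0 l t) (X 1 l t) (Y 1 l t) (na l) (nb l) (nd l).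
have XE t : let s := clamp T t in [/\ 0 <= s, s <= T &
    forall i l, X i l s = X i l t /\ Y i l s = Y i l t].
  move=> s; have /andP[s0 sT] := clamp_itv t (ltW T0); split=> // i l.
  by rewrite /X /Y clamp_id// s0.
have eXY t i : entire (fun l => X i l t) /\ entire (fun l => Y i l t).
  have [s0 sT E] := XE t; have [h1 h2] := frame_entire_clamp T0 qi HF i s0 sT.
  split; [apply: entire_ext h1|apply: entire_ext h2] => l /=; have [h3 h4] := E i l.
    exact: h3.
  exact: h4.
have ec t := entire_conj (eXY t 0).1 (eXY t 0).2 (eXY t 1).1 (eXY t 1).2 ena enb ed.
have bnd t : [/\ forall l, nc (p l * conj11 (X 0 l t) (Y 0 l t) (X 1 l t) (Y 1 l t) (na l) (nb l) (nd l)) <=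
      3 * expR (`|complex.Im l| * T / 2),
    forall l, nc (p l * conj12 (X 0 l t) (Y 0 l t) (X 1 l t) (Y 1 l t) (na l) (nb l) (nd l)) <=
      3 * expR (`|complex.Im l| * T / 2) &
    forall l, nc (p l * conj21 (X 0 l t) (Y 0 l t) (X 1 l t) (Y 1 l t) (na l) (nb l) (nd l)) <=
      3 * expR (`|complex.Im l| * T / 2)].
  have [s0 sT E] := XE t.
  by split=> l; have := conj_bound l s0 sT; have [-> ->] := E 0 l;
    have [-> ->] := E 1 l; case.
have /choice[pA HA] : forall t, exists p' : {poly R[i]}, (size p' <= N.+1)%N /\
    forall l, c conj11 t l = p'.[l].
  move=> t; have [e1 _ _] := ec t; have [b1 _ _] := bnd t.
  by have [p' ? ?] := scaled_entry_poly e1 Hw b1 HC; exists p'.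
have /choice[pB HB] : forall t, exists p' : {poly R[i]}, (size p' <= N.+1)%N /\
    forall l, c conj12 t l = p'.[l].
  move=> t; have [_ e1 _] := ec t; have [_ b1 _] := bnd t.
  by have [p' ? ?] := scaled_entry_poly e1 Hw b1 HC; exists p'.
have /choice[pC HC'] : forall t, exists p' : {poly R[i]}, (size p' <= N.+1)%N /\
    forall l, c conj21 t l = p'.[l].
  move=> t; have [_ _ e1] := ec t; have [_ _ b1] := bnd t.
  by have [p' ? ?] := scaled_entry_poly e1 Hw b1 HC; exists p'.
have A_E t l : (pA t).[l] = c conj11 t l by have [_ ->] := HA t.
have B_E t l : (pB t).[l] = c conj12 t l by have [_ ->] := HB t.
have C_E t l : (pC t).[l] = c conj21 t l by have [_ ->] := HC' t.
have init i l : X i l 0 = (i == 0)%:R /\ Y i l 0 = (i == 1)%:R by exact: (frame_init T0 HF i l).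
have c0 l : [/\ c conj11 0 l = w l / u l * na l, c conj12 0 l = w l / u l * nb l &
    c conj21 0 l = w l / u l * nd l].
  have [x0 y0] := init 0 l; have [x1 y1] := init 1 l.
  rewrite /c x0 y0 x1 y1 /conj11 /conj12 /conj21 /=.
  by split; congr (_ * _); ring.
exists N.+1, pA, pB, pC; split.
- move=> t; split; first by split; [have [] := HA t|have [] := HB t|have [] := HC' t].
  have [s0 sT E] := XE t.
  by split; apply: horner_inj => l; rewrite ?A_E ?B_E ?C_E /c;
    have [-> ->] := E 0 l; have [-> ->] := E 1 l.
- move=> l; have [ho1 ho2 ho3] := conj_ode (na l) (nb l) (nd l) (rows 0 l) (rows 1 l).
  pose k := w l / u l; have kE (h1 h2 : R -> R[i]) : (forall t, h1 t = h2 t) -> h1 = h2.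
    by move=> /funext.
  rewrite (kE (fun t => (pA t).[l]) _ (fun t => A_E t l)).
  rewrite (kE (fun t => (pB t).[l]) _ (fun t => B_E t l)).
  rewrite (kE (fun t => (pC t).[l]) _ (fun t => C_E t l)).
  split.
  + by apply: prim_ext (primZ k ho1) => t _; rewrite B_E C_E /c -/k; field.
  + by apply: prim_ext (primZ k ho2) => t _; rewrite A_E B_E /c -/k; field.
  + by apply: prim_ext (primZ k ho3) => t _; rewrite A_E C_E /c -/k; field.
- by split; apply: horner_inj => l; have [h1 h2 h3] := c0 l;
    have [k1 k2 k3] := frame_end_conj l;
    rewrite ?A_E ?B_E ?C_E ?h1 ?h2 ?h3 /c ?k1 ?k2 ?k3.
(* One of the three entries at time 0 is [w^2 / u], which does not vanish at [l0]. *)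
- move=> [zA zB zC]; have [h1 h2 h3] := c0 l0.
  move: h1 h2 h3; rewrite -A_E -B_E -C_E zA zB zC !horner0 => h1 h2 h3.
  have wu : w l0 / u l0 != 0 by rewrite mulf_neq0// invr_eq0.
  have z (v : R[i]) : 0 = w l0 / u l0 * v -> v = 0.
    by move=> /esym/eqP; rewrite mulf_eq0 (negPf wu) => /eqP.
  move: wl0; case: Hw => [|[|]] E; move: (z _ h1) (z _ h2) (z _ h3);
    rewrite -E => e1 e2 e3.
  + by rewrite e1 eqxx.
  + by rewrite e2 eqxx.
  + by rewrite e3 eqxx.
Qed.

End PolynomialKillingField.

Section VanishingIntegrals.
Context {R : realType}.
Implicit Types (f : R -> R[i]) (s t T : R).
Local Notation mu := (@lebesgue_measure R).

(** Extended by 0, [f] has vanishing integral over every half-line, and almost everywhere it is the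
    derivative of that integral. *)
Lemma rint_eq0_ae T (f : R -> R) : 0 <= T -> rin 0 T f ->
  (forall t, 0 <= t <= T -> \int[mu]_(s in `[0, t]) f s = 0) ->
  {ae mu, forall t, 0 <= t <= T -> f t = 0}.
Proof.
move=> T0 fi H; pose g := f \_ `[0, T].
have giT : mu.-integrable setT (EFin \o g).
  by rewrite -restrict_EFin; apply/integrable_restrict => //=; rewrite setTI.
have gi (y : R) : mu.-integrable `]-oo, y] (EFin \o g) by exact: integrableS giT.
have lg : locally_integrable [set: R] g := open_integrable_locally openT giT.
have := FTC1Ny gi lg; apply: filterS; first exact: (ae_filter_ringOfSetsType mu).
move=> t [_ Ht] /andP[t0 tT].
have g0 (y : R) : \int[mu]_(s in [set` `]-oo, y]]) g s = 0.
  rewrite /g -Rintegral_mkcondr.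
  have [y0|y0] := leP 0 y; last first.
    rewrite (_ : _ `&` _ = set0) ?Rintegral_set0// -subset0 => s /=.
    by rewrite !in_itv/= => -[sy /andP[s0 _]]; move: (le_lt_trans (le_trans s0 sy) y0); rewrite ltxx.
  rewrite (_ : _ `&` _ = `[0, Num.min y T]%classic).
    by apply: H; rewrite le_min y0 T0 ge_min lexx orbT.
  apply/seteqP; split=> s /=; rewrite !in_itv/= le_min.
    by move=> [-> /andP[-> ->]].
  by move=> /andP[-> /andP[-> ->]].
move: Ht; have -> : (fun x => \int[mu]_(s in [set` `]-oo, x]]) g s) = cst 0.
  by apply/funext => y; exact: g0.
rewrite derive1_cst /g patchE mem_set//=.
by rewrite in_itv/= t0 tT.
Qed.

Lemma prim_cst_ae T f k : 0 <= T -> prim 0 T f (fun=> k) ->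
  {ae mu, forall t, 0 <= t <= T -> f t = 0}.
Proof.
move=> T0 [[f1 f2] _ H].
have I t : 0 <= t <= T -> Cintegral 0 t f = 0.
  by move=> /andP[t0 tT]; rewrite -H// subrr.
have a1 : {ae mu, forall t, 0 <= t <= T -> complex.Re (f t) = 0}.
  by apply: rint_eq0_ae => // t /I /(congr1 (@complex.Re R)).
have a2 : {ae mu, forall t, 0 <= t <= T -> complex.Im (f t) = 0}.
  by apply: rint_eq0_ae => // t /I /(congr1 (@complex.Im R)).
move: a1 a2; apply: filterS2; first exact: (ae_filter_ringOfSetsType mu).
by move=> t h1 h2 tT; apply: complexP; [exact: h1|exact: h2].
Qed.

Lemma prim_cst_ccont T f k t : 0 < T -> ccont f -> prim 0 T f (fun=> k) ->
  0 <= t <= T -> f t = 0.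
Proof.
move=> T0 cf [_ _ H] /andP[t0 tT]; apply/eqP/negPn/negP => ft.
have f0 : 0 < nc (f t) by rewrite nc_gt0.
have e0 : 0 < nc (f t) / 4 by lra.
have [d d0 Hd] := (ccontP f).1 cf t _ e0.
(* A short interval with [t] as one end point, on the side where [[0, T]] has room; [f] stays close
   to [f t] on it. *)
have [a [b [ab a0 bT ad]]] : exists a b : R, [/\ a < b, 0 <= a, b <= T &
    forall s, a <= s <= b -> `|s - t| < d].
  have [h|h] := leP t (T / 2).
    exists t, (Num.min T (t + d / 2)); split=> //.
    - by rewrite lt_min; apply/andP; split; lra.
    - by rewrite ge_min lexx.
    - move=> s; rewrite le_min => /andP[ts /andP[_ sd]].
      by rewrite ger0_norm; lra.
  exists (Num.max 0 (t - d / 2)), t; split=> //.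
  - by rewrite gt_max; apply/andP; split; lra.
  - by rewrite le_max lexx.
  - move=> s; rewrite ge_max => /andP[/andP[_ sd] st].
    by rewrite ler0_norm; lra.
have := H a b a0 (ltW ab) bT; rewrite subrr => /esym E.
have cft : ccont (fun s => f s - f t) by apply: ccontB => //; exact: ccont_cst.
have E2 : Cintegral a b (fun s => f s - f t) = - (f t * (b - a)%:C).
  rewrite CIB; [|exact: cin_cont|exact/cin_cont/ccont_cst].
  by rewrite E CI_cst ?ltW// sub0r.
have : nc (f t * (b - a)%:C) <= 2 * (nc (f t) / 4) * (b - a).
  rewrite -ncN -E2; apply: nc_CI_le; [exact: ltW|exact: cin_cont|].
  by move=> s sab; apply/ltW/Hd/ad.
rewrite ncM nc_real ger0_norm; last by lra.
nra.
Qed.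

End VanishingIntegrals.

(** * Comparing coefficients in the Lax equation *)

Section Coefficients.
Context {R : realType}.

(** By Vandermonde, a coefficient is a combination, with weights independent of the polynomial, of
    the values at [0, ..., n - 1]. Equations known for each fixed parameter thereby pass to
    coefficients. *)
Lemma coef_interpolation n : exists L : nat -> nat -> R[i],
  forall p : {poly R[i]}, (size p <= n)%N -> forall k, (k < n)%N ->
  p`_k = \sum_(j < n) L k j * p.[j%:R].
Proof.
pose V := Vandermonde n (\row_(j < n) (j%:R : R[i])).
have uV : V \in unitmx.
  rewrite unitmxE unitfE det_Vandermonde.
  apply/prodf_neq0 => i _; apply/prodf_neq0 => j ij.
  by rewrite !mxE subr_eq0 eqr_nat gtn_eqF.
exists (fun k j => if insub k is Some k' then
  if insub j is Some j' then invmx V j' k' else 0 else 0) => p sp k kn.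
have H : poly_rV p *m V = \row_j p.[(j : 'I_n)%:R].
  apply/rowP => j; rewrite !mxE (horner_coef_wide _ sp).
  by apply: eq_bigr => i _; rewrite !mxE.
have -> : p`_k = (poly_rV p : 'rV_n) 0 (Ordinal kn) by rewrite mxE.
rewrite -[poly_rV p](mulmxK uV) H mxE; apply: eq_bigr => j _.
by rewrite !mxE insubT /= valK mulrC.
Qed.

Variables (T : R) (q : R -> R[i]) (N : nat) (pA pB pC : R -> {poly R[i]}).
Hypotheses (T0 : 0 < T)
  (Hsz : forall t,
    [/\ (size (pA t) <= N)%N, (size (pB t) <= N)%N & (size (pC t) <= N)%N] /\
    [/\ pA (clamp T t) = pA t, pB (clamp T t) = pB t & pC (clamp T t) = pC t])
  (Hode : forall l, [/\
    prim 0 T (fun t => - ((q t)^*%C * (pB t).[l] + q t * (pC t).[l]) / 2)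
      (fun t => (pA t).[l]),
    prim 0 T (fun t => q t * (pA t).[l] - 'i%C * (l * (pB t).[l]))
      (fun t => (pB t).[l]) &
    prim 0 T (fun t => (q t)^*%C * (pA t).[l] + 'i%C * (l * (pC t).[l]))
      (fun t => (pC t).[l])])
  (Hnz : ~ [/\ pA 0 = 0, pB 0 = 0 & pC 0 = 0]).
Implicit Types (s t : R) (k : nat).

Lemma prim_sum (n : nat) (f F : 'I_n -> R -> R[i]) (a b : R) :
  (forall j, prim a b (f j) (F j)) ->
  prim a b (fun t => \sum_j f j t) (fun t => \sum_j F j t).
Proof.
move=> H; have E (G : 'I_n -> R -> R[i]) t :
    \sum_j G j t = \sum_(j <- index_enum 'I_n) G j t by [].
rewrite (_ : (fun t => \sum_j F j t) =
  (fun t => \sum_(j <- index_enum 'I_n) F j t))//.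
elim: (index_enum 'I_n) => [|j r IH].
  rewrite (_ : (fun t => \sum_(j <- [::]) F j t) = fun=> 0); last first.
    by apply/funext => t; rewrite big_nil.
  by apply: prim_ext (prim_cst a b 0) => t _; rewrite big_nil.
rewrite (_ : (fun t => \sum_(i <- j :: r) F i t) =
  fun t => F j t + \sum_(i <- r) F i t); last first.
  by apply/funext => t; rewrite big_cons.
by apply: prim_ext (primD (H j) IH) => t _; rewrite big_cons.
Qed.

Lemma coef_ode k : [/\
    prim 0 T (fun t => - ((q t)^*%C * (pB t)`_k + q t * (pC t)`_k) / 2)
      (fun t => (pA t)`_k),
    prim 0 T (fun t => q t * (pA t)`_k - 'i%C * ('X * pB t)`_k)
      (fun t => (pB t)`_k) &
    prim 0 T (fun t => (q t)^*%C * (pA t)`_k + 'i%C * ('X * pC t)`_k)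
      (fun t => (pC t)`_k)].
Proof.
(* Large enough for the index [k], and for the products by ['X], whose size may reach [N + 1]. *)
have [L HL] := coef_interpolation (maxn N k).+1.
set n := (maxn N k).+1 in HL.
have kn : (k < n)%N by rewrite ltnS leq_maxr.
have sz (p : {poly R[i]}) : (size p <= N)%N -> (size p <= n)%N.
  by move=> h; rewrite (leq_trans h)// (leq_trans (leq_maxl N k))// leqnSn.
have szX (p : {poly R[i]}) : (size p <= N)%N -> (size ('X * p)%R <= n)%N.
  move=> h; rewrite mulrC (leq_trans (size_polyMleq _ _))// size_polyX addn2 /= ltnS.
  by rewrite (leq_trans h)// leq_maxl.
have sA t : (size (pA t) <= N)%N by have [[]] := Hsz t.
have sB t : (size (pB t) <= N)%N by have [[]] := Hsz t.
have sC t : (size (pC t) <= N)%N by have [[]] := Hsz t.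
have cE (p : {poly R[i]}) : (size p <= n)%N -> p`_k = \sum_(j < n) L k j * p.[j%:R].
  by move=> h; exact: HL.
have fE (p : R -> {poly R[i]}) : (forall t, (size (p t) <= N)%N) ->
    (fun t => (p t)`_k) = fun t => \sum_(j < n) L k j * (p t).[j%:R].
  by move=> h; apply/funext => t; exact/cE/sz.
rewrite (fE _ sA) (fE _ sB) (fE _ sC); split.
- have := prim_sum (fun j : 'I_n => primZ (L k j) (let: And3 h _ _ := Hode j%:R in h)).
  apply: prim_ext => t _; rewrite (cE _ (sz _ (sB t))) (cE _ (sz _ (sC t))).
  rewrite !mulr_sumr -big_split/= mulNr mulr_suml -sumrN; apply: eq_bigr => j _; ring.
- have := prim_sum (fun j : 'I_n => primZ (L k j) (let: And3 _ h _ := Hode j%:R in h)).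
  apply: prim_ext => t _; rewrite (cE _ (sz _ (sA t))) (cE _ (szX _ (sB t))).
  rewrite !mulr_sumr -sumrB; apply: eq_bigr => j _; rewrite hornerM hornerX; ring.
- have := prim_sum (fun j : 'I_n => primZ (L k j) (let: And3 _ _ h := Hode j%:R in h)).
  apply: prim_ext => t _; rewrite (cE _ (sz _ (sA t))) (cE _ (szX _ (sC t))).
  rewrite !mulr_sumr -big_split/=; apply: eq_bigr => j _; rewrite hornerM hornerX; ring.
Qed.

(* In the top degree m the Lax equation forces B and C to vanish, hence A to be a
   constant kappa; then 0 = B_m' = q kappa - i B_(m-1). *)
Lemma potential_from_coefs : exists (m : nat) (kappa : R[i]),
  {ae @lebesgue_measure R, forall t, 0 <= t <= T ->
    'i%C * ('X * pB t)`_m / kappa = q t}.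
Proof.
pose small n := `[< forall t,
  [/\ (size (pA t) <= n)%N, (size (pB t) <= n)%N & (size (pC t) <= n)%N] >].
have ex : exists n, small n by exists N; apply/asboolP => t; have [] := Hsz t.
(* [m + 1] is the least bound of the sizes valid for all [t]; by minimality the coefficients of
   degree [m] do not all vanish identically. *)
case: (ex_minnP ex) => -[|m] /asboolP sm min_m.
  exfalso; apply: Hnz; have [] := sm 0.
  by rewrite !leqn0 !size_poly_eq0 => /eqP ? /eqP ? /eqP.
have z1 t : [/\ (pA t)`_m.+1 = 0, (pB t)`_m.+1 = 0 & (pC t)`_m.+1 = 0].
  by have [h1 h2 h3] := sm t; split; apply: nth_default.
have [_ o2 o3] := coef_ode m.+1.
have cc k : [/\ ccont (fun t => (pA t)`_k), ccont (fun t => (pB t)`_k) &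
    ccont (fun t => (pC t)`_k)].
  by have [[_ ? _] [_ ? _] [_ ? _]] := coef_ode k.
have [cA cB cC] := cc m.
have Bm t : (pB t)`_m = 0.
  have E : (fun t => (pB t)`_m.+1) = (fun=> 0).
    by apply/funext => s; have [] := z1 s.
  rewrite E in o2.
  have H : prim 0 T (fun t => - 'i%C * (pB t)`_m) (fun=> 0).
    apply: prim_ext o2 => s _; have [-> _ _] := z1 s.
    by rewrite coefXM /=; ring.
  have [_ [_ HB _]] := Hsz t; rewrite -HB.
  have := prim_cst_ccont T0 (ccontM (ccont_cst _) cB) H (clamp_itv t (ltW T0)).
  move=> /eqP; rewrite mulf_eq0 oppr_eq0 -nc_eq0 nc_i oner_eq0 /= => /eqP.
  exact.
have Cm t : (pC t)`_m = 0.
  have E : (fun t => (pC t)`_m.+1) = (fun=> 0).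
    by apply/funext => s; have [] := z1 s.
  rewrite E in o3.
  have H : prim 0 T (fun t => 'i%C * (pC t)`_m) (fun=> 0).
    apply: prim_ext o3 => s _; have [-> _ _] := z1 s.
    by rewrite coefXM /=; ring.
  have [_ [_ _ HC]] := Hsz t; rewrite -HC.
  have := prim_cst_ccont T0 (ccontM (ccont_cst _) cC) H (clamp_itv t (ltW T0)).
  move=> /eqP; rewrite mulf_eq0 -nc_eq0 nc_i oner_eq0 /= => /eqP.
  exact.
have [pa pb _] := coef_ode m.
have Am t : (pA t)`_m = (pA 0)`_m.
  have [_ [HA _ _]] := Hsz t; rewrite -HA.
  have /andP[s0 sT] := clamp_itv t (ltW T0).
  have [_ _ /(_ 0 _ (lexx 0) s0 sT)] := pa.
  rewrite (@CI_ext _ _ _ _ (fun=> 0)).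
    by rewrite CI_cst// mul0r => /eqP; rewrite subr_eq0 => /eqP.
  by move=> s _; rewrite Bm Cm !mulr0 addr0 oppr0 mul0r.
(* For [m = 0] the coefficient of ['X * pB] is 0, and the conclusion reads [q = 0] almost
   everywhere. *)
exists m, (pA 0)`_m.
have k0 : (pA 0)`_m != 0.
  apply/eqP => k0; have : small m.
    apply/asboolP => t; have [h1 h2 h3] := sm t.
    have red (p : {poly R[i]}) : (size p <= m.+1)%N -> p`_m = 0 -> (size p <= m)%N.
      move=> h pm; apply/leq_sizeP => j; rewrite leq_eqVlt => /predU1P[<-//|mj].
      by apply: nth_default; exact: leq_trans h mj.
    by split; apply: red => //; rewrite ?Am.
  by move=> /min_m; rewrite ltnn.
have E : (fun t => (pB t)`_m) = (fun=> 0) by apply/funext.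
rewrite E in pb; have := prim_cst_ae (ltW T0) pb.
apply: filterS; first exact: (ae_filter_ringOfSetsType (@lebesgue_measure R)).
move=> t H tT; have /eqP := H tT; rewrite subr_eq0 Am => /eqP <-.
by rewrite mulfK.
Qed.

End Coefficients.

(** * Periodic extension and smoothness *)

Section DerivativesOfCurves.
Context {R : realType}.
Implicit Types (f g h Phi : R -> R[i]) (a b d e s t x T : R) (D k : R[i]).
Local Notation mu := (@lebesgue_measure R).

Lemma is_derive_epsP (F : R -> R) t (D : R) : is_derive t 1 F D <->
  forall e, 0 < e -> exists2 d : R, 0 < d &
    forall s, `|s - t| < d -> `|F s - F t - D * (s - t)| <= e * `|s - t|.
Proof.
split=> [[dF DF] e e0|H].
  have : h^-1 *: (F (h *: 1 + t) - F t) @[h --> 0^'] --> D by rewrite -DF.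
  move=> /cvgrPdist_le/(_ _ e0).
  rewrite /dnbhs /within /= => /nbhs_ballP[d /= d0 Hd]; exists d => // s st.
  have [->|s0] := eqVneq s t; first by rewrite !subrr mulr0 subr0 normr0 mulr0.
  have st0 : s - t != 0 by rewrite subr_eq0.
  have := Hd (s - t); rewrite /ball /= sub0r normrN => /(_ st st0).
  rewrite /GRing.scale /= mulr1 subrK => B.
  have -> : F s - F t - D * (s - t) = - ((D - (s - t)^-1 * (F s - F t)) * (s - t)).
    by rewrite mulrBl mulrAC mulVf// mul1r; ring.
  by rewrite normrN normrM ler_wpM2r.
have C : h^-1 *: (F (h *: 1 + t) - F t) @[h --> 0^'] --> D.
  apply/cvgrPdist_le => /= e e0; have [d d0 Hd] := H e e0.
  rewrite /dnbhs /within /=; apply/nbhs_ballP; exists d => //= h.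
  rewrite /ball /= sub0r normrN => hd h0; rewrite /GRing.scale /= mulr1.
  have := Hd (h + t); rewrite addrK => /(_ hd) B.
  have h0' : 0 < `|h| by rewrite normr_gt0.
  rewrite -(ler_pM2r h0') -normrM; apply: le_trans B.
  rewrite -normrN (_ : - ((D - h^-1 * (F (h + t) - F t)) * h) = F (h + t) - F t - D * h)//.
  by rewrite mulrBl mulrAC mulVf// mul1r; ring.
split; first by apply/cvg_ex; exists D.
exact/cvg_lim.
Qed.

Definition cder_at f D t : Prop := forall e, 0 < e -> exists2 d : R, 0 < d &
  forall s, `|s - t| < d -> nc (f s - f t - D * (s - t)%:C) <= e * `|s - t|.

Lemma cderP f g : cder f g <-> forall t, cder_at f (g t) t.
Proof.
split=> H t.
  have [/is_derive_epsP H1 /is_derive_epsP H2] := H t.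
  move=> e e0; have e20 : 0 < e / 2 by lra.
  have [d1 d10 B1] := H1 _ e20; have [d2 d20 B2] := H2 _ e20.
  exists (Num.min d1 d2) => [|s]; first by rewrite lt_min d10.
  rewrite lt_min => /andP[/B1 s1 /B2 s2].
  rewrite (le_trans (nc_le _))// !ReImE /= !mulr0 subr0 add0r.
  by rewrite [e]splitr mulrDl lerD.
have Ht := H t.
split; apply/is_derive_epsP => e /Ht[d d0 Hd]; exists d => // s /Hd B;
  apply: le_trans B.
  by apply: le_trans (nc_Re _); rewrite !ReImE /= mulr0 subr0.
by apply: le_trans (nc_Im _); rewrite !ReImE /= mulr0 add0r.
Qed.

Lemma cder_at_shift f D t x : cder_at f D (t + x) -> cder_at (fun s => f (s + x)) D t.
Proof.
move=> H e /H[d d0 Hd]; exists d => // s st.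
have E : s + x - (t + x) = s - t by ring.
by have := Hd (s + x); rewrite E; apply.
Qed.

(** Exactly one of the two integrals can be nonzero, according to the sign of [t]. Near a given [t],
    [F] differs by a constant from the integral based at a point [a] to the left of both [t] and 0,
    where the fundamental theorem applies. *)
Lemma continuous_primitive (f : R -> R) : continuous f ->
  exists F, forall t, is_derive t 1 F (f t).
Proof.
move=> cf; pose F t := \int[mu]_(s in `[0, t]) f s - \int[mu]_(s in `[t, 0]) f s.
have ci a b : rin a b f by exact: rin_cont.
exists F => t; pose a := - `|t| - 1.
have ta : a < t by rewrite /a; have := ler_norm (- t); rewrite normrN; lra.
have a0 : a < 0 by rewrite /a; have := normr_ge0 t; lra.
pose G x := \int[mu]_(s in `[a, x]) f s.
have t1 : t < t + 1 by lra.
have [dG DG] := continuous_FTC1_closed t1 (ci a (t + 1)) ta (cf t).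
have /is_derive_epsP HG : is_derive t 1 G (f t).
  by split; [exact: dG|rewrite -derive1E; exact: DG].
have FG s : a <= s -> F s = G s - G 0.
  move=> as_; rewrite /F /G; have [s0|s0] := leP 0 s.
    rewrite (@rint_split _ a s 0) ?(ltW a0)//.
    have -> : \int[mu]_(u in `[s, 0]) f u = 0.
      move: s0; rewrite le_eqVlt => /predU1P[<-|s0]; first exact: rint_pt.
      by rewrite set_itv_ge ?Rintegral_set0// bnd_simp -ltNge.
    by rewrite subr0 addrC addKr.
  rewrite (@rint_split _ a 0 s) ?as_ ?ltW//.
  rewrite (_ : \int[mu]_(u in `[0, s]) f u = 0); first by ring.
  by rewrite set_itv_ge ?Rintegral_set0// bnd_simp -ltNge.
apply/is_derive_epsP => e e0; have [d d0 Hd] := HG e e0.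
exists (Num.min d (t - a)) => [|s]; first by rewrite lt_min d0; lra.
rewrite lt_min => /andP[sd sa].
have as_ : a <= s by have := ler_norm (t - s); rewrite distrC; lra.
rewrite !FG ?(ltW ta)//.
by rewrite (_ : G s - G 0 - (G t - G 0) = G s - G t); [exact: Hd|ring].
Qed.

Lemma ccont_primitive f : ccont f -> exists Phi, cder Phi f.
Proof.
move=> [f1 f2]; have [F1 H1] := continuous_primitive f1.
have [F2 H2] := continuous_primitive f2.
by exists (fun t => F1 t +i* F2 t) => t; split; [exact: H1|exact: H2].
Qed.

Lemma CI_shift f a b x : a <= b -> ccont f ->
  Cintegral (a + x) (b + x) f = Cintegral a b (fun t => f (t + x)).
Proof.
move=> ab cf; have [Phi HPhi] := ccont_primitive cf.
have cx : continuous (fun t : R => t + x).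
  by move=> t; apply: cvgD; [exact: cvg_id|exact: cvg_cst].
rewrite (CI_FTC2 _ cf HPhi) ?lerD2r//.
rewrite (@CI_FTC2 _ a b (fun t => Phi (t + x)))//; first exact: ccont_comp.
by apply/cderP => t; apply: cder_at_shift; move/cderP: HPhi; exact.
Qed.

Lemma prim_shift a b x f Y : ccont f -> prim (a + x) (b + x) f Y ->
  prim a b (fun t => f (t + x)) (fun t => Y (t + x)).
Proof.
move=> cf [fi cY H].
have cx : continuous (fun t : R => t + x).
  by move=> t; apply: cvgD; [exact: cvg_id|exact: cvg_cst].
split; [exact/cin_cont/ccont_comp|exact: ccont_comp|].
by move=> s t as_ st tb; rewrite H ?lerD2r// CI_shift.
Qed.

Lemma prim_cat a b c f Y : a <= b -> b <= c -> prim a b f Y -> prim b c f Y ->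
  cin a c f -> prim a c f Y.
Proof.
move=> ab bc [_ cY H1] [_ _ H2] fi; split=> // s t as_ st tc.
have [tb|bt] := leP t b; first exact: H1.
have [sb|bs] := leP s b; last by apply: H2 => //; exact: ltW.
rewrite (@CI_split _ s t b) ?sb ?(ltW bt)//; last exact: cin_sub fi.
rewrite -H1// -H2 ?(ltW bt)//; ring.
Qed.

Lemma rint_ae a b (f g : R -> R) : rin a b f -> rin a b g ->
  {ae mu, forall t, a <= t <= b -> f t = g t} ->
  \int[mu]_(s in `[a, b]) f s = \int[mu]_(s in `[a, b]) g s.
Proof.
move=> /integrableP[mf _] /integrableP[mg _] H; rewrite /Rintegral; congr fine.
apply: ae_eq_integral => //.
move: H; apply: filterS; first exact: (ae_filter_ringOfSetsType mu).
by move=> t /= H; rewrite in_itv/= => tab; rewrite H.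
Qed.

Lemma prim_ae a b f g Y : prim a b f Y -> cin a b g ->
  {ae mu, forall t, a <= t <= b -> f t = g t} -> prim a b g Y.
Proof.
move=> [fi cY H] gi E; split=> // s t as_ st tb; rewrite H//.
have Est : {ae mu, forall u, s <= u <= t -> f u = g u}.
  move: E; apply: filterS; first exact: (ae_filter_ringOfSetsType mu).
  by move=> u Eu /andP[su ut]; rewrite Eu// (le_trans as_ su) (le_trans ut tb).
have [f1 f2] := cin_sub as_ tb fi; have [g1 g2] := cin_sub as_ tb gi.
rewrite /Cintegral; congr (_ +i* _); apply: rint_ae => //.
  move: Est; apply: filterS; first exact: (ae_filter_ringOfSetsType mu).
  by move=> u Eu /Eu ->.
move: Est; apply: filterS; first exact: (ae_filter_ringOfSetsType mu).
by move=> u Eu /Eu ->.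
Qed.

End DerivativesOfCurves.

Section Periodization.
Context {R : realType}.
Implicit Types (f g Y : R -> R[i]) (d e s t x T : R).

Definition residue T t : R := t - T * (Num.floor (t / T))%:~R.

Lemma residue_itv T t : 0 < T -> 0 <= residue T t < T.
Proof.
move=> T0; rewrite /residue; have := Num.Theory.floor_itv (t / T).
rewrite ler_pdivlMr// ltr_pdivrMr// intrD => /andP[h1 h2].
by apply/andP; split; nra.
Qed.

Lemma residueE T (n : int) t : 0 < T -> T * n%:~R <= t -> t < T * (n + 1)%:~R ->
  residue T t = t - T * n%:~R.
Proof.
move=> T0 h1 h2; rewrite /residue (_ : Num.floor (t / T) = n)//.
apply/Num.Theory.floor_def; rewrite ler_pdivlMr// ltr_pdivrMr//.
by rewrite !(mulrC _ T) h1.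
Qed.

Lemma residue_id T t : 0 <= t < T -> residue T t = t.
Proof.
move=> /andP[t0 tT]; have T0 : 0 < T := le_lt_trans t0 tT.
by rewrite (@residueE T 0) ?add0r ?mulr0z ?mulr1z ?mulr0 ?mulr1 ?subr0.
Qed.

Lemma residue_addz T t (n : int) : 0 < T ->
  residue T (t + T * n%:~R) = residue T t.
Proof.
move=> T0; have := Num.Theory.floor_itv (t / T).
rewrite ler_pdivlMr// ltr_pdivrMr// => /andP[h1 h2].
rewrite intrD in h2; rewrite (@residueE T (Num.floor (t / T) + n)) ?intrD//.
- by rewrite /residue; ring.
- by lra.
- by lra.
Qed.

Lemma residue_period T t : 0 < T -> residue T (t + T) = residue T t.
Proof. by move=> T0; rewrite -(residue_addz t 1 T0) mulr1z mulr1. Qed.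

Lemma residueDl T s t : 0 < T -> residue T (residue T s + t) = residue T (s + t).
Proof.
move=> T0; rewrite -(residue_addz _ (Num.floor (s / T)) T0).
by congr residue; rewrite /residue; ring.
Qed.

(** On [[0, T]], [Y] differs by a constant from a primitive [Phi] of [f] on the whole line. Inside a
    period the claim is the differentiability of [Phi]; at a multiple of [T] the expansions of [Phi]
    at 0 and at [T] are glued, using that the end values of [Y] and [f] match. *)
Lemma periodization_cder T f Y : 0 < T -> ccont f -> prim 0 T f Y ->
  f 0 = f T -> Y 0 = Y T ->
  cder (fun t => Y (residue T t)) (fun t => f (residue T t)).
Proof.
move=> T0 cf [_ _ H] f0T Y0T; have [Phi /[dup] HPhi /cderP dPhi] := ccont_primitive cf.
have YE s : 0 <= s -> s <= T -> Y s = Phi s + (Y 0 - Phi 0).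
  move=> s0 sT; have := H 0 s (lexx 0) s0 sT; rewrite (CI_FTC2 s0 cf HPhi).
  by move=> /eqP; rewrite subr_eq => /eqP ->; ring.
apply/cderP => t; set n := Num.floor (t / T).
have /andP[u0 uT] := residue_itv t T0; set u := residue T t in u0 uT *.
have uE : u = t - T * n%:~R by [].
have loc s : T * n%:~R <= s -> s < T * n%:~R + T ->
    Y (residue T s) = Phi (s - T * n%:~R) + (Y 0 - Phi 0).
  move=> h1 h2; rewrite (@residueE T n)//; last by rewrite intrD mulrDr mulr1.
  by rewrite YE//; lra.
have t_loc : Y u = Phi (t - T * n%:~R) + (Y 0 - Phi 0) by rewrite -loc//; lra.
move=> e e0; have [d d0 Hd] := dPhi u e e0.
have shiftE s : s - T * n%:~R - u = s - t by rewrite uE; ring.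
have [un|un] := ltP 0 u.
  exists (Num.min d (Num.min u (T - u))) => [|s]; first by rewrite !lt_min d0 un; lra.
  rewrite !lt_min => /andP[sd /andP[su sT]].
  have hs := ler_norm (s - t); have hs' := ler_norm (t - s).
  rewrite distrC in hs'; rewrite loc; [|by lra..]; rewrite t_loc.
  have := Hd (s - T * n%:~R); rewrite shiftE => /(_ sd).
  by rewrite uE (_ : Phi (s - T * n%:~R) - Phi (t - T * n%:~R) =
    Phi (s - T * n%:~R) + (Y 0 - Phi 0) - (Phi (t - T * n%:~R) + (Y 0 - Phi 0)))//; ring.
have uz : u = 0 by apply/eqP; rewrite eq_le un u0.
have tn : t = T * n%:~R by lra.
(* Points to the left of the junction belong to the end of the previous period, hence the expansion
   at [T]. *)
have [d' d'0 Hd'] := dPhi T e e0.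
exists (Num.min T (Num.min d d')) => [|s]; first by rewrite !lt_min T0 d0.
rewrite !lt_min => /andP[sT /andP[sd sd']].
have hs := ler_norm (s - t); have hs' := ler_norm (t - s); rewrite distrC in hs'.
have [ts|st] := leP t s.
  rewrite loc; [|by lra..]; rewrite t_loc.
  have := Hd (s - T * n%:~R); rewrite shiftE => /(_ sd).
  by rewrite uE (_ : Phi (s - T * n%:~R) - Phi (t - T * n%:~R) =
    Phi (s - T * n%:~R) + (Y 0 - Phi 0) - (Phi (t - T * n%:~R) + (Y 0 - Phi 0)))//; ring.
have -> : Y (residue T s) = Phi (s - t + T) + (Y 0 - Phi 0).
  have nE : T * (n - 1)%:~R = t - T by rewrite intrD mulrDr mulrN1 -tn.
  rewrite (@residueE T (n - 1))// ?nE; [|by lra|by rewrite subrK -tn].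
  rewrite YE; [|by lra..].
  by congr (Phi _ + _); ring.
have := Hd' (s - t + T); rewrite addrK => /(_ sd').
have -> : f u = f T by rewrite uz.
have -> : Y u = Phi T + (Y 0 - Phi 0) by rewrite uz {1}Y0T YE// ltW.
by rewrite (_ : Phi (s - t + T) - Phi T =
    Phi (s - t + T) + (Y 0 - Phi 0) - (Phi T + (Y 0 - Phi 0)))//; ring.
Qed.

End Periodization.

(** * Smoothness by differential algebra *)

Section DifferentialAlgebra.
Context {R : realType}.
Implicit Types (f g : R -> R[i]) (k : R[i]).

Lemma cder_cst k : cder (fun=> k) (fun=> 0 : R[i]).
Proof. by move=> t; split; exact: is_derive_cst. Qed.

Lemma cderD f g f' g' : cder f f' -> cder g g' ->
  cder (fun t => f t + g t) (fun t => f' t + g' t).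
Proof.
move=> Hf Hg t; have [f1 f2] := Hf t; have [g1 g2] := Hg t; split.
  under eq_fun do rewrite ReD.
  by rewrite ReD; exact: is_deriveD.
under eq_fun do rewrite ImD.
by rewrite ImD; exact: is_deriveD.
Qed.

Lemma cderJ f f' : cder f f' -> cder (fun t => (f t)^*%C) (fun t => (f' t)^*%C).
Proof.
move=> Hf t; have [f1 f2] := Hf t; split.
  by under eq_fun do rewrite ReJ; rewrite ReJ.
under eq_fun do rewrite ImJ.
by rewrite ImJ; exact: is_deriveN.
Qed.

Lemma cderM f g f' g' : cder f f' -> cder g g' ->
  cder (fun t => f t * g t) (fun t => f' t * g t + f t * g' t).
Proof.
move=> Hf Hg t; have [f1 f2] := Hf t; have [g1 g2] := Hg t; split.
  under eq_fun do rewrite ReM.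
  apply: is_derive_eq (is_deriveB (is_deriveM f1 g1) (is_deriveM f2 g2)) _.
  by rewrite /GRing.scale /= !ReImE; ring.
under eq_fun do rewrite ImM.
apply: is_derive_eq (is_deriveD (is_deriveM f1 g2) (is_deriveM f2 g1)) _.
by rewrite /GRing.scale /= !ReImE; ring.
Qed.

(** The polynomials in the members of [G] and their conjugates. Once the derivatives of the
    generators lie in it, this algebra is closed under differentiation, so all its members are
    smooth at once. *)
Inductive palg (G : (R -> R[i]) -> Prop) : (R -> R[i]) -> Prop :=
| palg_gen f : G f -> palg G f
| palg_cst k : palg G (fun=> k)
| palg_add f g : palg G f -> palg G g -> palg G (fun t => f t + g t)
| palg_mul f g : palg G f -> palg G g -> palg G (fun t => f t * g t)
| palg_conj f : palg G f -> palg G (fun t => (f t)^*%C).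

Lemma palg_cder (G : (R -> R[i]) -> Prop) :
  (forall f, G f -> exists2 f', palg G f' & cder f f') ->
  forall f, palg G f -> exists2 f', palg G f' & cder f f'.
Proof.
move=> HG f; elim=> {f} [f /HG//|k|f g pf [f' pf' df] pg [g' pg' dg]
  |f g pf [f' pf' df] pg [g' pg' dg]|f _ [f' pf' df]].
- by exists (fun=> 0); [exact: palg_cst|exact: cder_cst].
- by exists (fun t => f' t + g' t); [exact: palg_add|exact: cderD].
- exists (fun t => f' t * g t + f t * g' t); last exact: cderM.
  by apply: palg_add; exact: palg_mul.
- by exists (fun t => (f' t)^*%C); [exact: palg_conj|exact: cderJ].
Qed.

Lemma palg_smooth (G : (R -> R[i]) -> Prop) :
  (forall f, G f -> exists2 f', palg G f' & cder f f') ->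
  forall f, palg G f -> smooth f.
Proof.
move=> HG f pf n.
have [fn pfn [E1 E2]] : exists2 fn, palg G fn &
    derive1n n (fun s => complex.Re (f s)) = (fun s => complex.Re (fn s)) /\
    derive1n n (fun s => complex.Im (f s)) = (fun s => complex.Im (fn s)).
  elim: n => [|n [fn pfn [E1 E2]]]; first by exists f.
  have [f' pf' df] := palg_cder HG pfn; exists f' => //.
  rewrite !derive1nS E1 E2; split; apply/funext => t; rewrite derive1E;
    by have [[_ h1] [_ h2]] := df t.
have [f' _ df] := palg_cder HG pfn.
by move=> t; rewrite E1 E2; have [[h1 _] [h2 _]] := df t.
Qed.

End DifferentialAlgebra.

(** * Change of base point *)

Section ShiftedFrames.
Context {R : realType}.
Implicit Types (q x y : R -> R[i]) (a b c s t T : R) (l k : R[i]).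

Lemma prim_eq a b (f F G : R -> R[i]) : (forall t, a <= t <= b -> F t = G t) ->
  ccont G -> prim a b f F -> prim a b f G.
Proof.
move=> FG cG [fi _ H]; split=> // s t as_ st tb.
by rewrite -!FG ?H ?as_ ?(le_trans as_) ?(le_trans st).
Qed.

Lemma rowsol_eq a b q l (x y x' y' : R -> R[i]) :
  (forall t, a <= t <= b -> x t = x' t) -> (forall t, a <= t <= b -> y t = y' t) ->
  ccont x' -> ccont y' -> rowsol a b q l x y -> rowsol a b q l x' y'.
Proof.
move=> xx yy cx cy [px py]; split.
  apply: prim_ext (prim_eq xx cx px) => t tab; by rewrite xx// yy.
by apply: prim_ext (prim_eq yy cy py) => t tab; rewrite xx// yy.
Qed.

Lemma rowsol_coef_ccont q l x y : ccont q -> ccont x -> ccont y ->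
  ccont (fun t => 'i%C * l / 2 * x t - (q t)^*%C / 2 * y t) /\
  ccont (fun t => q t / 2 * x t - 'i%C * l / 2 * y t).
Proof.
move=> cq cx cy; split.
  apply: ccontB; apply: ccontM => //; first exact: ccont_cst.
  by apply: ccontM; [exact: ccontJ|exact: ccont_cst].
apply: ccontB; apply: ccontM => //; last exact: ccont_cst.
by apply: ccontM => //; exact: ccont_cst.
Qed.

Lemma rowsol_shift a b c q l x y : ccont q -> rowsol (a + c) (b + c) q l x y ->
  rowsol a b (fun t => q (t + c)) l (fun t => x (t + c)) (fun t => y (t + c)).
Proof.
move=> cq [px py]; have [_ cx _] := px; have [_ cy _] := py.
have [h1 h2] := rowsol_coef_ccont l cq cx cy.
by split; [exact: (prim_shift h1 px)|exact: (prim_shift h2 py)].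
Qed.

Lemma rowsol_cat a b c q l x y : a <= b -> b <= c -> ccont q ->
  rowsol a b q l x y -> rowsol b c q l x y -> rowsol a c q l x y.
Proof.
move=> ab bc cq [px py] [px' py']; have [_ cx _] := px; have [_ cy _] := py.
have [h1 h2] := rowsol_coef_ccont l cq cx cy.
by split; apply: (@prim_cat _ a b c) => //; exact: cin_cont.
Qed.

Lemma rowsol_ae a b q q' l x y : cin a b q' ->
  {ae @lebesgue_measure R, forall t, a <= t <= b -> q t = q' t} ->
  rowsol a b q l x y -> rowsol a b q' l x y.
Proof.
move=> qi E [px py]; have [_ cx _] := px; have [_ cy _] := py.
have hc : ccont (fun=> 'i%C * l / 2 : R[i]) := ccont_cst _.
split.
  apply: prim_ae px _ _.
    apply: cinB; first exact/cin_cont/ccontM.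
    by apply: cinM => //; apply: cinM; [exact: cinJ|exact: ccont_cst].
  move: E; apply: filterS; first exact: (ae_filter_ringOfSetsType (@lebesgue_measure R)).
  by move=> t Et tab; rewrite Et.
apply: prim_ae py _ _.
  apply: cinB; last exact/cin_cont/ccontM.
  by apply: cinM => //; apply: cinM => //; exact: ccont_cst.
move: E; apply: filterS; first exact: (ae_filter_ringOfSetsType (@lebesgue_measure R)).
by move=> t Et tab; rewrite Et.
Qed.

(** Converse of [frame_rowsol]: rows with the right initial values assemble into a frame. *)
Lemma rowsol_frame T q l (x y : 'I_2 -> R -> R[i]) : 0 <= T ->
  (forall i, rowsol 0 T q l (x i) (y i)) ->
  (forall i, x i 0 = (i == 0)%:R /\ y i 0 = (i == 1)%:R) ->
  frame_solution T q l (fun t => \matrix_(i, j) if j == 0 then x i t else y i t).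
Proof.
move=> T0 H H0 i j.
pose M t : 'M[R[i]]_2 := \matrix_(i, j) if j == 0 then x i t else y i t.
have [[xi cx Hx] [yi cy Hy]] := H i; have [x0 y0] := H0 i.
have E2 u : (M u *m alpha q u l) i j = x i u * alpha q u l 0 j + y i u * alpha q u l 1 j.
  rewrite mxE big_ord_recl big_ord1 (_ : lift ord0 ord0 = 1); last exact: val_inj.
  by rewrite /M !mxE.
have [Z [[cr ci] [ME [Z0 Zp]]]] : exists Z : R -> R[i], ccont Z /\
    (forall t, M t i j = Z t) /\ Z 0 = (i == j)%:R /\
    forall t, 0 <= t -> t <= T -> Z t - Z 0 =
      Cintegral 0 t (fun s => (M s *m alpha q s l) i j).
  have [j0|j1] : j = 0 \/ j = 1.
    by case: (j) => -[|[|//]] h; [left|right]; apply: val_inj.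
    exists (x i); split=> //; split; first by move=> t; rewrite mxE j0.
    split; first by rewrite x0 j0.
    move=> t t0 tT; rewrite Hx//; apply: CI_ext => s _.
    by rewrite E2 j0 !mxE /=; ring.
  exists (y i); split=> //; split; first by move=> t; rewrite mxE j1.
  split; first by rewrite y0 j1.
  move=> t t0 tT; rewrite Hy//; apply: CI_ext => s _.
  by rewrite E2 j1 !mxE /=; ring.
have EF : (fun t => M t i j) = Z by apply/funext.
split.
- rewrite (_ : (fun t => _) = (fun t => complex.Re (Z t))).
    exact: continuous_subspaceT.
  by apply/funext => t; rewrite -ME.
- rewrite (_ : (fun t => _) = (fun t => complex.Im (Z t))).
    exact: continuous_subspaceT.
  by apply/funext => t; rewrite -ME.
- move=> t /andP[t0 tT]; rewrite -/(M t) ME mxE -Z0.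
  by apply/eqP; rewrite addrC -subr_eq; apply/eqP; exact: Zp.
Qed.

End ShiftedFrames.

(** * The frame continued over two periods *)

Section PeriodicContinuation.
Context {R : realType}.
Variables (T : R) (q Q : R -> R[i]) (F : R -> R[i] -> 'M[R[i]]_2).
Hypotheses (T0 : 0 < T) (qi : cin 0 T q)
  (HF : forall l, frame_solution T q l (fun t => F t l))
  (cQ : ccont Q) (QT : forall t, Q (t + T) = Q t)
  (Qq : {ae @lebesgue_measure R, forall t, 0 <= t <= T -> q t = Q t}).
Implicit Types (s t x : R) (l : R[i]) (i j : 'I_2).

Let X i l t := F (clamp T t) l i 0.
Let Y i l t := F (clamp T t) l i 1.

(* Equals F on [0, T] and M F(. - T) on [T, 2T]; being written with clamped
   arguments it is continuous on the whole line. *)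
Let X' i l t := X i l t + (X i l T * X 0 l (t - T) + Y i l T * X 1 l (t - T)) - X i l T.
Let Y' i l t := Y i l t + (X i l T * Y 0 l (t - T) + Y i l T * Y 1 l (t - T)) - Y i l T.

Let init i l : X i l 0 = (i == 0)%:R /\ Y i l 0 = (i == 1)%:R.
Proof. exact: (frame_init T0 HF i l). Qed.

Let clamp_neg t : t <= 0 -> clamp T t = clamp T 0.
Proof.
move=> t0; rewrite (@clamp_id _ T 0) ?lexx ?(ltW T0)// /clamp.
by rewrite max_l// ge_min t0.
Qed.

Let clamp_large t : T <= t -> clamp T t = clamp T T.
Proof.
move=> Tt; rewrite (@clamp_id _ T T) ?lexx ?(ltW T0)// /clamp.
by rewrite min_r// max_r// ltW.
Qed.

(** For [t <= T] the clamped frame at [t - T] is the identity, so the two correction terms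
    cancel. *)
Let low i l t : t <= T -> X' i l t = X i l t /\ Y' i l t = Y i l t.
Proof.
move=> tT; have E : clamp T (t - T) = clamp T 0 by rewrite clamp_neg// subr_le0.
have [x0 y0] := init 0 l; have [x1 y1] := init 1 l.
have E0 k : X k l (t - T) = X k l 0 by rewrite /X E.
have E1 k : Y k l (t - T) = Y k l 0 by rewrite /Y E.
rewrite /X' /Y' !E0 !E1 x0 y0 x1 y1 /=; split; ring.
Qed.

Let high i l t : T <= t ->
  X' i l t = X i l T * X 0 l (t - T) + Y i l T * X 1 l (t - T) /\
  Y' i l t = X i l T * Y 0 l (t - T) + Y i l T * Y 1 l (t - T).
Proof.
move=> Tt; have E := clamp_large Tt.
have E0 : X i l t = X i l T by rewrite /X E.
have E1 : Y i l t = Y i l T by rewrite /Y E.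
rewrite /X' /Y' E0 E1; split; ring.
Qed.

Let rows i l : rowsol 0 T Q l (X i l) (Y i l).
Proof. exact: rowsol_ae (cin_cont _ _ cQ) Qq (frame_rows T0 qi HF i l). Qed.

(** [Q] is periodic, so translated rows, and their combinations by [M], solve the same system on
    [[T, 2T]]; the pieces agree at [T]. *)
Let rows2 i l : rowsol 0 (T + T) Q l (X' i l) (Y' i l).
Proof.
have cXY k v : ccont (X k v) /\ ccont (Y k v).
  by have [[_ ? _] [_ ? _]] := rows k v.
have cs : continuous (fun t => t - T).
  by move=> t; apply: cvgB; [exact: cvg_id|exact: cvg_cst].
have cX : ccont (X' i l).
  apply: ccontB; last exact: ccont_cst.
  apply: ccontD; first by have [] := cXY i l.
  by apply: ccontD; apply: ccontM; try exact: ccont_cst;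
    apply: ccont_comp => //; [have [] := cXY 0 l|have [] := cXY 1 l].
have cY : ccont (Y' i l).
  apply: ccontB; last exact: ccont_cst.
  apply: ccontD; first by have [] := cXY i l.
  by apply: ccontD; apply: ccontM; try exact: ccont_cst;
    apply: ccont_comp => //; [have [] := cXY 0 l|have [] := cXY 1 l].
have T0' : 0 <= T by exact: ltW.
have TT : T <= T + T by rewrite lerDl.
apply: (rowsol_cat T0' TT cQ).
  by apply: rowsol_eq (rows i l) => // t /andP[_ /(low i l)[]].
have QT' : (fun t => Q (t - T)) = Q.
  by apply/funext => t; rewrite -[in RHS](subrK T t) QT.
have r k : rowsol T (T + T) Q l (fun t => X k l (t - T)) (fun t => Y k l (t - T)).
  have := @rowsol_shift _ T (T + T) (- T) Q l (X k l) (Y k l) cQ.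
  by rewrite subrr addrK QT'; apply; exact: rows.
by apply: rowsol_eq (rowsol_lin (X i l T) (Y i l T) (r 0) (r 1)) => // t /andP[Tt _];
  have [] := high i l Tt.
Qed.

(** The frame based at [x] is [F(x)^-1 F(x + t)] with [F] continued beyond [T]; its value at [T] is
    [F(x)^-1 M F(x)], written out. *)
Lemma shifted_frame x : 0 <= x -> x <= T ->
  exists2 G : R -> R[i] -> 'M[R[i]]_2,
    forall l, frame_solution T (fun t => Q (x + t)) l (fun t => G t l) &
    forall l,
    [/\ G T l 0 0 = Y 1 l x * (X 0 l T * X 0 l x + Y 0 l T * X 1 l x) -
                    Y 0 l x * (X 1 l T * X 0 l x + Y 1 l T * X 1 l x),
        G T l 0 1 = Y 1 l x * (X 0 l T * Y 0 l x + Y 0 l T * Y 1 l x) -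
                    Y 0 l x * (X 1 l T * Y 0 l x + Y 1 l T * Y 1 l x),
        G T l 1 0 = X 0 l x * (X 1 l T * X 0 l x + Y 1 l T * X 1 l x) -
                    X 1 l x * (X 0 l T * X 0 l x + Y 0 l T * X 1 l x) &
        G T l 1 1 = X 0 l x * (X 1 l T * Y 0 l x + Y 1 l T * Y 1 l x) -
                    X 1 l x * (X 0 l T * Y 0 l x + Y 0 l T * Y 1 l x)].
Proof.
move=> x0 xT.
(* The entries of [F(x)^-1]. *)
pose k i j l := if i == 0 :> 'I_2 then (if j == 0 :> 'I_2 then Y 1 l x else - Y 0 l x)
  else (if j == 0 :> 'I_2 then - X 1 l x else X 0 l x).
pose gx i l t := k i 0 l * X' 0 l (t + x) + k i 1 l * X' 1 l (t + x).
pose gy i l t := k i 0 l * Y' 0 l (t + x) + k i 1 l * Y' 1 l (t + x).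
exists (fun t l => \matrix_(i, j) if j == 0 then gx i l t else gy i l t).
  move=> l; rewrite (_ : (fun t => Q (x + t)) = (fun t => Q (t + x))); last first.
    by apply/funext => t; rewrite addrC.
  apply: (rowsol_frame (x := fun i => gx i l) (y := fun i => gy i l)); first exact: ltW.
    move=> i; have rs j : rowsol 0 T (fun t => Q (t + x)) l (fun t => X' j l (t + x))
        (fun t => Y' j l (t + x)).
      apply: (rowsol_shift (a := 0) (b := T) cQ); apply: rowsol_sub (rows2 j l).
        by rewrite add0r.
      by rewrite lerD2l.
    exact: rowsol_lin (rs 0) (rs 1).
  have D : X 0 l x * Y 1 l x - Y 0 l x * X 1 l x = 1 := frame_det T0 qi HF l x0 xT.
  move=> i; rewrite /gx /gy !add0r.
  have [-> ->] := low 0 l xT; have [-> ->] := low 1 l xT.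
  have -> : (i == 0)%:R = (i == 0)%:R * (X 0 l x * Y 1 l x - Y 0 l x * X 1 l x).
    by rewrite D mulr1.
  have -> : (i == 1)%:R = (i == 1)%:R * (X 0 l x * Y 1 l x - Y 0 l x * X 1 l x).
    by rewrite D mulr1.
  by case: i => -[|[|//]] h; rewrite /k /=; split; ring.
move=> l; have Tx : T <= T + x by rewrite lerDl.
have E j : X' j l (T + x) = X j l T * X 0 l x + Y j l T * X 1 l x /\
    Y' j l (T + x) = X j l T * Y 0 l x + Y j l T * Y 1 l x.
  by have := high j l Tx; rewrite addrAC subrr add0r.
have [e1 e2] := E 0; have [e3 e4] := E 1.
by rewrite !mxE /gx /gy e1 e2 e3 e4 /k /=; split; ring.
Qed.

End PeriodicContinuation.

(** * Invariance of the greatest common divisor and of the finite gap property *)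

Section GcdTransfer.
Context {R : realType}.
Implicit Types (p f g e : R[i] -> R[i]).

(** A matrix of entire functions with determinant 1 is invertible over that ring, so conjugation by
    it and by its inverse preserves common divisors. The halves arise because the traceless part of
    [M] has the diagonal entry [(a - d) / 2]. *)
Lemma gcd_conj p (f1 f2 f3 x1 y1 x2 y2 : R[i] -> R[i]) :
  entire x1 -> entire y1 -> entire x2 -> entire y2 ->
  (forall l, x1 l * y2 l - y1 l * x2 l = 1) ->
  entire_gcd3 p f1 f2 f3 ->
  let c (w : R[i] -> R[i] -> R[i] -> R[i] -> R[i] -> R[i] -> R[i] -> R[i]) l := w (x1 l) (y1 l) (x2 l) (y2 l) (f1 l / 2) (f2 l) (f3 l) in
  entire_gcd3 p (fun l => 2 * c conj11 l) (c conj12) (c conj21).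
Proof.
move=> ex1 ey1 ex2 ey2 D [ep [[h1 eh1 H1] [h2 eh2 H2] [h3 eh3 H3]] Hmax] c.
have half (h : R[i] -> R[i]) : entire h -> entire (fun l => h l / 2).
  by move=> eh; exact: (@entireM R h (fun=> (2^-1 : R[i])) eh (@entire_cst R _)).
have two (h : R[i] -> R[i]) : entire h -> entire (fun l => 2 * h l).
  by move=> eh; exact: (@entireM R (fun=> (2 : R[i])) h (@entire_cst R _) eh).
split; first exact: ep.
  have [e1 e2 e3] := entire_conj ex1 ey1 ex2 ey2 (half _ eh1) eh2 eh3.
  have E l : f1 l / 2 = p l * (h1 l / 2) by rewrite H1 mulrA.
  have Z l := conjZ (p l) (x1 l) (y1 l) (x2 l) (y2 l) (h1 l / 2) (h2 l) (h3 l).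
  split.
  - exists (fun l => 2 * conj11 (x1 l) (y1 l) (x2 l) (y2 l) (h1 l / 2) (h2 l) (h3 l)).
      exact: two.
    by move=> l; rewrite /c E H2 H3; have [-> _ _] := Z l; ring.
  - exists (fun l => conj12 (x1 l) (y1 l) (x2 l) (y2 l) (h1 l / 2) (h2 l) (h3 l)).
      exact: e2.
    by move=> l; rewrite /c E H2 H3; have [_ -> _] := Z l.
  - exists (fun l => conj21 (x1 l) (y1 l) (x2 l) (y2 l) (h1 l / 2) (h2 l) (h3 l)).
      exact: e3.
    by move=> l; rewrite /c E H2 H3; have [_ _ ->] := Z l.
move=> e ee [k1 ek1 K1] [k2 ek2 K2] [k3 ek3 K3].
have [e1 e2 e3] := entire_conj ey2 (entireN ey1) (entireN ex2) ex1 (half _ ek1) ek2 ek3.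
have K1' l : c conj11 l = e l * (k1 l / 2) by rewrite mulrA -K1; field.
have I l := conj_conj_inv (f1 l / 2) (f2 l) (f3 l) (D l).
have Z l := conjZ (e l) (y2 l) (- y1 l) (- x2 l) (x1 l) (k1 l / 2) (k2 l) (k3 l).
have C1 l : conj11 (x1 l) (y1 l) (x2 l) (y2 l) (f1 l / 2) (f2 l) (f3 l) = e l * (k1 l / 2).
  exact: K1'.
have C2 l : conj12 (x1 l) (y1 l) (x2 l) (y2 l) (f1 l / 2) (f2 l) (f3 l) = e l * k2 l.
  exact: K2.
have C3 l : conj21 (x1 l) (y1 l) (x2 l) (y2 l) (f1 l / 2) (f2 l) (f3 l) = e l * k3 l.
  exact: K3.
apply: (Hmax e ee).
- exists (fun l => 2 * conj11 (y2 l) (- y1 l) (- x2 l) (x1 l) (k1 l / 2) (k2 l) (k3 l)).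
    exact: two.
  move=> l; have [I1 _ _] := I l; have [Z1 _ _] := Z l.
  have -> : f1 l = 2 * (f1 l / 2) by field.
  by rewrite -I1 C1 C2 C3 Z1; ring.
- exists (fun l => conj12 (y2 l) (- y1 l) (- x2 l) (x1 l) (k1 l / 2) (k2 l) (k3 l)).
    exact: e2.
  move=> l; have [_ I1 _] := I l; have [_ Z1 _] := Z l.
  by rewrite -[LHS]I1 C1 C2 C3 Z1.
- exists (fun l => conj21 (y2 l) (- y1 l) (- x2 l) (x1 l) (k1 l / 2) (k2 l) (k3 l)).
    exact: e3.
  move=> l; have [_ _ I1] := I l; have [_ _ Z1] := Z l.
  by rewrite -[LHS]I1 C1 C2 C3 Z1.
Qed.

Lemma entire_gcd3_ext p (f1 f2 f3 g1 g2 g3 : R[i] -> R[i]) :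
  f1 =1 g1 -> f2 =1 g2 -> f3 =1 g3 ->
  entire_gcd3 p f1 f2 f3 -> entire_gcd3 p g1 g2 g3.
Proof. by move=> /funext <- /funext <- /funext <-. Qed.

End GcdTransfer.

Section FiniteGap.
Context {R : realType}.
Implicit Types (T x t : R) (q Q : R -> R[i]).

Lemma finite_gap_shift T q Q x : 0 < T -> cin 0 T q -> ccont Q ->
  (forall t, Q (t + T) = Q t) ->
  {ae @lebesgue_measure R, forall t, 0 <= t <= T -> q t = Q t} ->
  finite_gap T q -> 0 <= x -> x <= T -> finite_gap T (fun t => Q (x + t)).
Proof.
move=> T0 qi cQ QT Qq [F HF [p [g [Hgcd p0 eg Hg fin]]]] x0 xT.
have [G HG GT] := shifted_frame T0 qi HF cQ QT Qq x0 xT.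
have TT : clamp T T = T by rewrite clamp_id// (ltW T0) lexx.
have xx : clamp T x = x by rewrite clamp_id// x0.
exists G => //; exists p, g.
have D l := frame_det T0 qi HF l x0 xT.
have e0 := frame_entire_clamp T0 qi HF 0 x0 xT.
have e1 := frame_entire_clamp T0 qi HF 1 x0 xT.
have GTl l := GT l; rewrite /= TT xx in GTl D e0 e1.
split; [|exact: p0|exact: eg| |exact: fin].
  have := gcd_conj e0.1 e0.2 e1.1 e1.2 D Hgcd.
  apply: entire_gcd3_ext => l; have [G1 G2 G3 G4] := GTl l.
  - by rewrite /= G1 G4 /conj11; field.
  - by rewrite /= G2 /conj12; field.
  - by rewrite /= G3 /conj21; field.
move=> l; rewrite -Hg; congr (_ ^+ 2 - 4); rewrite !mxtrace2.
have [G1 _ _ G4] := GTl l; rewrite G1 G4 -[RHS]mulr1 -(D l); ring.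
Qed.

Lemma finite_gap_coefs T q : 0 < T -> cin 0 T q -> finite_gap T q ->
  exists (pA pB pC : R -> {poly R[i]}) (m : nat) (kappa : R[i]),
  [/\ forall k, [/\
        prim 0 T (fun t => - ((q t)^*%C * (pB t)`_k + q t * (pC t)`_k) / 2)
          (fun t => (pA t)`_k),
        prim 0 T (fun t => q t * (pA t)`_k - 'i%C * ('X * pB t)`_k)
          (fun t => (pB t)`_k) &
        prim 0 T (fun t => (q t)^*%C * (pA t)`_k + 'i%C * ('X * pC t)`_k)
          (fun t => (pC t)`_k)],
      [/\ pA 0 = pA T, pB 0 = pB T & pC 0 = pC T] &
      {ae @lebesgue_measure R, forall t, 0 <= t <= T ->
        'i%C * ('X * pB t)`_m / kappa = q t}].
Proof.
move=> T0 qi [F HF [p [g [[ep [[h1 eh1 H1] [h2 eh2 H2] [h3 eh3 H3]] _] p0 eg Hg fin]]]].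
have [P [u [eu u0 gPu]]] := zeros_removal eg fin.
have TT : clamp T T = T by rewrite clamp_id// (ltW T0) lexx.
have eh1' : entire (fun l => h1 l * 2^-1).
  exact: (@entireM R h1 (fun=> (2^-1 : R[i])) eh1 (@entire_cst R _)).
have [||||N [pA [pB [pC [Hsz Hode Hend Hnz]]]]] :=
  killing_field (p := p) (g := g) (na := fun l => h1 l * 2^-1) (nb := h2) (nd := h3)
    T0 qi HF eh1' eh2 eh3 eu u0 _ _ _ _ gPu.
- by move=> l; rewrite TT H1; field.
- by move=> l; rewrite TT.
- by move=> l; rewrite TT.
- by move=> l; rewrite TT -Hg mxtrace2.
have [m [kappa E]] := potential_from_coefs T0 Hsz Hode Hnz.
by exists pA, pB, pC, m, kappa; split=> // k; exact: coef_ode Hsz Hode k.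
Qed.

End FiniteGap.

Theorem proposition6p4 (R : realType) (T : R) (T_gt0 : 0 < T)
    (q : R -> R[i]) (q_L2 : L2_potential T q) (q_fg : finite_gap T q) :
  exists Q : R -> R[i],
    [/\ {ae @lebesgue_measure R, forall t, 0 <= t <= T -> Q t = q t},
        smooth Q,
        (forall t, Q (t + T) = Q t) &
        finite_gap_line T Q].
Proof.
have qi := L2_cin q_L2.
have [pA [pB [pC [m [kappa [ode [endA endB endC] Qq]]]]]] :=
  finite_gap_coefs T_gt0 qi q_fg.
(* A continuous representative of [q] on [[0, T]]. *)
pose Q0 t := 'i%C * ('X * pB t)`_m / kappa.
pose Q t := Q0 (residue T t).
have QQ0 t : 0 <= t <= T -> Q t = Q0 t.
  move=> /andP[t0]; rewrite /Q le_eqVlt => /predU1P[->|tT].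
    (* At [t = T] the residue jumps to 0, so the end condition on [pB] is what makes [Q] and [Q0]
       agree there. *)
    have -> : residue T T = 0.
      by rewrite -[T in X in residue _ X](add0r T) residue_period// residue_id// lexx.
    by rewrite /Q0 endB.
  by rewrite residue_id// t0.
have QT t : Q (t + T) = Q t by rewrite /Q residue_period.
have cA k : ccont (fun t => (pA t)`_k) by have [[]] := ode k.
have cB k : ccont (fun t => (pB t)`_k) by have [_ []] := ode k.
have cC k : ccont (fun t => (pC t)`_k) by have [_ _ []] := ode k.
have cX (p : R -> {poly R[i]}) k : (forall j, ccont (fun t => (p t)`_j)) ->
    ccont (fun t => ('X * p t)`_k).
  move=> cp; case: k => [|k].
    rewrite (_ : (fun t => _) = fun=> 0); first exact: ccont_cst.
    by apply/funext => t; rewrite coefXM.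
  rewrite (_ : (fun t => _) = fun t => (p t)`_k); first exact: cp.
  by apply/funext => t; rewrite coefXM.
have cQ0 : ccont Q0.
  apply: ccontM; last exact: ccont_cst.
  by apply: ccontM; [exact: ccont_cst|exact: cX].
have q_Q0 : {ae @lebesgue_measure R, forall t, 0 <= t <= T -> q t = Q0 t}.
  move: Qq; apply: filterS; first exact: (ae_filter_ringOfSetsType (@lebesgue_measure R)).
  by move=> t H /H.
(* The right-hand sides of the Lax equation with [q] replaced by [Q0]. They are continuous, so the
   coefficients become continuously differentiable. *)
pose fA k t := - ((Q0 t)^*%C * (pB t)`_k + Q0 t * (pC t)`_k) / 2.
pose fB k t := Q0 t * (pA t)`_k - 'i%C * ('X * pB t)`_k.
pose fC k t := (Q0 t)^*%C * (pA t)`_k + 'i%C * ('X * pC t)`_k.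
have cfA k : ccont (fA k).
  apply: ccontM; last exact: ccont_cst.
  by apply: ccontN; apply: ccontD; apply: ccontM => //; exact: ccontJ.
have cfB k : ccont (fB k).
  by apply: ccontB; apply: ccontM => //; [exact: ccont_cst|exact: cX].
have cfC k : ccont (fC k).
  apply: ccontD; apply: ccontM => //; [exact: ccontJ|exact: ccont_cst|exact: cX].
have toQ0 (f f' Y : R -> R[i]) : ccont f' -> (forall t, q t = Q0 t -> f t = f' t) ->
    prim 0 T f Y -> prim 0 T f' Y.
  move=> cf' ff' pY; apply: prim_ae pY (cin_cont _ _ cf') _.
  move: q_Q0; apply: filterS; first exact: (ae_filter_ringOfSetsType (@lebesgue_measure R)).
  by move=> t H /H; exact: ff'.
have pAk k : prim 0 T (fA k) (fun t => (pA t)`_k).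
  by have [h _ _] := ode k; apply: toQ0 h => // t; rewrite /fA => ->.
have pBk k : prim 0 T (fB k) (fun t => (pB t)`_k).
  by have [_ h _] := ode k; apply: toQ0 h => // t; rewrite /fB => ->.
have pCk k : prim 0 T (fC k) (fun t => (pC t)`_k).
  by have [_ _ h] := ode k; apply: toQ0 h => // t; rewrite /fC => ->.
(* The generators are the periodized coefficients. [Q] is itself a multiple of one of them, or 0, so
   their derivatives are polynomials in the generators and their conjugates. *)
pose G (h : R -> R[i]) := exists k, h = (fun t => (pA (residue T t))`_k) \/
  h = (fun t => (pB (residue T t))`_k) \/ h = (fun t => (pC (residue T t))`_k).
have gA k : palg G (fun t => (pA (residue T t))`_k) by apply: palg_gen; exists k; left.
have gB k : palg G (fun t => (pB (residue T t))`_k).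
  by apply: palg_gen; exists k; right; left.
have gC k : palg G (fun t => (pC (residue T t))`_k).
  by apply: palg_gen; exists k; right; right.
have gX (p : R -> {poly R[i]}) k : (forall j, palg G (fun t => (p (residue T t))`_j)) ->
    palg G (fun t => ('X * p (residue T t))`_k).
  move=> gp; case: k => [|k].
    rewrite (_ : (fun t => _) = fun=> 0); first exact: palg_cst.
    by apply/funext => t; rewrite coefXM.
  rewrite (_ : (fun t => _) = fun t => (p (residue T t))`_k); first exact: gp.
  by apply/funext => t; rewrite coefXM.
have gQ : palg G Q.
  apply: (palg_mul (g := fun=> kappa^-1)); last exact: palg_cst.
  by apply: (palg_mul (f := fun=> 'i%C)); [exact: palg_cst|exact: gX].
have gQJ : palg G (fun t => (Q t)^*%C) by exact: palg_conj.
have Gder h : G h -> exists2 h', palg G h' & cder h h'.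
  move=> [k [->|[->|->]]].
  - exists (fun t => fA k (residue T t)).
      rewrite (_ : (fun t => _) = fun t => (- 2^-1) * ((Q t)^*%C * (pB (residue T t))`_k +
        Q t * (pC (residue T t))`_k)); last first.
        by apply/funext => t; rewrite /fA -/(Q t); ring.
      apply: palg_mul; first exact: palg_cst.
      by apply: palg_add; exact: palg_mul.
    apply: (periodization_cder T_gt0 (cfA k) (pAk k)); last by rewrite endA.
    by rewrite /fA /Q0 endB endC.
  - exists (fun t => fB k (residue T t)).
      rewrite (_ : (fun t => _) = fun t => Q t * (pA (residue T t))`_k +
        (- 'i%C) * ('X * pB (residue T t))`_k); last first.
        by apply/funext => t; rewrite /fB -/(Q t); ring.
      apply: palg_add; first exact: palg_mul.
      by apply: palg_mul; [exact: palg_cst|exact: gX].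
    apply: (periodization_cder T_gt0 (cfB k) (pBk k)); last by rewrite endB.
    by rewrite /fB /Q0 endB endA.
  - exists (fun t => fC k (residue T t)).
      rewrite (_ : (fun t => _) = fun t => (Q t)^*%C * (pA (residue T t))`_k +
        'i%C * ('X * pC (residue T t))`_k)//.
      apply: palg_add; first exact: palg_mul.
      by apply: palg_mul; [exact: palg_cst|exact: gX].
    apply: (periodization_cder T_gt0 (cfC k) (pCk k)); last by rewrite endC.
    by rewrite /fC /Q0 endB endC endA.
have cQ : ccont Q by have [h' _ dQ] := palg_cder Gder gQ; exact: cder_ccont dQ.
have q_Q : {ae @lebesgue_measure R, forall t, 0 <= t <= T -> q t = Q t}.
  move: q_Q0; apply: filterS; first exact: (ae_filter_ringOfSetsType (@lebesgue_measure R)).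
  by move=> t H tT; rewrite QQ0// H.
exists Q; split; [|  |exact: QT|].
- move: q_Q; apply: filterS; first exact: (ae_filter_ringOfSetsType (@lebesgue_measure R)).
  by move=> t H /H.
- exact: palg_smooth Gder _ gQ.
(* By periodicity only base points in [[0, T)] have to be considered. *)
- move=> x; have /andP[x0 xT] := residue_itv x T_gt0.
  have := finite_gap_shift T_gt0 qi cQ QT q_Q q_fg x0 (ltW xT).
  rewrite (_ : (fun t => Q (residue T x + t)) = (fun t => Q (x + t)))//.
  by apply/funext => t; rewrite /Q residueDl.
Qed.
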